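(* Let $f:X_1\to X_2$, $p_1:X_1\to X$, $p_2:X_2\to X$ be $\infty$-functors with $p_2f=p_1$, and suppose that $X$ is a ($1$-)category. If for every object $x$ of $X$ the $\infty$-functor $x\backslash f:x\backslash X_1\to x\backslash X_2$ is a polygraphic equivalence, then $f$ is a polygraphic equivalence.
   Context: **$\infty$-categories.** All $\infty$-categories are small strict $\infty$-categories and all $\infty$-functors are strict; no invertibility of cells is assumed. $\infty\text{-}\mathrm{Cat}$ is their category. For an $\infty$-category $X$, $X_n$ is the set of $n$-cells (objects if $n=0$); for $x\in X_n$, $0\le i\le n$, $s_ix,t_ix\in X_i$ are the iterated $i$-source and $i$-target ($s_nx=x=t_nx$), $1_x$ is the unit of $x$; if $t_ix_0=s_ix_1$, $x_1*_ix_0$ is the $i$-composite ($x_0$ followed by $x_1$). A $1$-category is viewed as an $\infty$-category with only unit $i$-cells for $i>1$. $X^\circ$ is the total dual (all $i$-cells, $i>0$, reversed). The fundamental category $c_1(X)$ has the objects of $X$ and as arrows the $1$-cells of $X$, two being identified when connected by a zigzag of $2$-cells; the fundamental groupoid $\Pi_1(X)$ is obtained from $c_1(X)$ by formally inverting all arrows. **Slices.** For a $1$-category $X$, an object $x$ of $X$ and an $\infty$-functor $X'\to X$, $x\backslash X'$ denotes the fibre product $X'\times_X(x\backslash X)$, where $x\backslash X$ is the usual category of objects of $X$ under $x$ with its forgetful functor to $X$; $x\backslash f$ is the $\infty$-functor induced by $f$. **Local systems.** A local system on $X$ is an $\infty$-functor $M:X^\circ\to\mathrm{Ab}$ ($\mathrm{Ab}$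 the $1$-category of abelian groups), given by groups $M_x$ for objects $x$ and contravariantly functorial morphisms $x^*:M_{x_1}\to M_{x_0}$ for $1$-cells $x:x_0\to x_1$, such that all $x^*$ are isomorphisms. For $f:X'\to X$, $f^*(M)=M\circ f^\circ$. **The complex.** $\mathrm{C}(X,M)$ is the chain complex with $\mathrm{C}_n(X,M)=\bigoplus_{x\in X_n}M_{t_0x}/\sim_n$, where $\sim_n$ is the smallest equivalence relation compatible with addition such that $(x_1*_0x_0,m)\sim_n(x_1,m)+(x_0,t_1(x_1)^*(m))$ and, for $0<i<n$, $(x_1*_ix_0,m)\sim_n(x_1,m)+(x_0,m)$, whenever these composites of $n$-cells make sense (no relation if $n=0$); $d_1(x,m)=(t_0x,m)-(s_0x,x^*m)$, $d_n(x,m)=(t_{n-1}x,m)-(s_{n-1}x,m)$ for $n>1$. An $\infty$-functor $f:X'\to X$ induces $\mathrm{C}(f,M):\mathrm{C}(X',f^*(M))\to\mathrm{C}(X,M)$, $(x',m)\mapsto(f(x'),m)$. **Polygraphic homology and polygraphic equivalences.** The folk model structure on $\infty\text{-}\mathrm{Cat}$ (Lafont–Métayer–Worytkiewicz) has cofibrations generated by the inclusions $i_n:S^{n-1}\hookrightarrow D_n$, $n\ge 0$, where $D_n$ is the $n$-category with exactly one non-trivial $n$-cell $\zeta_n$ and exactly two non-trivial $i$-cells $s_i\zeta_n,t_i\zeta_n$ for $0\le i<n$, and $S^{n-1}$ is $D_n$ with $\zeta_n$ removed; trivial fibrations are the maps with the right lifting property with respect to the $i_n$, and cofibrant objects are the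 polygraphs. A polygraphic resolution of $X$ is a trivial fibration $p:P\to X$ with $P$ a polygraph. One sets $\mathrm{H}^{\mathrm{pol}}_n(X,M)=\mathrm{H}_n(\mathrm{C}(P,p^*(M)))$, independent of the resolution up to canonical isomorphism. For $f:X'\to X$, resolutions $p',p$ and a lift $\tilde f:P'\to P$ with $p\tilde f=fp'$, $\mathrm{H}^{\mathrm{pol}}_n(f,M):\mathrm{H}^{\mathrm{pol}}_n(X',f^*(M))\to\mathrm{H}^{\mathrm{pol}}_n(X,M)$ is induced by $\mathrm{C}(\tilde f,p^*(M))$. An $\infty$-functor $f:X'\to X$ is a polygraphic equivalence if $\Pi_1(f)$ is an equivalence of groupoids and $\mathrm{H}^{\mathrm{pol}}_n(f,M)$ is an isomorphism for every local system $M$ on $X$ and every $n\ge0$. *)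

(* Defs.v *)
From HB Require Import structures.
From mathcomp Require Import all_boot all_algebra generic_quotient ring_quotient.
From mathcomp Require Import boolp classical_sets functions cardinality fsbigop.
From mathcomp Require Import zify.
From Stdlib Require Import Relation_Operators.

Set Implicit Arguments.
Unset Strict Implicit.
Unset Printing Implicit Defensive.

Import GRing.Theory.
Local Open Scope ring_scope.
Local Open Scope quotient_scope.

(* [src], [trg] and [idn] are the iterated operations: for [i <= n],
   [src (i := i)] is s_i on n-cells and [idn] sends an i-cell to the n-cell
   obtained from it by n - i successive units. [comp i x1 x0] is x1 *_i x0,
   that is x0 followed by x1. Equations between composites are stated for all
   proofs of composability, which are irrelevant. *)
Record infcat := InfCat {
  cell :> nat -> Type;
  src : forall i n, (i <= n)%N -> cell n -> cell i;
  trg : forall i n, (i <= n)%N -> cell n -> cell i;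
  idn : forall i n, (i <= n)%N -> cell i -> cell n;
  comp : forall i n (lt_in : (i < n)%N) (x1 x0 : cell n),
    trg (ltnW lt_in) x0 = src (ltnW lt_in) x1 -> cell n;
  src_id : forall n (h : (n <= n)%N) (x : cell n), src h x = x;
  trg_id : forall n (h : (n <= n)%N) (x : cell n), trg h x = x;
  src_src : forall i j n (hij : (i <= j)%N) (hjn : (j <= n)%N) (hin : (i <= n)%N)
    (x : cell n), src hij (src hjn x) = src hin x;
  trg_trg : forall i j n (hij : (i <= j)%N) (hjn : (j <= n)%N) (hin : (i <= n)%N)
    (x : cell n), trg hij (trg hjn x) = trg hin x;
  src_trg : forall i j n (lt_ij : (i < j)%N) (hjn : (j <= n)%N) (hin : (i <= n)%N)
    (x : cell n), src (ltnW lt_ij) (trg hjn x) = src hin x;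
  trg_src : forall i j n (lt_ij : (i < j)%N) (hjn : (j <= n)%N) (hin : (i <= n)%N)
    (x : cell n), trg (ltnW lt_ij) (src hjn x) = trg hin x;
  idn_id : forall n (h : (n <= n)%N) (x : cell n), idn h x = x;
  idn_idn : forall i j n (hij : (i <= j)%N) (hjn : (j <= n)%N) (hin : (i <= n)%N)
    (x : cell i), idn hjn (idn hij x) = idn hin x;
  src_idn_hi : forall i j n (hij : (i <= j)%N) (hjn : (j <= n)%N) (hin : (i <= n)%N)
    (x : cell i), src hjn (idn hin x) = idn hij x;
  trg_idn_hi : forall i j n (hij : (i <= j)%N) (hjn : (j <= n)%N) (hin : (i <= n)%N)
    (x : cell i), trg hjn (idn hin x) = idn hij x;
  src_idn_lo : forall j i n (hji : (j <= i)%N) (hin : (i <= n)%N) (hjn : (j <= n)%N)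
    (x : cell i), src hjn (idn hin x) = src hji x;
  trg_idn_lo : forall j i n (hji : (j <= i)%N) (hin : (i <= n)%N) (hjn : (j <= n)%N)
    (x : cell i), trg hjn (idn hin x) = trg hji x;
  src_comp : forall i n (lt_in : (i < n)%N) (x1 x0 : cell n)
    (e : trg (ltnW lt_in) x0 = src (ltnW lt_in) x1),
    src (ltnW lt_in) (comp e) = src (ltnW lt_in) x0;
  trg_comp : forall i n (lt_in : (i < n)%N) (x1 x0 : cell n)
    (e : trg (ltnW lt_in) x0 = src (ltnW lt_in) x1),
    trg (ltnW lt_in) (comp e) = trg (ltnW lt_in) x1;
  src_comp_hi : forall i j n (lt_ij : (i < j)%N) (hjn : (j <= n)%N)
    (lt_in : (i < n)%N) (x1 x0 : cell n)
    (e : trg (ltnW lt_in) x0 = src (ltnW lt_in) x1)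
    (e' : trg (ltnW lt_ij) (src hjn x0) = src (ltnW lt_ij) (src hjn x1)),
    src hjn (comp e) = comp e';
  trg_comp_hi : forall i j n (lt_ij : (i < j)%N) (hjn : (j <= n)%N)
    (lt_in : (i < n)%N) (x1 x0 : cell n)
    (e : trg (ltnW lt_in) x0 = src (ltnW lt_in) x1)
    (e' : trg (ltnW lt_ij) (trg hjn x0) = src (ltnW lt_ij) (trg hjn x1)),
    trg hjn (comp e) = comp e';
  comp_idr : forall i n (lt_in : (i < n)%N) (x : cell n)
    (e : trg (ltnW lt_in) (idn (ltnW lt_in) (src (ltnW lt_in) x)) =
         src (ltnW lt_in) x), comp e = x;
  comp_idl : forall i n (lt_in : (i < n)%N) (x : cell n)
    (e : trg (ltnW lt_in) x =
         src (ltnW lt_in) (idn (ltnW lt_in) (trg (ltnW lt_in) x))), comp e = x;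
  idn_comp : forall i n k (lt_in : (i < n)%N) (hnk : (n <= k)%N) (lt_ik : (i < k)%N)
    (x1 x0 : cell n) (e : trg (ltnW lt_in) x0 = src (ltnW lt_in) x1)
    (e' : trg (ltnW lt_ik) (idn hnk x0) = src (ltnW lt_ik) (idn hnk x1)),
    idn hnk (comp e) = comp e';
  comp_assoc : forall i n (lt_in : (i < n)%N) (x2 x1 x0 : cell n)
    (e10 : trg (ltnW lt_in) x0 = src (ltnW lt_in) x1)
    (e21 : trg (ltnW lt_in) x1 = src (ltnW lt_in) x2)
    (el : trg (ltnW lt_in) (comp e10) = src (ltnW lt_in) x2)
    (er : trg (ltnW lt_in) x0 = src (ltnW lt_in) (comp e21)),
    comp el = comp er;
  comp_exchange : forall i j n (lt_ij : (i < j)%N) (lt_jn : (j < n)%N)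
    (lt_in : (i < n)%N) (y1 y0 x1 x0 : cell n)
    (ey : trg (ltnW lt_jn) y0 = src (ltnW lt_jn) y1)
    (ex : trg (ltnW lt_jn) x0 = src (ltnW lt_jn) x1)
    (eyx : trg (ltnW lt_in) (comp ex) = src (ltnW lt_in) (comp ey))
    (e1 : trg (ltnW lt_in) x1 = src (ltnW lt_in) y1)
    (e0 : trg (ltnW lt_in) x0 = src (ltnW lt_in) y0)
    (e10 : trg (ltnW lt_jn) (comp e0) = src (ltnW lt_jn) (comp e1)),
    comp eyx = comp e10
}.

Arguments src {_ i n} _ _.
Arguments trg {_ i n} _ _.
Arguments idn {_ i n} _ _.
Arguments comp {_ i n} _ _ _ _.

Notation src0 x := (src (leq0n _) x).
Notation trg0 x := (trg (leq0n _) x).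

Lemma comp_congr (X : infcat) i n (h h' : (i < n)%N) (x1 x0 y1 y0 : X n) e e' :
  x1 = y1 -> x0 = y0 -> comp h x1 x0 e = comp h' y1 y0 e'.
Proof.
move=> e1 e0; subst; rewrite (bool_irrelevance h h') in e *.
by rewrite (Prop_irrelevance e e').
Qed.

Record functor (X Y : infcat) := Functor {
  fap : forall n, X n -> Y n;
  fap_src : forall i n (h : (i <= n)%N) (x : X n), fap (src h x) = src h (fap x);
  fap_trg : forall i n (h : (i <= n)%N) (x : X n), fap (trg h x) = trg h (fap x);
  fap_idn : forall i n (h : (i <= n)%N) (x : X i), fap (idn h x) = idn h (fap x);
  fap_comp : forall i n (h : (i < n)%N) (x1 x0 : X n) e e',
    fap (comp h x1 x0 e) = comp h (fap x1) (fap x0) e'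
}.

Arguments fap {X Y} _ {n} _.

Lemma functor_eq (X Y : infcat) (f g : functor X Y) :
  (forall n (x : X n), fap f x = fap g x) -> f = g.
Proof.
case: f g => [f f1 f2 f3 f4] [g g1 g2 g3 g4] /= fg.
have E : f = g by apply: functional_extensionality_dep => n; apply/funext/fg.
by subst; congr Functor; apply: Prop_irrelevance.
Qed.

Lemma fap_composable (X Y : infcat) (f : functor X Y) i n (h : (i <= n)%N)
  (x1 x0 : X n) : trg h x0 = src h x1 -> trg h (fap f x0) = src h (fap f x1).
Proof. by move=> e; rewrite -fap_trg e fap_src. Qed.

Program Definition fcomp (X Y Z : infcat) (g : functor Y Z) (f : functor X Y) :
  functor X Z := @Functor X Z (fun n x => fap g (fap f x)) _ _ _ _.
Next Obligation. by rewrite !fap_src. Qed.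
Next Obligation. by rewrite !fap_trg. Qed.
Next Obligation. by rewrite !fap_idn. Qed.
Next Obligation.
have e1 := fap_composable f e; rewrite (fap_comp e e1).
exact: fap_comp.
Qed.

Section FibreProduct.
Variables (A B C : infcat) (f : functor A C) (g : functor B C).

Record fpcell n := FPCell {
  fpl : A n;
  fpr : B n;
  fp_eq : fap f fpl = fap g fpr
}.

Lemma fpcell_eq n (x y : fpcell n) : fpl x = fpl y -> fpr x = fpr y -> x = y.
Proof.
case: x y => [a b e] [a' b' e'] /= ea eb; subst.
by congr FPCell; apply: Prop_irrelevance.
Qed.

Program Definition fpsrc i n (h : (i <= n)%N) (x : fpcell n) : fpcell i :=
  @FPCell i (src h (fpl x)) (src h (fpr x)) _.
Next Obligation. by rewrite !fap_src fp_eq. Qed.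

Program Definition fptrg i n (h : (i <= n)%N) (x : fpcell n) : fpcell i :=
  @FPCell i (trg h (fpl x)) (trg h (fpr x)) _.
Next Obligation. by rewrite !fap_trg fp_eq. Qed.

Program Definition fpidn i n (h : (i <= n)%N) (x : fpcell i) : fpcell n :=
  @FPCell n (idn h (fpl x)) (idn h (fpr x)) _.
Next Obligation. by rewrite !fap_idn fp_eq. Qed.

Program Definition fpcomp i n (h : (i < n)%N) (x1 x0 : fpcell n)
  (e : fptrg (ltnW h) x0 = fpsrc (ltnW h) x1) : fpcell n :=
  @FPCell n (comp h (fpl x1) (fpl x0) (congr1 (@fpl i) e))
            (comp h (fpr x1) (fpr x0) (congr1 (@fpr i) e)) _.
Next Obligation.
have el := fap_composable f (congr1 (@fpl i) e).
have er := fap_composable g (congr1 (@fpr i) e).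
rewrite (fap_comp _ el) (fap_comp _ er).
by apply: comp_congr; apply: fp_eq.
Qed.

Program Definition fprod : infcat :=
  @InfCat fpcell fpsrc fptrg fpidn fpcomp
    _ _ _ _ _ _ _ _ _ _ _ _ _ _ _ _ _ _ _ _ _.
Next Obligation. by apply: fpcell_eq; apply: src_id. Qed.
Next Obligation. by apply: fpcell_eq; apply: trg_id. Qed.
Next Obligation. by apply: fpcell_eq; apply: src_src. Qed.
Next Obligation. by apply: fpcell_eq; apply: trg_trg. Qed.
Next Obligation. by apply: fpcell_eq; apply: src_trg. Qed.
Next Obligation. by apply: fpcell_eq; apply: trg_src. Qed.
Next Obligation. by apply: fpcell_eq; apply: idn_id. Qed.
Next Obligation. by apply: fpcell_eq; apply: idn_idn. Qed.
Next Obligation. by apply: fpcell_eq; apply: src_idn_hi. Qed.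
Next Obligation. by apply: fpcell_eq; apply: trg_idn_hi. Qed.
Next Obligation. by apply: fpcell_eq; apply: src_idn_lo. Qed.
Next Obligation. by apply: fpcell_eq; apply: trg_idn_lo. Qed.
Next Obligation. by apply: fpcell_eq; apply: src_comp. Qed.
Next Obligation. by apply: fpcell_eq; apply: trg_comp. Qed.
Next Obligation. by apply: fpcell_eq; apply: src_comp_hi. Qed.
Next Obligation. by apply: fpcell_eq; apply: trg_comp_hi. Qed.
Next Obligation. by apply: fpcell_eq; apply: comp_idr. Qed.
Next Obligation. by apply: fpcell_eq; apply: comp_idl. Qed.
Next Obligation. by apply: fpcell_eq; apply: idn_comp. Qed.
Next Obligation. by apply: fpcell_eq; apply: comp_assoc. Qed.
Next Obligation. by apply: fpcell_eq; apply: comp_exchange. Qed.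

End FibreProduct.

(* Cells of the infinite-dimensional sphere: a k-cell is a pair [(j, b)] with
   [j <= k], namely the (iterated unit of the) non-trivial j-cell which is a
   source if [b = false] and a target if [b = true]. D_n and S^{n-1} are the
   sub-infinity-categories cut out by a predicate on such pairs; the principal
   cell of D_n is taken to be [(n, true)]. *)
Section Globe.
Variable ok : nat * bool -> bool.
Hypothesis ok_down : forall i b c, ok c -> (i < c.1)%N -> ok (i, b).

Record gcell k := GCell {
  gval : nat * bool;
  gval_le : (gval.1 <= k)%N;
  gval_ok : ok gval
}.

Lemma gcell_eq k (x y : gcell k) : gval x = gval y -> x = y.
Proof.
by case: x y => [x h o] [y h' o'] /= e; subst; congr GCell; apply: bool_irrelevance.
Qed.

Program Definition gface (b : bool) i k (h : (i <= k)%N) (x : gcell k) : gcell i :=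
  @GCell i (if ((gval x).1 <= i)%N then gval x else (i, b)) _ _.
Next Obligation. by case: ifP. Qed.
Next Obligation.
case: ifPn => [_|]; first exact: gval_ok.
by rewrite -ltnNge => lt; apply: (ok_down b (gval_ok x) lt).
Qed.

Program Definition gidn i k (h : (i <= k)%N) (x : gcell i) : gcell k :=
  @GCell k (gval x) (leq_trans (gval_le x) h) (gval_ok x).

(* Of two i-composable cells, at least one is a unit on an i-cell. *)
Definition gcomp i k (h : (i < k)%N) (x1 x0 : gcell k)
  (e : gface true (ltnW h) x0 = gface false (ltnW h) x1) : gcell k :=
  if ((gval x1).1 <= i)%N then x0 else x1.

Lemma gvalE k (x : gcell k) : ((gval x).1 <= k)%N = true.
Proof. exact: gval_le. Qed.

Lemma gval_face b i k (h : (i <= k)%N) (x : gcell k) :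
  gval (gface b h x) = if ((gval x).1 <= i)%N then gval x else (i, b).
Proof. by []. Qed.

Lemma gval_idn i k (h : (i <= k)%N) (x : gcell i) : gval (gidn h x) = gval x.
Proof. by []. Qed.

Lemma gval_comp i k (h : (i < k)%N) (x1 x0 : gcell k) e :
  gval (@gcomp i k h x1 x0 e) =
  if ((gval x1).1 <= i)%N then gval x0 else gval x1.
Proof. by rewrite /gcomp; case: ifP. Qed.

Ltac gsolve :=
  intros; apply: gcell_eq;
  rewrite ?(gval_face, gval_comp, gval_idn);
  repeat match goal with
  | e : gface _ _ _ = gface _ _ _ |- _ =>
    let E := fresh "E" in
    have E := congr1 (@gval _) e;
    rewrite ?(gval_face, gval_comp, gval_idn) in E; clear e
  end;
  repeat match goal with
  | x : gcell _ |- _ =>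
    let v := fresh "v" in let j := fresh "j" in let b := fresh "b" in
    have := gval_le x; set v := gval x in *; clearbody v; clear x;
    case: v => j b in *; move=> /= ?
  end;
  simpl in *;
  repeat match goal with
  | |- context [if ?b then _ else _] => destruct b eqn:?; simpl in *
  | H : context [if ?b then _ else _] |- _ => destruct b eqn:?; simpl in *
  end;
  repeat match goal with H : (_, _) = (_, _) |- _ => injection H as ? ?; subst end;
  try (congr pair); try reflexivity; try congruence; try (exfalso; lia); try lia.

Program Definition globe : infcat :=
  @InfCat gcell (gface false) (gface true) gidn gcomp
    _ _ _ _ _ _ _ _ _ _ _ _ _ _ _ _ _ _ _ _ _.
Next Obligation. by apply: gcell_eq; rewrite gval_face gvalE. Qed.
Next Obligation. by apply: gcell_eq; rewrite gval_face gvalE. Qed.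
Next Obligation. gsolve. Qed.
Next Obligation. gsolve. Qed.
Next Obligation. gsolve. Qed.
Next Obligation. gsolve. Qed.
Next Obligation. gsolve. Qed.
Next Obligation. gsolve. Qed.
Next Obligation. by apply: gcell_eq; rewrite gval_face !gval_idn (leq_trans (gval_le x) hij). Qed.
Next Obligation. by apply: gcell_eq; rewrite gval_face !gval_idn (leq_trans (gval_le x) hij). Qed.
Next Obligation. gsolve. Qed.
Next Obligation. gsolve. Qed.
Next Obligation. gsolve. Qed.
Next Obligation. gsolve. Qed.
Next Obligation. gsolve. Qed.
Next Obligation. gsolve. Qed.
Next Obligation. gsolve. Qed.
Next Obligation. gsolve. Qed.
Next Obligation. gsolve. Qed.
Next Obligation. gsolve. Qed.
Next Obligation. gsolve. Qed.

End Globe.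

Lemma sphere_down n i (b : bool) (c : nat * bool) : (c.1 < n)%N -> (i < c.1)%N -> (i < n)%N.
Proof. by move=> h h'; apply: ltn_trans h' h. Qed.

Lemma disk_down n i (b : bool) (c : nat * bool) :
  ((c.1 < n)%N || (c == (n, true))) -> (i < c.1)%N ->
  (i < n)%N || ((i, b) == (n, true)).
Proof.
by case/orP=> [h h'|/eqP -> /= ->] //; rewrite (ltn_trans h' h).
Qed.

Definition disk n : infcat := globe (@disk_down n).

(* [sphere n] is S^{n-1}; it is empty for [n = 0]. *)
Definition sphere n : infcat := globe (ok := fun c => (c.1 < n)%N) (@sphere_down n).

Program Definition sphere_incl n : functor (sphere n) (disk n) :=
  @Functor (sphere n) (disk n) (fun k x => @GCell _ k (gval x) (gval_le x) _)
    _ _ _ _.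
Next Obligation. by rewrite (gval_ok x). Qed.
Next Obligation. exact: gcell_eq. Qed.
Next Obligation. exact: gcell_eq. Qed.
Next Obligation. exact: gcell_eq. Qed.
Next Obligation. by apply: gcell_eq; rewrite /= !gval_comp. Qed.

Definition has_rlp (A B X Y : infcat) (i : functor A B) (p : functor X Y) :=
  forall (a : functor A X) (b : functor B Y), fcomp p a = fcomp b i ->
  exists2 l : functor B X, fcomp l i = a & fcomp p l = b.

Definition trivial_fibration (X Y : infcat) (p : functor X Y) :=
  forall n, has_rlp (sphere_incl n) p.

(* [B] is obtained from [A] by freely attaching n-cells: [j] is a pushout of a
   coproduct of copies of S^{n-1} -> D_n, indexed by the generators. *)
Definition attaches_cells n (A B : infcat) (j : functor A B) :=
  exists (I : Type) (bd : I -> functor (sphere n) A) (gen : I -> functor (disk n) B),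
    (forall i, fcomp j (bd i) = fcomp (gen i) (sphere_incl n)) /\
    forall (Y : infcat) (g : functor A Y) (h : I -> functor (disk n) Y),
      (forall i, fcomp g (bd i) = fcomp (h i) (sphere_incl n)) ->
      exists! u : functor B Y, fcomp u j = g /\ forall i, fcomp u (gen i) = h i.

(* [sk n] is the (n-1)-skeleton, [sk 0] being empty; [P] is the colimit. *)
Definition polygraph (P : infcat) :=
  exists (sk : nat -> infcat) (j : forall n, functor (sk n) (sk n.+1))
         (k : forall n, functor (sk n) P),
    [/\ sk 0%N 0%N -> False,
        forall n, attaches_cells n (j n),
        forall n, fcomp (k n.+1) (j n) = k n &
        forall (Y : infcat) (g : forall n, functor (sk n) Y),
          (forall n, fcomp (g n.+1) (j n) = g n) ->
          exists! u : functor P Y, forall n, fcomp u (k n) = g n].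

Definition polygraphic_resolution (P X : infcat) (p : functor P X) :=
  polygraph P /\ trivial_fibration p.

Record category := Category {
  ob :> Type;
  hom : ob -> ob -> Type;
  cid : forall a, hom a a;
  ccomp : forall a b c, hom b c -> hom a b -> hom a c;
  ccomp_idl : forall a b (f : hom a b), ccomp (cid b) f = f;
  ccomp_idr : forall a b (f : hom a b), ccomp f (cid a) = f;
  ccompA : forall a b c d (h : hom c d) (g : hom b c) (f : hom a b),
    ccomp h (ccomp g f) = ccomp (ccomp h g) f
}.

Arguments cid {_} _.

Record cfunctor (C D : category) := CFunctor {
  cf_ob :> C -> D;
  cf_hom : forall a b, hom a b -> hom (cf_ob a) (cf_ob b);
  cf_id : forall a, cf_hom (cid a) = cid (cf_ob a);
  cf_comp : forall a b c (g : hom b c) (f : hom a b),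
    cf_hom (ccomp g f) = ccomp (cf_hom g) (cf_hom f)
}.

Program Definition cfid (C : category) : cfunctor C C :=
  @CFunctor C C id (fun _ _ f => f) _ _.

Program Definition cfcomp (C D E : category) (G : cfunctor D E) (F : cfunctor C D) :
  cfunctor C E := @CFunctor C E (fun a => G (F a)) (fun _ _ f => cf_hom G (cf_hom F f)) _ _.
Next Obligation. by rewrite !cf_id. Qed.
Next Obligation. by rewrite !cf_comp. Qed.

Definition is_iso (C : category) (a b : C) (f : hom a b) :=
  exists2 g : hom b a, ccomp g f = cid a & ccomp f g = cid b.

Definition nat_isomorphic (C D : category) (F G : cfunctor C D) :=
  exists eta : forall a, hom (F a) (G a),
    (forall a b (f : hom a b), ccomp (eta b) (cf_hom F f) = ccomp (cf_hom G f) (eta a)) /\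
    forall a, is_iso (eta a).

Definition equivalence_of_categories (C D : category) (F : cfunctor C D) :=
  exists G : cfunctor D C,
    nat_isomorphic (cfcomp G F) (cfid C) /\ nat_isomorphic (cfcomp F G) (cfid D).

(* All n-cells for [n >= 1] are arrows: the only cells of dimension > 1 are
   units. *)
Section OfCategory.
Variable C : category.

Record arrow := Arrow { dom : C; cod : C; mor : hom dom cod }.

Definition acomp (g f : arrow) (e : cod f = dom g) : arrow :=
  Arrow (ccomp (mor g) (eq_rect _ (hom (dom f)) (mor f) _ e)).

Lemma acomp_idl (f : arrow) (e : cod f = cod f) :
  @acomp (Arrow (cid (cod f))) f e = f.
Proof.
by case: f e => a b f e; rewrite (Prop_irrelevance e erefl) /acomp /= ccomp_idl.
Qed.

Lemma acomp_idr (f : arrow) (e : dom f = dom f) :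
  @acomp f (Arrow (cid (dom f))) e = f.
Proof.
by case: f e => a b f e; rewrite (Prop_irrelevance e erefl) /acomp /= ccomp_idr.
Qed.

Lemma acompA (h g f : arrow) (e1 : cod f = dom g) (e2 : cod g = dom h)
  (e3 : cod (acomp e1) = dom h) (e4 : cod f = dom (acomp e2)) :
  acomp e3 = acomp e4.
Proof.
case: f g h e1 e2 e3 e4 => [a b f] [b' c g] [c' d h] /= e1 e2 e3 e4; subst.
rewrite (Prop_irrelevance e3 erefl) (Prop_irrelevance e4 erefl) /acomp /=.
by rewrite ccompA.
Qed.

Definition ocell (n : nat) : Type := if n is 0 then ob C else arrow.

Definition oface (end_ : arrow -> C) i n : (i <= n)%N -> ocell n -> ocell i :=
  match i, n return (i <= n)%N -> ocell n -> ocell i with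
  | 0, 0 => fun _ x => x
  | 0, _.+1 => fun _ f => end_ f
  | _.+1, _.+1 => fun _ f => f
  | _.+1, 0 => fun h _ => False_rect _ (notF h)
  end.

Definition oidn i n : (i <= n)%N -> ocell i -> ocell n :=
  match i, n return (i <= n)%N -> ocell i -> ocell n with
  | 0, 0 => fun _ x => x
  | 0, _.+1 => fun _ x => Arrow (cid x)
  | _.+1, _.+1 => fun _ f => f
  | _.+1, 0 => fun h _ => False_rect _ (notF h)
  end.

Definition ocomp i n : forall (h : (i < n)%N) (x1 x0 : ocell n),
  oface cod (ltnW h) x0 = oface dom (ltnW h) x1 -> ocell n :=
  match i, n return forall (h : (i < n)%N) (x1 x0 : ocell n),
    oface cod (ltnW h) x0 = oface dom (ltnW h) x1 -> ocell n with
  | 0, _.+1 => fun _ x1 x0 e => @acomp x1 x0 e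
  | _.+1, _.+1 => fun _ x1 _ _ => x1
  | _, 0 => fun h _ _ _ => False_rect _ (notF h)
  end.

Program Definition ofcat : infcat :=
  @InfCat ocell (oface dom) (oface cod) oidn ocomp
    _ _ _ _ _ _ _ _ _ _ _ _ _ _ _ _ _ _ _ _ _.
Next Obligation. by case: n h x. Qed.
Next Obligation. by case: n h x. Qed.
Next Obligation. by move: i j n hij hjn hin x => [|i] [|j] [|n]. Qed.
Next Obligation. by move: i j n hij hjn hin x => [|i] [|j] [|n]. Qed.
Next Obligation. by move: i j n lt_ij hjn hin x => [|i] [|j] [|n]. Qed.
Next Obligation. by move: i j n lt_ij hjn hin x => [|i] [|j] [|n]. Qed.
Next Obligation. by case: n h x. Qed.
Next Obligation. by move: i j n hij hjn hin x => [|i] [|j] [|n]. Qed.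
Next Obligation. by move: i j n hij hjn hin x => [|i] [|j] [|n]. Qed.
Next Obligation. by move: i j n hij hjn hin x => [|i] [|j] [|n]. Qed.
Next Obligation. by move: i j n hji hin hjn x => [|i] [|j] [|n]. Qed.
Next Obligation. by move: i j n hji hin hjn x => [|i] [|j] [|n]. Qed.
Next Obligation. by move: i n lt_in x1 x0 e => [|i] [|n]. Qed.
Next Obligation. by move: i n lt_in x1 x0 e => [|i] [|n]. Qed.
Next Obligation.
by move: i j n lt_ij hjn lt_in x1 x0 e e' => [|i] [|j] [|n] //= *; apply: congr1; apply: Prop_irrelevance.
Qed.
Next Obligation.
by move: i j n lt_ij hjn lt_in x1 x0 e e' => [|i] [|j] [|n] //= *; apply: congr1; apply: Prop_irrelevance.
Qed.
Next Obligation.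
by move: i n lt_in x e => [|i] [|n] //= *; apply: acomp_idr.
Qed.
Next Obligation.
by move: i n lt_in x e => [|i] [|n] //= *; apply: acomp_idl.
Qed.
Next Obligation.
by move: i n k lt_in hnk lt_ik x1 x0 e e' => [|i] [|n] [|k] //= *; apply: congr1; apply: Prop_irrelevance.
Qed.
Next Obligation.
by move: i n lt_in x2 x1 x0 e10 e21 el er => [|i] [|n] //= *; apply: acompA.
Qed.
Next Obligation.
move: i j n lt_ij lt_jn lt_in y1 y0 x1 x0 ey ex eyx e1 e0 e10 => [|i] [|j] [|n] //= *.
by apply: congr1; apply: Prop_irrelevance.
Qed.

End OfCategory.

Section OfFunctor.
Variables (C D : category) (F : cfunctor C D).

Definition ofap n : ocell C n -> ocell D n :=
  if n is _.+1 then fun f : arrow C => Arrow (cf_hom F (mor f)) else fun x : C => F x.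

Program Definition ofcat_map : functor (ofcat C) (ofcat D) :=
  @Functor (ofcat C) (ofcat D) ofap _ _ _ _.
Next Obligation. by move: i n h x => [|i] [|n]. Qed.
Next Obligation. by move: i n h x => [|i] [|n]. Qed.
Next Obligation. by move: i n h x => [|i] [|n] //= *; rewrite cf_id. Qed.
Next Obligation.
move: i n h x1 x0 e e' => [|i] [|n] //= _ [b' c g] [a b f] /= e e'; subst.
by rewrite (Prop_irrelevance e' erefl) /acomp /= cf_comp.
Qed.

End OfFunctor.

Section Under.
Variables (C : category) (x : C).

Record under_ob := UnderOb { u_ob : C; u_mor : hom x u_ob }.

Record under_hom (a b : under_ob) := UnderHom {
  u_hom : hom (u_ob a) (u_ob b);
  u_tri : ccomp u_hom (u_mor a) = u_mor b
}.

Lemma under_hom_eq a b (f g : under_hom a b) : u_hom f = u_hom g -> f = g.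
Proof.
by case: f g => [f e] [g e'] /= E; subst; congr UnderHom; apply: Prop_irrelevance.
Qed.

Program Definition under : category :=
  @Category under_ob under_hom (fun a => @UnderHom a a (cid _) _)
    (fun a b c g f => @UnderHom a c (ccomp (u_hom g) (u_hom f)) _) _ _ _.
Next Obligation. exact: ccomp_idl. Qed.
Next Obligation. by rewrite -ccompA !u_tri. Qed.
Next Obligation. by apply: under_hom_eq; apply: ccomp_idl. Qed.
Next Obligation. by apply: under_hom_eq; apply: ccomp_idr. Qed.
Next Obligation. by apply: under_hom_eq; apply: ccompA. Qed.

Program Definition under_forget : cfunctor under C :=
  @CFunctor under C u_ob u_hom _ _.

End Under.

(* [slice p x] is x\X' for p : X' -> X, and [slice_map e x] is x\f. *)
Definition slice (C : category) (X' : infcat) (p : functor X' (ofcat C)) (x : C) :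
  infcat := fprod p (ofcat_map (under_forget x)).

Program Definition slice_map (C : category) (X1 X2 : infcat) (f : functor X1 X2)
  (p1 : functor X1 (ofcat C)) (p2 : functor X2 (ofcat C)) (e : fcomp p2 f = p1)
  (x : C) : functor (slice p1 x) (slice p2 x) :=
  @Functor (slice p1 x) (slice p2 x)
    (fun n c => @FPCell _ _ _ _ _ n (fap f (fpl c)) (fpr c) _) _ _ _ _.
Next Obligation. exact: (fp_eq c). Qed.
Next Obligation. by apply: fpcell_eq => //=; apply: fap_src. Qed.
Next Obligation. by apply: fpcell_eq => //=; apply: fap_trg. Qed.
Next Obligation. by apply: fpcell_eq => //=; apply: fap_idn. Qed.
Next Obligation.
apply: fpcell_eq => /=; first exact: fap_comp.
by congr ocomp; apply: Prop_irrelevance.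
Qed.

Section Quotient.
Variables (T : Type) (R : T -> T -> Prop).

Definition quo_rel (x y : {classic T}) : bool := `[< clos_refl_sym_trans T R x y >].

Lemma quo_rel_equiv : equiv_class_of quo_rel.
Proof.
split=> [x|x y|y x z].
- exact/asboolP/rst_refl.
- by apply/asboolP/asboolP => ?; apply: rst_sym.
- by move=> /asboolP ? /asboolP ?; apply/asboolP; apply: rst_trans; eauto.
Qed.
Canonical quo_equiv := EquivRelPack quo_rel_equiv.

Definition quo : Type := {eq_quot quo_rel}.

Definition qpi (x : T) : quo := \pi_({eq_quot quo_rel}) x.
Definition qrepr (q : quo) : T := repr (q : {eq_quot quo_rel}).

Lemma qreprK q : qpi (qrepr q) = q.
Proof. exact: reprK. Qed.

Lemma qpiP x y : qpi x = qpi y <-> clos_refl_sym_trans T R x y.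
Proof.
by split=> [/eqmodP/asboolP|h] //; apply/eqmodP/asboolP.
Qed.

Lemma qrepr_pi x : clos_refl_sym_trans T R (qrepr (qpi x)) x.
Proof. by apply/qpiP; rewrite qreprK. Qed.

End Quotient.

Lemma rst_map (T T' : Type) (R : T -> T -> Prop) (R' : T' -> T' -> Prop) (h : T -> T') :
  (forall x y, R x y -> R' (h x) (h y)) ->
  forall x y, clos_refl_sym_trans T R x y -> clos_refl_sym_trans T' R' (h x) (h y).
Proof.
move=> hR x y; elim=> [a b /hR|a|a b _|a b c _ hab _]; first exact: rst_step.
- exact: rst_refl.
- exact: rst_sym.
- exact: rst_trans hab.
Qed.

Section OneCells.
Variable X : infcat.

Record hom1 (a b : X 0%N) := Hom1 {
  h1 :> X 1%N;
  h1_src : src0 h1 = a;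
  h1_trg : trg0 h1 = b
}.

Lemma hom1_eq a b (u v : hom1 a b) : u = v :> X 1%N -> u = v.
Proof.
by case: u v => [u e1 e2] [v e1' e2'] /= e; subst; congr Hom1; apply: Prop_irrelevance.
Qed.

Program Definition hom1_id (a : X 0%N) : hom1 a a := @Hom1 a a (idn (leq0n 1) a) _ _.
Next Obligation. by rewrite (src_idn_hi (leqnn 0)) idn_id. Qed.
Next Obligation. by rewrite (trg_idn_hi (leqnn 0)) idn_id. Qed.

Program Definition hom1_comp a b c (v : hom1 b c) (u : hom1 a b) : hom1 a c :=
  @Hom1 a c (comp (ltn0Sn 0) v u _) _ _.
Next Obligation.
by rewrite (bool_irrelevance (ltnW (ltn0Sn 0)) (leq0n 1)) h1_trg h1_src.
Qed.
Next Obligation.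
rewrite {1}(bool_irrelevance (leq0n 1) (ltnW (ltn0Sn 0))) src_comp.
by rewrite (bool_irrelevance (ltnW (ltn0Sn 0)) (leq0n 1)) h1_src.
Qed.
Next Obligation.
rewrite {1}(bool_irrelevance (leq0n 1) (ltnW (ltn0Sn 0))) trg_comp.
by rewrite (bool_irrelevance (ltnW (ltn0Sn 0)) (leq0n 1)) h1_trg.
Qed.

Definition two_cell a b (u v : hom1 a b) :=
  exists alpha : X 2%N, src (leqnSn 1) alpha = u /\ trg (leqnSn 1) alpha = v.

Lemma src_trgW i j n (hij : (i <= j)%N) (hjn : (j <= n)%N) (hin : (i <= n)%N)
  (x : X n) : (i < j)%N -> src hij (trg hjn x) = src hin x.
Proof. by move=> h; rewrite (bool_irrelevance hij (ltnW h)) (src_trg _ _ hin). Qed.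

Lemma trg_srcW i j n (hij : (i <= j)%N) (hjn : (j <= n)%N) (hin : (i <= n)%N)
  (x : X n) : (i < j)%N -> trg hij (src hjn x) = trg hin x.
Proof. by move=> h; rewrite (bool_irrelevance hij (ltnW h)) (trg_src _ _ hin). Qed.

Lemma src_comp_hiW i j n (lt_ij : (i < j)%N) (hjn : (j <= n)%N)
  (lt_in : (i < n)%N) (x1 x0 : X n) e :
  exists e', src hjn (comp lt_in x1 x0 e) = comp lt_ij (src hjn x1) (src hjn x0) e'.
Proof.
have e' : trg (ltnW lt_ij) (src hjn x0) = src (ltnW lt_ij) (src hjn x1).
  by rewrite (trg_src _ _ (ltnW lt_in)) e (src_src _ _ (ltnW lt_in)).
by exists e'; apply: src_comp_hi.
Qed.

Lemma trg_comp_hiW i j n (lt_ij : (i < j)%N) (hjn : (j <= n)%N)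
  (lt_in : (i < n)%N) (x1 x0 : X n) e :
  exists e', trg hjn (comp lt_in x1 x0 e) = comp lt_ij (trg hjn x1) (trg hjn x0) e'.
Proof.
have e' : trg (ltnW lt_ij) (trg hjn x0) = src (ltnW lt_ij) (trg hjn x1).
  by rewrite (trg_trg _ _ (ltnW lt_in)) e (src_trg _ _ (ltnW lt_in)).
by exists e'; apply: trg_comp_hi.
Qed.

Lemma two_cell_hcomp a b c (v v' : hom1 b c) (u u' : hom1 a b) (alpha beta : X 2%N) :
  src (leqnSn 1) alpha = u -> trg (leqnSn 1) alpha = u' ->
  src (leqnSn 1) beta = v -> trg (leqnSn 1) beta = v' ->
  two_cell (hom1_comp v u) (hom1_comp v' u').
Proof.
move=> au au' bv bv'; have lt02 : (0 < 2)%N by [].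
have e : trg (ltnW lt02) alpha = src (ltnW lt02) beta.
  rewrite -(trg_trg (leq0n 1) (leqnSn 1)) au' h1_trg.
  by rewrite -(src_src (leq0n 1) (leqnSn 1)) bv h1_src.
exists (comp lt02 beta alpha e); split.
- have [e' ->] := src_comp_hiW (ltn0Sn 0) (leqnSn 1) e.
  exact: comp_congr.
- have [e' ->] := trg_comp_hiW (ltn0Sn 0) (leqnSn 1) e.
  exact: comp_congr.
Qed.

Lemma src_idn1 (u : X 1%N) : src (leqnSn 1) (idn (leqnSn 1) u) = u.
Proof. by rewrite (src_idn_hi (leqnn 1)) idn_id. Qed.

Lemma trg_idn1 (u : X 1%N) : trg (leqnSn 1) (idn (leqnSn 1) u) = u.
Proof. by rewrite (trg_idn_hi (leqnn 1)) idn_id. Qed.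

Lemma two_cell_whiskerl a b c (v : hom1 b c) (u u' : hom1 a b) :
  two_cell u u' -> two_cell (hom1_comp v u) (hom1_comp v u').
Proof.
case=> al [h h'].
by apply: (two_cell_hcomp h h'); [apply: src_idn1|apply: trg_idn1].
Qed.

Lemma two_cell_whiskerr a b c (v v' : hom1 b c) (u : hom1 a b) :
  two_cell v v' -> two_cell (hom1_comp v u) (hom1_comp v' u).
Proof.
case=> al [h h'].
by apply: two_cell_hcomp h h'; [apply: src_idn1|apply: trg_idn1].
Qed.

Definition c1_hom (a b : X 0%N) : Type := quo (@two_cell a b).

Definition c1_comp a b c (g : c1_hom b c) (f : c1_hom a b) : c1_hom a c :=
  qpi _ (hom1_comp (qrepr g) (qrepr f)).

Lemma c1_comp_pi a b c (v : hom1 b c) (u : hom1 a b) :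
  c1_comp (qpi _ v) (qpi _ u) = qpi (@two_cell a c) (hom1_comp v u).
Proof.
apply/qpiP; apply: (@rst_trans _ _ _ (hom1_comp (qrepr (qpi (@two_cell b c) v)) u)).
  apply: (rst_map (h := fun u => hom1_comp _ u)) (qrepr_pi _ _) => x y.
  exact: two_cell_whiskerl.
apply: (rst_map (h := fun v => hom1_comp v u)) (qrepr_pi _ _) => x y.
exact: two_cell_whiskerr.
Qed.

Program Definition c1 : category :=
  @Category (X 0%N) c1_hom (fun a => qpi _ (hom1_id a)) c1_comp _ _ _.
Next Obligation.
rewrite -[f]qreprK c1_comp_pi; congr qpi; apply: hom1_eq => /=.
move: (qrepr f) => u.
have e : trg (ltnW (ltn0Sn 0)) u =
    src (ltnW (ltn0Sn 0)) (idn (ltnW (ltn0Sn 0)) (trg (ltnW (ltn0Sn 0)) u)).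
  by rewrite (src_idn_hi (leqnn 0)) idn_id.
rewrite -[RHS](comp_idl e); apply: comp_congr => //.
by rewrite -{1}(h1_trg u) !(bool_irrelevance (ltnW _) (leq0n _)).
Qed.
Next Obligation.
rewrite -[f]qreprK c1_comp_pi; congr qpi; apply: hom1_eq => /=.
move: (qrepr f) => u.
have e : trg (ltnW (ltn0Sn 0)) (idn (ltnW (ltn0Sn 0)) (src (ltnW (ltn0Sn 0)) u)) =
    src (ltnW (ltn0Sn 0)) u.
  by rewrite (trg_idn_hi (leqnn 0)) idn_id.
rewrite -[RHS](comp_idr e); apply: comp_congr => //.
by rewrite -{1}(h1_src u) !(bool_irrelevance (ltnW _) (leq0n _)).
Qed.
Next Obligation.
rewrite -[f]qreprK -[g]qreprK -[h]qreprK !c1_comp_pi; congr qpi; apply: hom1_eq => /=.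
exact: comp_assoc.
Qed.

End OneCells.

Arguments hom1_id {X} _.
Arguments Hom1 {X a b} _ _ _.

Section C1Map.
Variables (X Y : infcat) (f : functor X Y).

Program Definition map_hom1 (a b : X 0%N) (u : hom1 a b) : hom1 (fap f a) (fap f b) :=
  Hom1 (fap f u) _ _.
Next Obligation. by rewrite -fap_src h1_src. Qed.
Next Obligation. by rewrite -fap_trg h1_trg. Qed.

Lemma map_hom1_id (a : X 0%N) : map_hom1 (hom1_id a) = hom1_id (fap f a).
Proof. by apply: hom1_eq; apply: fap_idn. Qed.

Lemma map_hom1_comp (a b c : X 0%N) (v : hom1 b c) (u : hom1 a b) :
  map_hom1 (hom1_comp v u) = hom1_comp (map_hom1 v) (map_hom1 u).
Proof. by apply: hom1_eq; apply: fap_comp. Qed.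

Lemma map_two_cell (a b : X 0%N) (u v : hom1 a b) :
  two_cell u v -> two_cell (map_hom1 u) (map_hom1 v).
Proof.
by case=> al [h h']; exists (fap f al); rewrite -fap_src -fap_trg h h'.
Qed.

Definition c1_map_hom (a b : X 0%N) (g : c1_hom a b) : c1_hom (fap f a) (fap f b) :=
  qpi _ (map_hom1 (qrepr g)).

Lemma c1_map_pi (a b : X 0%N) (u : hom1 a b) :
  c1_map_hom (qpi _ u) = qpi _ (map_hom1 u).
Proof.
by apply/qpiP; apply: (rst_map (@map_two_cell a b)); apply: qrepr_pi.
Qed.

Program Definition c1_map : cfunctor (c1 X) (c1 Y) :=
  @CFunctor (c1 X) (c1 Y) (@fap X Y f 0%N) c1_map_hom _ _.
Next Obligation. by rewrite c1_map_pi map_hom1_id. Qed.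
Next Obligation.
by rewrite -[f0]qreprK -[g]qreprK c1_comp_pi !c1_map_pi c1_comp_pi map_hom1_comp.
Qed.

End C1Map.

Section Localization.
Variable C : category.

Inductive word : C -> C -> Type :=
| w_id a : word a a
| w_hom a b : hom a b -> word a b
| w_inv a b : hom a b -> word b a
| w_comp a b c : word b c -> word a b -> word a c.

Inductive word_rel : forall a b : C, word a b -> word a b -> Prop :=
| wr_idl a b (w : word a b) : word_rel (w_comp (w_id b) w) w
| wr_idr a b (w : word a b) : word_rel (w_comp w (w_id a)) w
| wr_assoc a b c d (w2 : word c d) (w1 : word b c) (w0 : word a b) :
    word_rel (w_comp w2 (w_comp w1 w0)) (w_comp (w_comp w2 w1) w0)
| wr_hom_id a : word_rel (w_hom (cid a)) (w_id a)
| wr_hom_comp a b c (g : hom b c) (f : hom a b) :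
    word_rel (w_hom (ccomp g f)) (w_comp (w_hom g) (w_hom f))
| wr_invl a b (f : hom a b) : word_rel (w_comp (w_inv f) (w_hom f)) (w_id a)
| wr_invr a b (f : hom a b) : word_rel (w_comp (w_hom f) (w_inv f)) (w_id b)
| wr_compl a b c (w1 : word b c) (w0 w0' : word a b) :
    word_rel w0 w0' -> word_rel (w_comp w1 w0) (w_comp w1 w0')
| wr_compr a b c (w1 w1' : word b c) (w0 : word a b) :
    word_rel w1 w1' -> word_rel (w_comp w1 w0) (w_comp w1' w0).

Definition loc_hom (a b : C) : Type := quo (@word_rel a b).

Definition loc_comp a b c (g : loc_hom b c) (f : loc_hom a b) : loc_hom a c :=
  qpi _ (w_comp (qrepr g) (qrepr f)).

Lemma loc_comp_pi a b c (v : word b c) (u : word a b) :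
  loc_comp (qpi _ v) (qpi _ u) = qpi (@word_rel a c) (w_comp v u).
Proof.
apply/qpiP; apply: (@rst_trans _ _ _ (w_comp (qrepr (qpi (@word_rel b c) v)) u)).
  apply: (rst_map (h := fun u => w_comp _ u)) (qrepr_pi _ _) => x y.
  exact: wr_compl.
apply: (rst_map (h := fun v => w_comp v u)) (qrepr_pi _ _) => x y.
exact: wr_compr.
Qed.

Program Definition localization : category :=
  @Category C loc_hom (fun a => qpi _ (w_id a)) loc_comp _ _ _.
Next Obligation.
by rewrite -[f]qreprK loc_comp_pi; apply/qpiP/rst_step/wr_idl.
Qed.
Next Obligation.
by rewrite -[f]qreprK loc_comp_pi; apply/qpiP/rst_step/wr_idr.
Qed.
Next Obligation.
rewrite -[f]qreprK -[g]qreprK -[h]qreprK !loc_comp_pi.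
exact/qpiP/rst_step/wr_assoc.
Qed.

End Localization.

Section LocalizationMap.
Variables (C D : category) (F : cfunctor C D).

Fixpoint map_word (a b : C) (w : word a b) : word (F a) (F b) :=
  match w with
  | w_id a => w_id (F a)
  | w_hom a b f => w_hom (cf_hom F f)
  | w_inv a b f => w_inv (cf_hom F f)
  | w_comp a b c v u => w_comp (map_word v) (map_word u)
  end.

Lemma map_word_rel (a b : C) (w w' : word a b) :
  word_rel w w' -> word_rel (map_word w) (map_word w').
Proof.
elim=> /=; try by move=> *; constructor.
- by move=> c; rewrite cf_id; apply: wr_hom_id.
- by move=> *; rewrite cf_comp; apply: wr_hom_comp.
Qed.

Definition loc_map_hom (a b : C) (g : loc_hom a b) : loc_hom (F a) (F b) :=
  qpi _ (map_word (qrepr g)).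

Lemma loc_map_pi (a b : C) (w : word a b) :
  loc_map_hom (qpi _ w) = qpi _ (map_word w).
Proof.
by apply/qpiP; apply: (rst_map (@map_word_rel a b)); apply: qrepr_pi.
Qed.

Program Definition localization_map : cfunctor (localization C) (localization D) :=
  @CFunctor (localization C) (localization D) F loc_map_hom _ _.
Next Obligation. by rewrite loc_map_pi. Qed.
Next Obligation.
by rewrite -[f]qreprK -[g]qreprK loc_comp_pi !loc_map_pi loc_comp_pi.
Qed.

End LocalizationMap.

Definition Pi1 (X : infcat) : category := localization (c1 X).

Definition Pi1_map (X Y : infcat) (f : functor X Y) : cfunctor (Pi1 X) (Pi1 Y) :=
  localization_map (c1_map f).

(* An infinity-functor from the total dual of X to the 1-category Ab, spelled
   out: since Ab has only unit i-cells for i > 1, such a functor is determined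
   by its values on objects and 1-cells, and the condition coming from 2-cells
   is that parallel 1-cells connected by a 2-cell act in the same way. *)
Record local_system (X : infcat) := LocalSystem {
  ls_ob :> X 0%N -> zmodType;
  ls_res : forall a b, hom1 a b -> {additive ls_ob b -> ls_ob a};
  ls_res_id : forall a m, ls_res (hom1_id a) m = m;
  ls_res_comp : forall a b c (v : hom1 b c) (u : hom1 a b) m,
    ls_res (hom1_comp v u) m = ls_res u (ls_res v m);
  ls_res_two_cell : forall a b (u v : hom1 a b), two_cell u v ->
    forall m, ls_res u m = ls_res v m;
  ls_res_bij : forall a b (u : hom1 a b), bijective (ls_res u)
}.

Program Definition pullback (X Y : infcat) (f : functor X Y) (M : local_system Y) :
  local_system X :=
  @LocalSystem X (fun a => M (fap f a)) (fun a b u => ls_res M (map_hom1 f u)) _ _ _ _.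
Next Obligation. by rewrite map_hom1_id ls_res_id. Qed.
Next Obligation. by rewrite map_hom1_comp ls_res_comp. Qed.
Next Obligation. exact/ls_res_two_cell/map_two_cell. Qed.
Next Obligation. exact: ls_res_bij. Qed.

Lemma local_system_eq (X : infcat) (o : X 0%N -> zmodType) r r' h1 h1' h2 h2' h3 h3' h4 h4' :
  r = r' -> @LocalSystem X o r h1 h2 h3 h4 = @LocalSystem X o r' h1' h2' h3' h4'.
Proof. by move=> e; subst; congr LocalSystem; apply: Prop_irrelevance. Qed.

Lemma pullback_fcomp (X Y Z : infcat) (g : functor Y Z) (f : functor X Y)
  (M : local_system Z) : pullback (fcomp g f) M = pullback f (pullback g M).
Proof.
apply: local_system_eq.
apply: functional_extensionality_dep => a; apply: functional_extensionality_dep => b.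
by apply/funext => u /=; congr ls_res; apply: hom1_eq.
Qed.

Section DirectSum.
Variables (I : choiceType) (M : I -> zmodType).

Record dirsum := DirSum {
  ds_val :> forall i, M i;
  ds_fin : finite_set [set i | ds_val i <> 0]
}.

HB.instance Definition _ := gen_eqMixin dirsum.
HB.instance Definition _ := gen_choiceMixin dirsum.

Lemma dirsum_eq (f g : dirsum) : (forall i, f i = g i) -> f = g.
Proof.
case: f g => [f hf] [g hg] /= fg.
have E : f = g by apply: functional_extensionality_dep.
by subst; congr DirSum; apply: Prop_irrelevance.
Qed.

Program Definition ds_zero : dirsum := @DirSum (fun i => 0) _.
Next Obligation. by rewrite (_ : mkset _ = classical_sets.set0) // -subset0 => i /=. Qed.

Program Definition ds_opp (f : dirsum) : dirsum := @DirSum (fun i => - f i) _.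
Next Obligation.
apply: sub_finite_set (ds_fin f) => i /= h h0; apply: h.
by rewrite h0 oppr0.
Qed.

Program Definition ds_add (f g : dirsum) : dirsum := @DirSum (fun i => f i + g i) _.
Next Obligation.
apply: (@sub_finite_set _ _ ([set i | f i <> 0] `|` [set i | g i <> 0])%classic).
  move=> i /= h; apply/not_andP => -[h1 h2]; apply: h.
  by rewrite h1 h2 addr0.
by rewrite finite_setU; split; apply: ds_fin.
Qed.

Lemma ds_addA : associative ds_add.
Proof. by move=> f g h; apply: dirsum_eq => i /=; rewrite addrA. Qed.
Lemma ds_addC : commutative ds_add.
Proof. by move=> f g; apply: dirsum_eq => i /=; rewrite addrC. Qed.
Lemma ds_add0 : left_id ds_zero ds_add.
Proof. by move=> f; apply: dirsum_eq => i /=; rewrite add0r. Qed.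
Lemma ds_addN : left_inverse ds_zero ds_opp ds_add.
Proof. by move=> f; apply: dirsum_eq => i /=; rewrite addNr. Qed.

HB.instance Definition _ := GRing.isZmodule.Build dirsum ds_addA ds_addC ds_add0 ds_addN.

Lemma ds_addE (f g : dirsum) i : (f + g) i = f i + g i. Proof. by []. Qed.
Lemma ds_oppE (f : dirsum) i : (- f) i = - f i. Proof. by []. Qed.
Lemma ds_zeroE i : (0 : dirsum) i = 0. Proof. by []. Qed.

Definition ds_inj_fun i (m : M i) (j : I) : M j :=
  match pselect (i = j) with
  | left e => eq_rect i (fun k => M k) m j e
  | right _ => 0
  end.

Lemma ds_inj_funE i (m : M i) : ds_inj_fun m i = m.
Proof.
rewrite /ds_inj_fun; case: pselect => [e|//].
by rewrite (Prop_irrelevance e erefl).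
Qed.

Lemma ds_inj_fun0 i (m : M i) j : i <> j -> ds_inj_fun m j = 0.
Proof. by rewrite /ds_inj_fun; case: pselect. Qed.

Program Definition ds_inj i (m : M i) : dirsum := @DirSum (ds_inj_fun m) _.
Next Obligation.
apply: (@sub_finite_set _ _ [set i]%classic); last exact: finite_set1.
by move=> j /= h; apply/esym; apply: contrapT => h'; apply/h/ds_inj_fun0.
Qed.

Lemma ds_inj_additive i : zmod_morphism (@ds_inj i).
Proof.
move=> m m'; apply: dirsum_eq => j; rewrite ds_addE ds_oppE /=.
case: (pselect (i = j)) => [e|h]; last by rewrite !ds_inj_fun0 // subr0.
by subst j; rewrite !ds_inj_funE.
Qed.
HB.instance Definition _ i :=
  GRing.isZmodMorphism.Build (M i) dirsum (@ds_inj i) (@ds_inj_additive i).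

Definition ds_lift (A : zmodType) (phi : forall i, {additive M i -> A}) (f : dirsum) : A :=
  \sum_(i \in [set: I]) phi i (f i).

Lemma ds_liftE (A : zmodType) (phi : forall i, {additive M i -> A}) (f : dirsum)
  (D : set I) : finite_set D -> ([set i | f i <> 0] `<=` D)%classic ->
  ds_lift phi f = \sum_(i \in D) phi i (f i).
Proof.
move=> finD fD; rewrite /ds_lift; apply/esym/fsbig_widen => // i [_ /= Di].
by apply: contrapT => h; apply/Di/fD => /= h0; apply: h; rewrite h0 raddf0.
Qed.

Lemma ds_lift_additive (A : zmodType) (phi : forall i, {additive M i -> A}) :
  zmod_morphism (ds_lift phi).
Proof.
move=> f g; pose D := ([set i | f i <> 0] `|` [set i | g i <> 0])%classic.
have finD : finite_set D by rewrite finite_setU; split; apply: ds_fin.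
rewrite !(ds_liftE phi finD).
- rewrite !fsbig_finite // -sumrB; apply: eq_bigr => i _.
  by rewrite -raddfB.
- by move=> i; right.
- by move=> i; left.
- move=> i /= h; apply/not_andP => -[h1 h2]; apply: h.
  by rewrite -[LHS]/(f i - g i) h1 h2 subr0.
Qed.
HB.instance Definition _ (A : zmodType) (phi : forall i, {additive M i -> A}) :=
  GRing.isZmodMorphism.Build dirsum A (ds_lift phi) (ds_lift_additive phi).

Lemma ds_lift_inj (A : zmodType) (phi : forall i, {additive M i -> A}) i (m : M i) :
  ds_lift phi (ds_inj m) = phi i m.
Proof.
rewrite (ds_liftE phi (finite_set1 i)); first by rewrite fsbig_set1 /= ds_inj_funE.
by move=> j /= h; apply/esym; apply: contrapT => h'; apply/h/ds_inj_fun0.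
Qed.

Definition ds_ev j (f : dirsum) : M j := f j.
Lemma ds_ev_additive j : zmod_morphism (ds_ev j). Proof. by []. Qed.
HB.instance Definition _ j :=
  GRing.isZmodMorphism.Build dirsum (M j) (ds_ev j) (ds_ev_additive j).

Lemma ds_decomp (f : dirsum) :
  f = \sum_(i \in [set i | f i <> 0]%classic) ds_inj (f i).
Proof.
apply: dirsum_eq => j; rewrite -[RHS]/(ds_ev j _) fsbig_finite; last exact: ds_fin.
rewrite raddf_sum /=; set s := fset_set _.
have off i : i != j -> ds_ev j (ds_inj (f i)) = 0.
  by move=> /eqP ij; apply: ds_inj_fun0.
case: (pselect (f j = 0)) => [fj0|fj].
  rewrite fj0 big_seq big1 // => i.
  rewrite in_fset_set ?inE; last exact: ds_fin.
  by move=> /= fi; apply: off; apply/eqP => ij; apply: fi; rewrite ij.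
rewrite (bigD1_seq j) ?finmap.fset_uniq //=; last first.
  by rewrite in_fset_set ?inE //; apply: ds_fin.
by rewrite big1 ?addr0 // /ds_ev /= ds_inj_funE.
Qed.

Lemma ds_ext (A : zmodType) (g h : {additive dirsum -> A}) :
  (forall i (m : M i), g (ds_inj m) = h (ds_inj m)) -> g =1 h.
Proof.
move=> gh f; rewrite (ds_decomp f) fsbig_finite; last exact: ds_fin.
by rewrite !raddf_sum; apply: eq_bigr => i _; apply: gh.
Qed.

End DirectSum.

(* The smallest equivalence relation compatible with addition containing [G];
   quotients by it are taken through the subgroup of elements congruent to 0,
   see [aq_piP]. *)
Definition add_cong (A : zmodType) (G : A -> A -> Prop) (x y : A) :=
  forall E : A -> A -> Prop,
    (forall a, E a a) -> (forall a b, E a b -> E b a) ->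
    (forall a b c, E a b -> E b c -> E a c) ->
    (forall a b c d, E a b -> E c d -> E (a + c) (b + d)) ->
    (forall a b, G a b -> E a b) ->
    E x y.

Section AdditiveQuotient.
Variables (A : zmodType) (G : A -> A -> Prop).

Definition add_cong0 : {pred A} := fun z => `[< add_cong G z 0 >].

Lemma add_congD x y : add_cong G x y <-> add_cong G (x - y) 0.
Proof.
split=> h E Er Es Et Ea Eg.
  rewrite -(subrr y); apply: (Ea _ _ _ _ _ (Er _)).
  exact: h.
rewrite -[x](subrK y) -[y in E _ y]add0r.
by apply: (Ea _ _ _ _ _ (Er _)); apply: h.
Qed.

Lemma add_cong0_closed : zmod_closed add_cong0.
Proof.
split=> [|x y /asboolP hx /asboolP hy]; first by apply/asboolP => E.
apply/asboolP; apply: (add_congD x y).1 => E Er Es Et Ea Eg.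
by exact: (Et x 0 y (hx E Er Es Et Ea Eg) (Es _ _ (hy E Er Es Et Ea Eg))).
Qed.
HB.instance Definition _ := GRing.isZmodClosed.Build A add_cong0 add_cong0_closed.

Definition add_quot : zmodType := Quotient.quot add_cong0.

Definition aq_pi (x : A) : add_quot := \pi_(Quotient.quot add_cong0) x.

Lemma aq_pi_additive : zmod_morphism aq_pi.
Proof. by move=> x y; rewrite /aq_pi raddfB. Qed.
HB.instance Definition _ := GRing.isZmodMorphism.Build A add_quot aq_pi aq_pi_additive.

Lemma aq_piP x y : aq_pi x = aq_pi y <-> add_cong G x y.
Proof.
rewrite add_congD; split=> [/eqP|h]; last apply/eqP.
  by rewrite -Quotient.idealrBE => /asboolP.
by rewrite -Quotient.idealrBE; apply/asboolP.
Qed.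

Definition aq_repr (q : add_quot) : A := repr (q : Quotient.quot add_cong0).

Lemma aq_reprK q : aq_pi (aq_repr q) = q.
Proof. exact: reprK. Qed.

Section Lift.
Variables (B : zmodType) (phi : {additive A -> B}).
Hypothesis phiG : forall x y, G x y -> phi x = phi y.

Definition aq_lift (_ : forall x y, G x y -> phi x = phi y) (q : add_quot) : B :=
  phi (aq_repr q).

Lemma aq_lift_pi x : aq_lift phiG (aq_pi x) = phi x.
Proof.
have H := (aq_piP _ _).1 (aq_reprK (aq_pi x)).
apply: (H (fun a b => phi a = phi b)) => // [a b c -> //|a b c d h h'].
by rewrite !raddfD h h'.
Qed.

Lemma aq_lift_additive : zmod_morphism (aq_lift phiG).
Proof.
move=> q r; rewrite -[q]aq_reprK -[r]aq_reprK -raddfB !aq_lift_pi.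
exact: raddfB.
Qed.
HB.instance Definition _ :=
  GRing.isZmodMorphism.Build add_quot B (aq_lift phiG) aq_lift_additive.
End Lift.

Lemma aq_ext (B : zmodType) (g h : {additive add_quot -> B}) :
  (forall x, g (aq_pi x) = h (aq_pi x)) -> g =1 h.
Proof. by move=> gh q; rewrite -[q]aq_reprK. Qed.

End AdditiveQuotient.

Record complex := Complex {
  cgrp :> nat -> zmodType;
  cdiff : forall n, {additive cgrp n.+1 -> cgrp n};
  cdiff_diff : forall n x, cdiff n (cdiff n.+1 x) = 0
}.

Record chain_map (C D : complex) := ChainMap {
  cm :> forall n, {additive C n -> D n};
  cm_diff : forall n x, cm n (cdiff C n x) = cdiff D n (cm n.+1 x)
}.

Section Homology.
Variables (C : complex) (n : nat).

Definition is_cycle : {pred C n} :=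
  match n return {pred C n} with
  | 0 => fun _ => true
  | m.+1 => fun z : C m.+1 => cdiff C m z == 0
  end.

Lemma is_cycle_closed : zmod_closed is_cycle.
Proof.
rewrite /is_cycle; case: n => [|m]; split=> //=; rewrite ?inE /in_mem /= ?raddf0 //.
by move=> x y; rewrite /in_mem /= => /eqP hx /eqP hy; rewrite raddfB hx hy subr0.
Qed.
HB.instance Definition _ := GRing.isZmodClosed.Build (C n) is_cycle is_cycle_closed.

Record cycle := Cycle { cyc_val : C n; cyc_prop : cyc_val \in is_cycle }.
HB.instance Definition _ := [isSub for cyc_val].
HB.instance Definition _ := [Choice of cycle by <:].
HB.instance Definition _ := [SubChoice_isSubZmodule of cycle by <:].

Definition is_boundary : {pred cycle} := fun z => `[< exists w, cyc_val z = cdiff C n w >].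

Lemma is_boundary_closed : zmod_closed is_boundary.
Proof.
split=> [|x y /asboolP[w hw] /asboolP[v hv]]; apply/asboolP.
  by exists 0; rewrite raddf0.
by exists (w - v); rewrite raddfB -hw -hv.
Qed.
HB.instance Definition _ := GRing.isZmodClosed.Build cycle is_boundary is_boundary_closed.

Definition homology : zmodType := Quotient.quot is_boundary.

Definition hclass (z : cycle) : homology := \pi_(Quotient.quot is_boundary) z.
Definition hrepr (q : homology) : cycle := repr (q : Quotient.quot is_boundary).

Lemma hreprK q : hclass (hrepr q) = q. Proof. exact: reprK. Qed.

Lemma hclassP z z' :
  hclass z = hclass z' <-> exists w, cyc_val z - cyc_val z' = cdiff C n w.
Proof.
split=> [/eqP|h]; last apply/eqP.
  by rewrite -Quotient.idealrBE => /asboolP.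
by rewrite -Quotient.idealrBE; apply/asboolP.
Qed.

End Homology.

Arguments is_cycle : clear implicits.

Section HomologyMap.
Variables (C D : complex) (phi : chain_map C D) (n : nat).

Lemma map_cycle_subproof (z : cycle C n) : phi n (cyc_val z) \in is_cycle D n.
Proof.
case: z; case: n => [//|m] z /= hz.
move: hz; rewrite /in_mem /= => /eqP hz.
by rewrite -cm_diff hz raddf0.
Qed.

Definition map_cycle (z : cycle C n) : cycle D n := Cycle (map_cycle_subproof z).

Definition homology_map (q : homology C n) : homology D n :=
  hclass (map_cycle (hrepr q)).

Lemma homology_map_class z : homology_map (hclass z) = hclass (map_cycle z).
Proof.
have /hclassP[w hw] := hreprK (hclass z).
by apply/hclassP; exists (phi n.+1 w); rewrite /= -raddfB hw cm_diff.
Qed.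

Lemma homology_map_additive : zmod_morphism homology_map.
Proof.
move=> q r; rewrite -[q]hreprK -[r]hreprK.
have hB E m (x y : cycle E m) : hclass (x - y) = hclass x - hclass y.
  by rewrite /hclass raddfB.
rewrite -hB !homology_map_class -hB; congr hclass; apply: val_inj => /=.
by rewrite raddfB.
Qed.
HB.instance Definition _ :=
  GRing.isZmodMorphism.Build (homology C n) (homology D n) homology_map
    homology_map_additive.

End HomologyMap.

Section Chains.
Variables (X : infcat) (M : local_system X).

Definition prechain n : zmodType :=
  dirsum (fun x : {classic X n} => M (trg0 (x : X n))).

(* The element (x, m); the object [a] stands for t_0 x, so that elements of
   propositionally equal groups can be used without explicit transport. *)
Definition pregen n (x : X n) (a : X 0%N) (e : trg0 x = a) (m : M a) : prechain n :=
  ds_inj (I := {classic X n}) (M := fun x : {classic X n} => M (trg0 (x : X n)))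
    (i := x) (eq_rect_r (fun b => M b) m e).

Lemma pregen_additive n (x : X n) a (e : trg0 x = a) : zmod_morphism (pregen e).
Proof.
by move=> m m'; subst a; rewrite /pregen /eq_rect_r /= raddfB.
Qed.
HB.instance Definition _ n (x : X n) a (e : trg0 x = a) :=
  GRing.isZmodMorphism.Build (M a) (prechain n) (pregen e) (pregen_additive e).

Inductive chain_rel n : prechain n -> prechain n -> Prop :=
| chain_rel0 (lt0n : (0 < n)%N) (x1 x0 : X n)
    (c : trg (ltnW lt0n) x0 = src (ltnW lt0n) x1) (a b : X 0%N)
    (e10 : trg0 (comp lt0n x1 x0 c) = a) (e1 : trg0 x1 = a) (e0 : trg0 x0 = b)
    (u : hom1 b a) (m : M a) :
    (u : X 1%N) = trg lt0n x1 ->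
    chain_rel (pregen e10 m) (pregen e1 m + pregen e0 (ls_res M u m))
| chain_relS i (lt0i : (0 < i)%N) (lt_in : (i < n)%N) (x1 x0 : X n)
    (c : trg (ltnW lt_in) x0 = src (ltnW lt_in) x1) (a : X 0%N)
    (e10 : trg0 (comp lt_in x1 x0 c) = a) (e1 : trg0 x1 = a) (e0 : trg0 x0 = a)
    (m : M a) :
    chain_rel (pregen e10 m) (pregen e1 m + pregen e0 m).

Definition chain n : zmodType := add_quot (@chain_rel n).

Definition gen n (x : X n) (a : X 0%N) (e : trg0 x = a) (m : M a) : chain n :=
  aq_pi (@chain_rel n) (pregen e m).

Lemma gen_additive n (x : X n) a (e : trg0 x = a) : zmod_morphism (gen e).
Proof. by move=> m m'; rewrite /gen !raddfB. Qed.
HB.instance Definition _ n (x : X n) a (e : trg0 x = a) :=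
  GRing.isZmodMorphism.Build (M a) (chain n) (gen e) (gen_additive e).

Lemma gen_congr n (x y : X n) a (e : trg0 x = a) (e' : trg0 y = a) (m : M a) :
  x = y -> gen e m = gen e' m.
Proof. by move=> h; subst; rewrite (Prop_irrelevance e' erefl). Qed.

Lemma gen_comp0 n (lt0n : (0 < n)%N) (x1 x0 : X n) c (a b : X 0%N)
  (e10 : trg0 (comp lt0n x1 x0 c) = a) (e1 : trg0 x1 = a) (e0 : trg0 x0 = b)
  (u : hom1 b a) (m : M a) :
  (u : X 1%N) = trg lt0n x1 -> gen e10 m = gen e1 m + gen e0 (ls_res M u m).
Proof.
move=> hu; rewrite /gen -raddfD; apply/aq_piP => E _ _ _ _; apply.
exact: chain_rel0.
Qed.

Lemma gen_compS n i (lt0i : (0 < i)%N) (lt_in : (i < n)%N) (x1 x0 : X n) c (a : X 0%N)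
  (e10 : trg0 (comp lt_in x1 x0 c) = a) (e1 : trg0 x1 = a) (e0 : trg0 x0 = a)
  (m : M a) : gen e10 m = gen e1 m + gen e0 m.
Proof.
rewrite /gen -raddfD; apply/aq_piP => E _ _ _ _; apply.
exact: chain_relS.
Qed.

Lemma chain_ext n (A : zmodType) (g h : {additive chain n -> A}) :
  (forall (x : X n) a (e : trg0 x = a) m, g (gen e m) = h (gen e m)) -> g =1 h.
Proof.
move=> gh; apply: aq_ext.
exact: (@ds_ext _ _ A (g \o aq_pi (@chain_rel n)) (h \o aq_pi (@chain_rel n)))
  (fun x m => gh x _ erefl m).
Qed.

Section Extension.
Variables (n : nat) (A : zmodType) (phi : forall x : X n, {additive M (trg0 x) -> A}).

Definition pre_ext : {additive prechain n -> A} :=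
  ds_lift (I := {classic X n}) (M := fun x : {classic X n} => M (trg0 (x : X n))) phi.

Lemma pre_ext_gen (x : X n) a (e : trg0 x = a) (m : M a) :
  pre_ext (pregen e m) = phi x (eq_rect_r (fun b => M b) m e).
Proof. exact: ds_lift_inj. Qed.

End Extension.

Lemma trg0_trg n (x : X n.+1) : trg0 (trg (leqnSn n) x) = trg0 x.
Proof. exact: trg_trg. Qed.

Lemma trg0_src n (x : X n.+2) : trg0 (src (leqnSn n.+1) x) = trg0 x.
Proof. exact: trg_srcW. Qed.

Definition diff_gen n : forall (x : X n.+1) (a : X 0%N), trg0 x = a -> M a -> chain n :=
  match n return forall (x : X n.+1) (a : X 0%N), trg0 x = a -> M a -> chain n with
  | 0 => fun x a e m =>
      gen (etrans (trg_id _ (trg0 x)) e) m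
      - gen (trg_id _ (src0 x)) (ls_res M (Hom1 x erefl e) m)
  | k.+1 => fun x a e m =>
      gen (etrans (trg0_trg x) e) m - gen (etrans (trg0_src x) e) m
  end.

Lemma diff_gen_additive n (x : X n.+1) a (e : trg0 x = a) : zmod_morphism (diff_gen e).
Proof.
by case: n x e => [|n] x e m m' /=; rewrite !raddfB /= addrACA.
Qed.

HB.instance Definition _ n (x : X n.+1) a (e : trg0 x = a) :=
  GRing.isZmodMorphism.Build (M a) (chain n) (diff_gen e) (diff_gen_additive e).

Lemma diff_gen0 (x : X 1%N) a b (e : trg0 x = a) (u : hom1 b a)
  (e1 : trg0 (trg0 x) = a) (e0 : trg0 (src0 x) = b) (m : M a) :
  (u : X 1%N) = x -> diff_gen e m = gen e1 m - gen e0 (ls_res M u m).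
Proof.
move=> ux; subst x; rewrite /= (Prop_irrelevance (etrans _ _) e1); congr (_ - _).
case: u e e1 e0 => x h h' e e1 e0; subst b.
by rewrite /= (Prop_irrelevance e0 (trg_id _ _)) (Prop_irrelevance e h').
Qed.

Lemma diff_genS n (x : X n.+2) a (e : trg0 x = a)
  (e1 : trg0 (trg (leqnSn n.+1) x) = a) (e0 : trg0 (src (leqnSn n.+1) x) = a) (m : M a) :
  diff_gen e m = gen e1 m - gen e0 m.
Proof.
by rewrite /= (Prop_irrelevance (etrans _ _) e1) (Prop_irrelevance (etrans _ e) e0).
Qed.

Definition pre_diff n : {additive prechain n.+1 -> chain n} :=
  pre_ext (fun x : X n.+1 => diff_gen (erefl (trg0 x))).

Lemma pre_diff_gen n (x : X n.+1) a (e : trg0 x = a) (m : M a) :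
  pre_diff n (pregen e m) = diff_gen e m.
Proof. by rewrite /pre_diff pre_ext_gen; subst a. Qed.

Lemma res_trg_src k (x : X k.+2) (a b : X 0%N) (u : hom1 b a) (m : M a) :
  (u : X 1%N) = trg (ltn0Sn k.+1) x ->
  exists2 u' : hom1 b a, (u' : X 1%N) = trg (ltn0Sn k) (src (leqnSn k.+1) x) &
    ls_res M u' m = ls_res M u m.
Proof.
case: k x => [|k] x hu; last first.
  by exists u => //; rewrite (trg_srcW _ _ (ltn0Sn k.+2)).
have hs : src0 (src (leqnSn 1) x) = b.
  by rewrite (src_src _ _ (leq0n 2)) -(h1_src u) hu (src_trgW _ _ (leq0n 2)).
have ht : trg0 (src (leqnSn 1) x) = a.
  by rewrite (trg_srcW _ _ (leq0n 2)) // -(h1_trg u) hu (trg_trg _ _ (leq0n 2)).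
exists (Hom1 _ hs ht); first by rewrite /= trg_id.
apply: ls_res_two_cell; exists x; split=> //.
by rewrite hu; congr trg; apply: bool_irrelevance.
Qed.

Lemma diff_gen_comp0 n (lt0n : (0 < n.+1)%N) (x1 x0 : X n.+1) c (a b : X 0%N)
  (e10 : trg0 (comp lt0n x1 x0 c) = a) (e1 : trg0 x1 = a) (e0 : trg0 x0 = b)
  (u : hom1 b a) (m : M a) :
  (u : X 1%N) = trg lt0n x1 ->
  diff_gen e10 m = diff_gen e1 m + diff_gen e0 (ls_res M u m).
Proof.
case: n => [|k] in lt0n x1 x0 c e10 e1 e0 * => hu.
  have ux1 : (u : X 1%N) = x1 by rewrite hu trg_id.
  pose v : hom1 (src0 x0) b := Hom1 x0 erefl e0.
  have wE : (hom1_comp u v : X 1%N) = comp lt0n x1 x0 c by apply: comp_congr.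
  have t1 : trg0 (trg0 x1) = a by rewrite trg_id.
  have s1 : trg0 (src0 x1) = b by rewrite trg_id -ux1 h1_src.
  have t0 : trg0 (trg0 x0) = b by rewrite trg_id.
  have s0 : trg0 (src0 x0) = src0 x0 by rewrite trg_id.
  have tE : trg0 (comp lt0n x1 x0 c) = trg0 x1 by rewrite e10 e1.
  have sE : src0 (comp lt0n x1 x0 c) = src0 x0 by rewrite -wE h1_src.
  have t10 : trg0 (trg0 (comp lt0n x1 x0 c)) = a by rewrite trg_id.
  have s10 : trg0 (src0 (comp lt0n x1 x0 c)) = src0 x0 by rewrite trg_id.
  rewrite (diff_gen0 e10 t10 s10 _ wE) (diff_gen0 e1 t1 s1 _ ux1).
  rewrite (@diff_gen0 x0 b _ e0 v t0 s0) // ls_res_comp.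
  rewrite (gen_congr t10 t1 _ tE) (gen_congr s10 s0 _ sE).
  rewrite (@gen_congr _ (src0 x1) (trg0 x0) _ s1 t0) ?subrKA //.
  by rewrite e0 -ux1 h1_src.
have [ct tE] := trg_comp_hiW (ltn0Sn k) (leqnSn k.+1) c.
have [cs sE] := src_comp_hiW (ltn0Sn k) (leqnSn k.+1) c.
have T (y : X k.+2) d : trg0 y = d -> trg0 (trg (leqnSn k.+1) y) = d.
  by rewrite trg0_trg.
have S (y : X k.+2) d : trg0 y = d -> trg0 (src (leqnSn k.+1) y) = d.
  by rewrite trg0_src.
rewrite (diff_genS _ (T _ _ e10) (S _ _ e10)) (diff_genS _ (T _ _ e1) (S _ _ e1)).
rewrite (diff_genS _ (T _ _ e0) (S _ _ e0)).
have t10 := T _ _ e10; have s10 := S _ _ e10.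
rewrite (Prop_irrelevance (T _ _ e10) t10) (Prop_irrelevance (S _ _ e10) s10).
move: t10 s10; rewrite tE sE => t10 s10.
have hu' : (u : X 1%N) = trg (ltn0Sn k) (trg (leqnSn k.+1) x1).
  by rewrite hu (trg_trg _ _ lt0n).
have hu2 : (u : X 1%N) = trg (ltn0Sn k.+1) x1.
  by rewrite hu; congr trg; apply: bool_irrelevance.
have [u' hu1 hres] := res_trg_src m hu2.
rewrite (gen_comp0 t10 (T _ _ e1) (T _ _ e0) m hu').
rewrite (gen_comp0 s10 (S _ _ e1) (S _ _ e0) m hu1) hres.
by rewrite opprD addrACA.
Qed.

Lemma diff_gen_compS n i (lt0i : (0 < i)%N) (lt_in : (i < n.+1)%N) (x1 x0 : X n.+1) c
  (a : X 0%N) (e10 : trg0 (comp lt_in x1 x0 c) = a) (e1 : trg0 x1 = a)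
  (e0 : trg0 x0 = a) (m : M a) :
  diff_gen e10 m = diff_gen e1 m + diff_gen e0 m.
Proof.
case: n => [|n] in lt_in x1 x0 c e10 e1 e0 *; first by exfalso; lia.
have T (y : X n.+2) d : trg0 y = d -> trg0 (trg (leqnSn n.+1) y) = d.
  by rewrite trg0_trg.
have S (y : X n.+2) d : trg0 y = d -> trg0 (src (leqnSn n.+1) y) = d.
  by rewrite trg0_src.
rewrite (diff_genS _ (T _ _ e10) (S _ _ e10)) (diff_genS _ (T _ _ e1) (S _ _ e1)).
rewrite (diff_genS _ (T _ _ e0) (S _ _ e0)).
have [lt|] := boolP (i < n.+1)%N.
  have [ct tE] := trg_comp_hiW lt (leqnSn n.+1) c.
  have [cs sE] := src_comp_hiW lt (leqnSn n.+1) c.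
  have t10 := T _ _ e10; have s10 := S _ _ e10.
  rewrite (Prop_irrelevance (T _ _ e10) t10) (Prop_irrelevance (S _ _ e10) s10).
  move: t10 s10; rewrite tE sE => t10 s10.
  rewrite (gen_compS lt0i t10 (T _ _ e1) (T _ _ e0)).
  rewrite (gen_compS lt0i s10 (S _ _ e1) (S _ _ e0)).
  by rewrite opprD addrACA.
move=> ge; have ei : i = n.+1 by lia.
subst i; have irr := bool_irrelevance (leqnSn n.+1) (ltnW lt_in).
rewrite (gen_congr _ (T _ _ e1)); last by rewrite irr trg_comp.
rewrite (gen_congr (S _ _ e10) (S _ _ e0)); last by rewrite irr src_comp.
rewrite (gen_congr (S _ _ e1) (T _ _ e0)) ?subrKA //.
by rewrite irr c.
Qed.

Lemma pre_diff_rel n (z z' : prechain n.+1) :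
  chain_rel z z' -> pre_diff n z = pre_diff n z'.
Proof.
case=> [lt0n x1 x0 c a b e10 e1 e0 u m hu|i lt0i lt_in x1 x0 c a e10 e1 e0 m].
  by rewrite raddfD !pre_diff_gen; apply: diff_gen_comp0.
by rewrite raddfD !pre_diff_gen; apply: diff_gen_compS.
Qed.

Definition chain_diff n : {additive chain n.+1 -> chain n} := aq_lift (@pre_diff_rel n).

Lemma chain_diff_gen n (x : X n.+1) a (e : trg0 x = a) (m : M a) :
  chain_diff n (gen e m) = diff_gen e m.
Proof. exact: (etrans (aq_lift_pi (@pre_diff_rel n) _) (pre_diff_gen e m)). Qed.

Lemma chain_diff_diff n (z : chain n.+2) : chain_diff n (chain_diff n.+1 z) = 0.
Proof.
move: z; apply: (@chain_ext _ _ (chain_diff n \o chain_diff n.+1) \0) => x a e m.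
rewrite -[LHS]/(chain_diff n (chain_diff n.+1 (gen e m))) -[RHS]/(0 : chain n).
have e1 : trg0 (trg (leqnSn n.+1) x) = a by rewrite trg0_trg.
have e0 : trg0 (src (leqnSn n.+1) x) = a by rewrite trg0_src.
rewrite chain_diff_gen (diff_genS e e1 e0) raddfB !chain_diff_gen.
case: n => [|n] in x e e1 e0 *.
  pose b := src0 x.
  have s1 : src0 (trg (leqnSn 1) x) = b by apply: src_trgW.
  have s0 : src0 (src (leqnSn 1) x) = b by apply: src_src.
  have t1 : trg0 (trg0 (trg (leqnSn 1) x)) = a by rewrite trg_id.
  have t0 : trg0 (trg0 (src (leqnSn 1) x)) = a by rewrite trg_id.
  have r1 : trg0 (src0 (trg (leqnSn 1) x)) = b by rewrite trg_id.
  have r0 : trg0 (src0 (src (leqnSn 1) x)) = b by rewrite trg_id.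
  rewrite (@diff_gen0 _ _ _ e1 (Hom1 _ s1 e1) t1 r1) //.
  rewrite (@diff_gen0 _ _ _ e0 (Hom1 _ s0 e0) t0 r0) //.
  rewrite (gen_congr t1 t0); last by rewrite e1 e0.
  rewrite (gen_congr r1 r0); last by rewrite s1 s0.
  rewrite (_ : ls_res M (Hom1 _ s1 e1) m = ls_res M (Hom1 _ s0 e0) m) ?subrr //.
  by apply/esym/ls_res_two_cell; exists x.
have T (y : X n.+2) d : trg0 y = d -> trg0 (trg (leqnSn n.+1) y) = d.
  by rewrite trg0_trg.
have S (y : X n.+2) d : trg0 y = d -> trg0 (src (leqnSn n.+1) y) = d.
  by rewrite trg0_src.
rewrite (diff_genS e1 (T _ _ e1) (S _ _ e1)) (diff_genS e0 (T _ _ e0) (S _ _ e0)).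
have h : (n.+1 <= n.+3)%N by lia.
rewrite (gen_congr (T _ _ e1) (T _ _ e0)); last first.
  by rewrite (trg_trg _ _ h) (trg_srcW _ _ h).
rewrite (gen_congr (S _ _ e1) (S _ _ e0)) ?subrr //.
by rewrite (src_src _ _ h) (src_trgW _ _ h).
Qed.

Definition chain_complex : complex := Complex chain_diff_diff.

End Chains.

Section ChainMap.
Variables (X Y : infcat) (f : functor X Y) (M : local_system Y).
Let N := pullback f M.

Lemma fap_trg0 n (x : X n) (a : X 0%N) : trg0 x = a -> trg0 (fap f x) = fap f a.
Proof. by move=> <-; rewrite fap_trg. Qed.

Definition pre_map n : {additive prechain N n -> chain M n} :=
  pre_ext (M := N) (fun x : X n => gen (M := M) (fap_trg0 (erefl (trg0 x)))
    : {additive M (fap f (trg0 x)) -> chain M n}).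

Lemma pre_map_gen n (x : X n) (a : X 0%N) (e : trg0 x = a) (m : N a) :
  pre_map n (pregen e m) = gen (M := M) (fap_trg0 e) m.
Proof. by rewrite /pre_map pre_ext_gen; subst a. Qed.

Lemma pre_map_rel n (z z' : prechain N n) :
  chain_rel z z' -> pre_map n z = pre_map n z'.
Proof.
case=> [lt0n x1 x0 c a b e10 e1 e0 u m hu|i lt0i lt_in x1 x0 c a e10 e1 e0 m].
  have c' := fap_composable f c; have cE := fap_comp c c'.
  rewrite raddfD !pre_map_gen; have e10' := fap_trg0 e10.
  rewrite (Prop_irrelevance (fap_trg0 e10) e10'); move: e10'; rewrite cE => e10'.
  rewrite (gen_comp0 (M := M) e10' (fap_trg0 e1) (fap_trg0 e0) (u := map_hom1 f u)) //=.
  by rewrite hu fap_trg.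
have c' := fap_composable f c; have cE := fap_comp c c'.
rewrite raddfD !pre_map_gen; have e10' := fap_trg0 e10.
rewrite (Prop_irrelevance (fap_trg0 e10) e10'); move: e10'; rewrite cE => e10'.
exact: gen_compS.
Qed.

Definition chain_fun n : {additive chain N n -> chain M n} := aq_lift (@pre_map_rel n).

Lemma chain_fun_gen n (x : X n) (a : X 0%N) (e : trg0 x = a) (m : N a) :
  chain_fun n (gen e m) = gen (M := M) (fap_trg0 e) m.
Proof. exact: (etrans (aq_lift_pi (@pre_map_rel n) _) (pre_map_gen e m)). Qed.

Lemma chain_fun_diff n (z : chain N n.+1) :
  chain_fun n (chain_diff N n z) = chain_diff M n (chain_fun n.+1 z).
Proof.
move: z; apply: (@chain_ext _ _ _ _ (chain_fun n \o chain_diff N n)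
  (chain_diff M n \o chain_fun n.+1)) => x a e m.
rewrite -[LHS]/(chain_fun n (chain_diff N n (gen e m))).
rewrite -[RHS]/(chain_diff M n (chain_fun n.+1 (gen e m))).
rewrite chain_fun_gen !chain_diff_gen.
case: n => [|n] in x e *.
  pose u := Hom1 x erefl e.
  have e1 : trg0 (trg0 x) = a by rewrite trg_id.
  have e0 : trg0 (src0 x) = src0 x by rewrite trg_id.
  have f1 : trg0 (trg0 (fap f x)) = fap f a by rewrite trg_id -fap_trg e.
  have f0 : trg0 (src0 (fap f x)) = fap f (src0 x) by rewrite trg_id -fap_src.
  rewrite (@diff_gen0 X N x a _ e u e1 e0) // raddfB !chain_fun_gen.
  rewrite (@diff_gen0 Y M (fap f x) _ _ (fap_trg0 e) (map_hom1 f u) f1 f0) //.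
  by congr (_ - _); apply: gen_congr; rewrite ?fap_trg ?fap_src.
have e1 : trg0 (trg (leqnSn n.+1) x) = a by rewrite trg0_trg.
have e0 : trg0 (src (leqnSn n.+1) x) = a by rewrite trg0_src.
have f1 : trg0 (trg (leqnSn n.+1) (fap f x)) = fap f a by rewrite -fap_trg -fap_trg e1.
have f0 : trg0 (src (leqnSn n.+1) (fap f x)) = fap f a by rewrite -fap_src -fap_trg e0.
rewrite (@diff_genS X N _ _ _ e e1 e0) raddfB !chain_fun_gen.
rewrite (@diff_genS Y M _ _ _ (fap_trg0 e) f1 f0).
by congr (_ - _); apply: gen_congr; rewrite ?fap_trg ?fap_src.
Qed.

Definition chain_complex_map : chain_map (chain_complex N) (chain_complex M) :=
  @ChainMap (chain_complex N) (chain_complex M) chain_fun chain_fun_diff.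

End ChainMap.

Definition Hpol (P X : infcat) (p : functor P X) (n : nat) (M : local_system X) : zmodType :=
  homology (chain_complex (pullback p M)) n.

Lemma pullback_square (P' P X' X : infcat) (p' : functor P' X') (p : functor P X)
  (f : functor X' X) (f' : functor P' P) (e : fcomp p f' = fcomp f p')
  (M : local_system X) :
  pullback f' (pullback p M) = pullback p' (pullback f M).
Proof. by rewrite -!pullback_fcomp e. Qed.

(* The map induced by [C(f', p^*(M))], whose source is identified with
   [C(P', p'^*(f^*(M)))] through f'^*(p^*(M)) = p'^*(f^*(M)). *)
Definition Hpol_map (P' P X' X : infcat) (p' : functor P' X') (p : functor P X)
  (f : functor X' X) (f' : functor P' P) (e : fcomp p f' = fcomp f p') (n : nat)
  (M : local_system X) : Hpol p' n (pullback f M) -> Hpol p n M :=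
  eq_rect (pullback f' (pullback p M))
    (fun N => homology (chain_complex N) n -> Hpol p n M)
    (homology_map (chain_complex_map f' (pullback p M)) (n := n))
    (pullback p' (pullback f M)) (pullback_square e M).

(* H^pol_n(f, M) does not depend, up to canonical isomorphism, on the
   resolutions (which always exist) nor on the lift; the condition is stated
   for all choices. *)
Definition polygraphic_equivalence (X' X : infcat) (f : functor X' X) :=
  equivalence_of_categories (Pi1_map f) /\
  forall (M : local_system X) (n : nat)
    (P' P : infcat) (p' : functor P' X') (p : functor P X) (f' : functor P' P)
    (e : fcomp p f' = fcomp f p'),
    polygraphic_resolution p' -> polygraphic_resolution p ->
    bijective (Hpol_map e (n := n) (M := M)).

(* Main.v *)
From HB Require Import structures.
From mathcomp Require Import all_boot all_algebra generic_quotient ring_quotient.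
From mathcomp Require Import boolp classical_sets functions cardinality fsbigop.
From mathcomp Require Import zify.
From Stdlib Require Import Relation_Operators.
Require Import Defs.

(** Both halves of a polygraphic equivalence are recovered from the slices.

    Homology. Take resolutions [P1], [P2] of [X1], [X2] and a lift [g : P1 -> P2] of [f].
    Slicing under [x], as a functor on infinity-categories over the base category, has a
    right adjoint [coind]; it therefore preserves the pushouts and the colimit that build
    a polygraph, and it turns a generator into a coproduct of generators, one for each
    object over its source. So the slice of a polygraph is a polygraph, and the slice of a
    resolution, being a base change of it, is a resolution ([slice_resolution]). The
    hypothesis thus says that the slices of [g] induce isomorphisms on the homology of the
    chains with coefficients in any local system on [X2].

    For a local system [N] on a polygraph [P] over [X], the groups of n-chains of the slices
    of [P] form a presheaf on [X]. Adjoin an initial object to [X] and give to the presheaf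
    the n-chains of [P] itself as value there. In terms of generators this presheaf is the
    sum, over the n-generators [c], of the presheaf represented by the image of the source
    of [c], with coefficients in the group of [N] at the target of [c]. What is needed of
    this is that it is a natural direct summand of a sum of representables with coefficients
    ([slice_rel_projective]), and this can be proved without a basis: sending a cell to
    itself, seen in the slice under its own source, is a derivation, and derivations on a
    polygraph lift along additively split maps ([derivation_lift]), because such lifts are
    the sections of a trivial fibration. By dimension shifting, a complex of such presheaves
    which is exact at the objects of [X] is exact at the initial object too
    ([rel_projective_acyclic]); applied to a mapping cone, this says that the chains of [g]
    induce an isomorphism in homology as soon as those of its slices do
    ([slicewise_homology]).

    Fundamental groupoids. The slice under [p y] contains the anchor of [y], that is [y] with
    the identity of [p y]. Choose an object of the slice of [X1] and an arrow from its image
    to that anchor. A 1-cell from [y] to [z] lifts to an arrow from the anchor of [y] to the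
    restriction of the anchor of [z], which corresponds, the slices of [f] being fully
    faithful, to one arrow between the chosen objects. Projecting these arrows to [X1] yields a
    functor [glued] from the fundamental groupoid of [X2] to that of [X1], and the chosen
    arrows yield the isomorphisms which make it an inverse of the one induced by [f]. *)

Set Implicit Arguments.
Unset Strict Implicit.
Unset Printing Implicit Defensive.

Import GRing.Theory.
Local Open Scope ring_scope.
Local Open Scope quotient_scope.

(** * Functors out of disks and spheres *)

Lemma fcompA (A B C D : infcat) (h : functor C D) (g : functor B C) (f : functor A B) :
  fcomp h (fcomp g f) = fcomp (fcomp h g) f.
Proof. exact: functor_eq. Qed.

Program Definition fid (X : infcat) : functor X X := @Functor X X (fun _ x => x) _ _ _ _.
Next Obligation. exact: comp_congr. Qed.

Lemma fcomp_idl (X Y : infcat) (f : functor X Y) : fcomp (fid Y) f = f.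
Proof. exact: functor_eq. Qed.

Lemma fcomp_idr (X Y : infcat) (f : functor X Y) : fcomp f (fid X) = f.
Proof. exact: functor_eq. Qed.

Section FaceOps.
Variable X : infcat.

Lemma src_congr i n (h h' : (i <= n)%N) (x y : X n) : x = y -> src h x = src h' y.
Proof. by move=> <-; rewrite (bool_irrelevance h h'). Qed.

Lemma trg_congr i n (h h' : (i <= n)%N) (x y : X n) : x = y -> trg h x = trg h' y.
Proof. by move=> <-; rewrite (bool_irrelevance h h'). Qed.

Lemma idn_congr i n (h h' : (i <= n)%N) (x y : X i) : x = y -> idn h x = idn h' y.
Proof. by move=> <-; rewrite (bool_irrelevance h h'). Qed.

(** Source and target are treated together, as the two values of a boolean. *)
Definition face (b : bool) i n (h : (i <= n)%N) (x : X n) : X i :=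
  if b then trg h x else src h x.

Lemma src_face b i j n (hij : (i <= j)%N) (hjn : (j <= n)%N) (hin : (i <= n)%N) (x : X n) :
  (i < j)%N -> src hij (face b hjn x) = src hin x.
Proof. by move=> lt; case: b; [apply: src_trgW|apply: src_src]. Qed.

Lemma trg_face b i j n (hij : (i <= j)%N) (hjn : (j <= n)%N) (hin : (i <= n)%N) (x : X n) :
  (i < j)%N -> trg hij (face b hjn x) = trg hin x.
Proof. by move=> lt; case: b; [apply: trg_trg|apply: trg_srcW]. Qed.

Lemma face_face c b i j n (hij : (i <= j)%N) (hjn : (j <= n)%N) (hin : (i <= n)%N) (x : X n) :
  (i < j)%N -> face c hij (face b hjn x) = face c hin x.
Proof. by case: c => lt; [apply: trg_face|apply: src_face]. Qed.

Lemma face_id b n (h : (n <= n)%N) (x : X n) : face b h x = x.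
Proof. by case: b; [apply: trg_id|apply: src_id]. Qed.

Lemma face_idn_hi b i j n (hij : (i <= j)%N) (hjn : (j <= n)%N) (hin : (i <= n)%N)
  (x : X i) : face b hjn (idn hin x) = idn hij x.
Proof. by case: b; [apply: trg_idn_hi|apply: src_idn_hi]. Qed.

Lemma face_idn_lo b j i n (hji : (j <= i)%N) (hin : (i <= n)%N) (hjn : (j <= n)%N)
  (x : X i) : face b hjn (idn hin x) = face b hji x.
Proof. by case: b; [apply: trg_idn_lo|apply: src_idn_lo]. Qed.

Lemma comp_idrE i n (h : (i < n)%N) (x1 x0 : X n) e :
  x0 = idn (ltnW h) (src (ltnW h) x1) -> comp h x1 x0 e = x1.
Proof. by move=> e0; subst; apply: comp_idr. Qed.

Lemma comp_idlE i n (h : (i < n)%N) (x1 x0 : X n) e :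
  x1 = idn (ltnW h) (trg (ltnW h) x0) -> comp h x1 x0 e = x0.
Proof. by move=> e0; subst; apply: comp_idl. Qed.

Lemma idn_compE i n k (h : (i < n)%N) (hnk : (n <= k)%N) (h' : (i < k)%N) (x1 x0 : X n)
    e (y1 y0 : X k) e' :
  y1 = idn hnk x1 -> y0 = idn hnk x0 -> idn hnk (comp h x1 x0 e) = comp h' y1 y0 e'.
Proof. by move=> ? ?; subst; apply: idn_comp. Qed.

Lemma comp_assocE i n (h : (i < n)%N) (x2 x1 x0 y2 y1 y0 : X n) e1 e2 e3 e4 :
  x2 = y2 -> x1 = y1 -> x0 = y0 ->
  comp h x2 (comp h x1 x0 e1) e2 = comp h (comp h y2 y1 e3) y0 e4.
Proof. by move=> ? ? ?; subst; apply: comp_assoc. Qed.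

Lemma comp_exchangeE i j n (lt_ij : (i < j)%N) (hj : (j < n)%N) (hi : (i < n)%N)
    (y1 y0 x1 x0 y1' y0' x1' x0' : X n) e1 e2 e3 e4 e5 e6 :
  y1 = y1' -> y0 = y0' -> x1 = x1' -> x0 = x0' ->
  comp hi (comp hj y1 y0 e1) (comp hj x1 x0 e2) e3 =
  comp hj (comp hi y1' x1' e4) (comp hi y0' x0' e5) e6.
Proof. by move=> ? ? ? ?; subst; apply: (comp_exchange lt_ij). Qed.

Lemma src_comp_hiE i j n (lt_ij : (i < j)%N) (hjn : (j <= n)%N) (lt_in : (i < n)%N)
    (x1 x0 : X n) e (y1 y0 : X j) e' :
  src hjn x1 = y1 -> src hjn x0 = y0 -> src hjn (comp lt_in x1 x0 e) = comp lt_ij y1 y0 e'.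
Proof. by move=> ? ?; subst; apply: src_comp_hi. Qed.

Lemma trg_comp_hiE i j n (lt_ij : (i < j)%N) (hjn : (j <= n)%N) (lt_in : (i < n)%N)
    (x1 x0 : X n) e (y1 y0 : X j) e' :
  trg hjn x1 = y1 -> trg hjn x0 = y0 -> trg hjn (comp lt_in x1 x0 e) = comp lt_ij y1 y0 e'.
Proof. by move=> ? ?; subst; apply: trg_comp_hi. Qed.

Lemma src0_compW i n (h : (i < n)%N) (x1 x0 : X n) k :
  src0 (comp h x1 x0 k) = src0 x0.
Proof.
case: i h k => [|i] h k.
  by rewrite (bool_irrelevance (leq0n n) (ltnW h)) src_comp.
by rewrite -(src_src (leq0n i.+1) (ltnW h)) src_comp (src_src _ _ (leq0n n)).
Qed.

Lemma src0_compS i k (h : (i.+1 < k)%N) (x1 x0 : X k) :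
  trg (ltnW h) x0 = src (ltnW h) x1 -> src0 x0 = src0 x1.
Proof.
by move=> e; rewrite -[RHS](src_src (leq0n i.+1) (ltnW h)) -e (src_trgW _ _ (leq0n k)).
Qed.

Lemma trg0_compW i k (h : (i < k)%N) (x1 x0 : X k) e : trg0 (comp h x1 x0 e) = trg0 x1.
Proof.
case: i h e => [|i] h e.
  by rewrite (bool_irrelevance (leq0n k) (ltnW h)) trg_comp.
by rewrite -(trg_trg (leq0n i.+1) (ltnW h)) trg_comp (trg_trg _ _ (leq0n k)).
Qed.

Lemma trg0_compS i k (h : (i.+1 < k)%N) (x1 x0 : X k) :
  trg (ltnW h) x0 = src (ltnW h) x1 -> trg0 x0 = trg0 x1.
Proof.
by move=> e; rewrite -[LHS](trg_trg (leq0n i.+1) (ltnW h)) e (trg_srcW _ _ (leq0n k)).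
Qed.

End FaceOps.

Lemma fap_face (X Y : infcat) (f : functor X Y) b i n (h : (i <= n)%N) (x : X n) :
  fap f (face b h x) = face b h (fap f x).
Proof. by case: b; [apply: fap_trg|apply: fap_src]. Qed.

Section CellFunctor.
Variables (X : infcat) (n : nat) (c : X n).

Definition disk_top : disk n n.
Proof. by apply: (@GCell _ n (n, true)) => //=; rewrite eqxx orbT. Defined.

Lemma disk_le k (x : disk n k) : ((gval x).1 <= n)%N.
Proof. by case/orP: (gval_ok x) => [/ltnW|/eqP ->]. Qed.

(** A cell of the disk is an iterated unit of an iterated face of the top cell, and it goes to
    the same unit of the same face of [c]. *)
Definition cell_fap k (x : disk n k) : X k :=
  idn (gval_le x) (face (gval x).2 (disk_le x) c).

Lemma cell_fapE k (x : disk n k) j b (hjk : (j <= k)%N) (hjn : (j <= n)%N) :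
  gval x = (j, b) -> cell_fap x = idn hjk (face b hjn c).
Proof.
rewrite /cell_fap; move: (gval_le x) (disk_le x); case: (gval x) => j' b' /= h h' [? ?].
by subst; rewrite (bool_irrelevance h hjk) (bool_irrelevance h' hjn).
Qed.

Lemma cell_fap_face b i k (h : (i <= k)%N) (x : disk n k) :
  cell_fap (gface (@disk_down n) b h x) = face b h (cell_fap x).
Proof.
case e : (gval x) => [j b']; have := disk_le x; have := gval_le x; rewrite e /= => hjk hjn.
rewrite (cell_fapE hjk hjn e); have [ji|ij] := leqP j i.
  rewrite (face_idn_hi b ji h); apply: cell_fapE.
  by rewrite gval_face e /= ji.
have hin : (i <= n)%N by lia.
have hij := ltnW ij.
rewrite (face_idn_lo b hij) (face_face _ _ _ _ hin) //.
rewrite -[RHS](idn_id (leqnn i)); apply: cell_fapE.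
by rewrite gval_face e /= leqNgt ij.
Qed.

Lemma cell_fap_unit i k (lt_ik : (i < k)%N) (x : disk n k) (b : bool) :
  ((gval x).1 <= i)%N ->
  cell_fap x = idn (ltnW lt_ik) (face b (ltnW lt_ik) (cell_fap x)).
Proof.
case e : (gval x) => [j c']; have := disk_le x; have := gval_le x; rewrite e /= => hjk hjn ji.
by rewrite (cell_fapE hjk hjn e) (face_idn_hi _ ji) idn_idn.
Qed.

Program Definition cell_functor : functor (disk n) X :=
  @Functor (disk n) X cell_fap _ _ _ _.
Next Obligation. exact: (cell_fap_face false). Qed.
Next Obligation. exact: (cell_fap_face true). Qed.
Next Obligation.
case e : (gval x) => [j b]; have := disk_le x; have := gval_le x; rewrite e /= => hji hjn.
rewrite (cell_fapE hji hjn e) (idn_idn _ _ (leq_trans hji h)).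
exact: cell_fapE.
Qed.
Next Obligation.
move: x1 x0 e e' => x1 x0 e e'; rewrite /gcomp; case: ifPn => h1.
  move: e'; rewrite [cell_fap x1](cell_fap_unit h false) // => e'.
  have E : face false (ltnW h) (cell_fap x1) = trg (ltnW h) (cell_fap x0).
    by rewrite e' /= src_idn_lo // src_id.
  by move: e'; rewrite E => e'; rewrite comp_idl.
have h0 : ((gval x0).1 <= i)%N.
  rewrite leqNgt; apply/negP => h0.
  have := congr1 (@gval _ _) e; rewrite /= (negbTE h1) leqNgt h0 /= => -[].
  by [].
move: e'; rewrite [cell_fap x0](cell_fap_unit h true) // => e'.
have E : face true (ltnW h) (cell_fap x0) = src (ltnW h) (cell_fap x1).
  by rewrite -e' /= trg_idn_lo // trg_id.
by move: e'; rewrite E => e'; rewrite comp_idr.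
Qed.

Lemma cell_functor_top : fap cell_functor disk_top = c.
Proof. by rewrite /= (cell_fapE (leqnn n) (leqnn n) (b := true)) // idn_id face_id. Qed.

End CellFunctor.

Lemma disk_cellE n k (x : disk n k) :
  x = idn (gval_le x) (face (gval x).2 (disk_le x) (disk_top n)).
Proof.
have E : gval (face (gval x).2 (disk_le x) (disk_top n)) = gval x.
  move: (disk_le x) (gval_ok x); case: (gval x) => j [] /= h /orP[h'|/eqP[?]] //; subst.
  - by rewrite leqNgt h'.
  - by rewrite leqnn.
  - by rewrite leqNgt h'.
by apply: gcell_eq; rewrite -[RHS]/(gval (face (gval x).2 (disk_le x) (disk_top n))) E.
Qed.

Lemma disk_ext (X : infcat) n (g h : functor (disk n) X) :
  fap g (disk_top n) = fap h (disk_top n) -> g = h.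
Proof.
move=> gh; apply: functor_eq => k x.
by rewrite (disk_cellE x) !fap_idn !fap_face gh.
Qed.

Lemma sphere0_ext (X : infcat) (g h : functor (sphere 0) X) : g = h.
Proof. by apply: functor_eq => k x; have := gval_ok x. Qed.

Definition sphere_top n (b : bool) : sphere n.+1 n.
Proof. by apply: (@GCell _ n (n, b)). Defined.

Lemma sphere_le n k (x : sphere n.+1 k) : ((gval x).1 <= n)%N.
Proof. exact: gval_ok x. Qed.

Lemma sphere_cellE n k (x : sphere n.+1 k) :
  x = idn (gval_le x) (face (gval x).2 (sphere_le x) (sphere_top n (gval x).2)).
Proof.
have E : gval (face (gval x).2 (sphere_le x) (sphere_top n (gval x).2)) = gval x.
  move: (sphere_le x); case: (gval x) => j [] /= h.
    by case: ltngtP h => // -> /=.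
  by case: ltngtP h => // -> /=.
by apply: gcell_eq;
  rewrite -[RHS]/(gval (face (gval x).2 (sphere_le x) (sphere_top n (gval x).2))) E.
Qed.

Lemma sphere_ext (X : infcat) n (g h : functor (sphere n.+1) X) :
  (forall b, fap g (sphere_top n b) = fap h (sphere_top n b)) -> g = h.
Proof.
move=> gh; apply: functor_eq => k x.
by rewrite (sphere_cellE x) !fap_idn !fap_face gh.
Qed.

Lemma sphere_incl_top n b :
  fap (sphere_incl n.+1) (sphere_top n b) = face b (leqnSn n) (disk_top n.+1).
Proof. by apply: gcell_eq; case: b => /=; rewrite ltnn. Qed.

Lemma sphere_top_parallel n b i (h : (i <= n)%N) : (i < n)%N ->
  face b h (sphere_top n true) = face b h (sphere_top n false).
Proof. by move=> lt; apply: gcell_eq; case: b => /=; rewrite leqNgt lt. Qed.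

(** Lifting along all sphere inclusions amounts to lifting objects, and cells with
    prescribed boundary. *)
Lemma trivial_fibration_of_cells (X Y : infcat) (p : functor X Y) :
  (forall y : Y 0%N, exists x : X 0%N, fap p x = y) ->
  (forall n (u v : X n) (c : Y n.+1),
    (forall b i (h : (i <= n)%N), (i < n)%N -> face b h u = face b h v) ->
    src (leqnSn n) c = fap p u -> trg (leqnSn n) c = fap p v ->
    exists c' : X n.+1,
      [/\ src (leqnSn n) c' = u, trg (leqnSn n) c' = v & fap p c' = c]) ->
  trivial_fibration p.
Proof.
move=> h0 hS [|n] a b ab.
  have [x px] := h0 (fap b (disk_top 0)).
  exists (cell_functor x); first exact: sphere0_ext.
  by apply: disk_ext; rewrite /= -px -[in RHS](cell_functor_top x).
have E c : fap p (fap a (sphere_top n c)) = face c (leqnSn n) (fap b (disk_top n.+1)).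
  by rewrite -fap_face -sphere_incl_top -[LHS]/(fap (fcomp p a) _) ab.
have [||| c' [s t pc]] := hS n (fap a (sphere_top n false)) (fap a (sphere_top n true))
  (fap b (disk_top n.+1)).
- by move=> c i h lt; rewrite -!fap_face sphere_top_parallel.
- by rewrite E.
- by rewrite E.
exists (cell_functor c').
  apply: sphere_ext => d.
  rewrite -[LHS]/(fap (cell_functor c') (fap (sphere_incl n.+1) (sphere_top n d))).
  by rewrite sphere_incl_top fap_face cell_functor_top; case: d.
by apply: disk_ext; rewrite -[LHS]/(fap p (fap (cell_functor c') _)) cell_functor_top.
Qed.

(** * Sections of trivial fibrations over polygraphs *)

Section EmptyFunctor.
Variables (A B : infcat) (A0 : A 0%N -> False).

Definition empty_absurd n (x : A n) : False := A0 (src0 x).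

Program Definition empty_functor : functor A B :=
  @Functor A B (fun n x => False_rect (B n) (empty_absurd x)) _ _ _ _.
Next Obligation. by have := empty_absurd x. Qed.
Next Obligation. by have := empty_absurd x. Qed.
Next Obligation. by have := empty_absurd x. Qed.
Next Obligation. by have := empty_absurd x1. Qed.

Lemma empty_functor_ext (f g : functor A B) : f = g.
Proof. by apply: functor_eq => n x; case: (empty_absurd x). Qed.

End EmptyFunctor.

(** The uniqueness half of the universal property, for functors out of a pushout. *)
Lemma attaches_cells_ext n (A B Y : infcat) (j : functor A B) (I : Type)
  (bd : I -> functor (sphere n) A) (gen : I -> functor (disk n) B) (u v : functor B Y) :
  (forall i, fcomp j (bd i) = fcomp (gen i) (sphere_incl n)) ->
  (forall (Y : infcat) (g : functor A Y) (h : I -> functor (disk n) Y),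
      (forall i, fcomp g (bd i) = fcomp (h i) (sphere_incl n)) ->
      exists! u : functor B Y, fcomp u j = g /\ forall i, fcomp u (gen i) = h i) ->
  fcomp u j = fcomp v j -> (forall i, fcomp u (gen i) = fcomp v (gen i)) -> u = v.
Proof.
move=> sq po ej eg.
have [i|w [_ uniq]] := po _ (fcomp v j) (fun i => fcomp v (gen i)).
  by rewrite -fcompA sq fcompA.
by rewrite -(uniq u) // -(uniq v).
Qed.

Lemma colimit_ext (P Y : infcat) (sk : nat -> infcat) (j : forall n, functor (sk n) (sk n.+1))
  (k : forall n, functor (sk n) P) (u v : functor P Y) :
  (forall n, fcomp (k n.+1) (j n) = k n) ->
  (forall (Y : infcat) (g : forall n, functor (sk n) Y),
    (forall n, fcomp (g n.+1) (j n) = g n) ->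
    exists! u : functor P Y, forall n, fcomp u (k n) = g n) ->
  (forall n, fcomp u (k n) = fcomp v (k n)) -> u = v.
Proof.
move=> cocone colim e.
have [n|w [_ uniq]] := colim _ (fun n => fcomp v (k n)).
  by rewrite -fcompA cocone.
by rewrite -(uniq u) // -(uniq v).
Qed.

(** A section is built skeleton by skeleton: each generator of the next skeleton is
    sent to a lift whose boundary is already prescribed. *)
Lemma polygraph_section (E P : infcat) (p : functor E P) :
  polygraph P -> trivial_fibration p -> exists s : functor P E, fcomp p s = fid P.
Proof.
move=> [sk [j [k [sk0 att cocone colim]]]] fib.
pose T n := {s : functor (sk n) E | fcomp p s = k n}.
have T0 : T 0%N.
  by exists (empty_functor E sk0); apply: empty_functor_ext.
have step n (s : T n) : {s' : T n.+1 | fcomp (sval s') (j n) = sval s}.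
  apply: boolp.cid; have [I [bd [gen [sq po]]]] := att n.
  case: s => s es.
  have lift i : {l : functor (disk n) E |
      fcomp l (sphere_incl n) = fcomp s (bd i) /\ fcomp p l = fcomp (k n.+1) (gen i)}.
    apply: boolp.cid; have [|l l1 l2] := fib n (fcomp s (bd i)) (fcomp (k n.+1) (gen i)).
      by rewrite fcompA es -cocone -fcompA sq fcompA.
    by exists l.
  have [|u [[uj ug] _]] := po _ s (fun i => sval (lift i)).
    by move=> i; case: (svalP (lift i)) => ->.
  suff pu : fcomp p u = k n.+1 by exists (exist _ u pu).
  apply: (attaches_cells_ext sq po); first by rewrite -fcompA uj es cocone.
  by move=> i; rewrite -fcompA ug; case: (svalP (lift i)).
pose s := nat_rect T T0 (fun n s => sval (step n s)).
have sS n : fcomp (sval (s n.+1)) (j n) = sval (s n) by exact: (svalP (step n (s n))).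
have [u [uk _]] := colim _ (fun n => sval (s n)) sS.
exists u; apply: (colimit_ext cocone colim) => n.
by rewrite -fcompA uk (svalP (s n)) fcomp_idl.
Qed.

(** * Slices of polygraphs *)

Section Push.
Variables (C : category) (x : C).
Local Notation oC := (ofcat C).

(** The object over the target of [c] reached from an object over its source. *)
Definition push n : forall (c : oC n) (o : under_ob x), u_ob o = src0 c -> under_ob x :=
  match n return forall (c : oC n) (o : under_ob x), u_ob o = src0 c -> under_ob x with
  | 0 => fun _ o _ => o
  | _.+1 => fun c o e => UnderOb (ccomp (mor c) (eq_rect _ (hom x) (u_mor o) _ e))
  end.

Lemma u_ob_push n (c : oC n) (o : under_ob x) (e : u_ob o = src0 c) :
  u_ob (push e) = trg0 c.
Proof. by case: n c e. Qed.

Lemma push_congr n (c c' : oC n) (o o' : under_ob x) e e' :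
  c = c' -> o = o' -> @push n c o e = @push n c' o' e'.
Proof. by move=> ? ?; subst; rewrite (Prop_irrelevance e e'). Qed.

Lemma push_src i n (h : (i.+1 <= n)%N) (c : oC n) o e e' :
  @push _ (src h c) o e = @push _ c o e'.
Proof. by case: n h c e e' => [|n] h c e e' //=; rewrite (Prop_irrelevance e e'). Qed.

Lemma push_srcW i n (h : (i <= n)%N) (c : oC n) o e e' : (0 < i)%N ->
  @push _ (src h c) o e = @push _ c o e'.
Proof. by case: i h e => // i h e _; apply: push_src. Qed.

Lemma push_trg i n (h : (i.+1 <= n)%N) (c : oC n) o e e' :
  @push _ (trg h c) o e = @push _ c o e'.
Proof. by case: n h c e e' => [|n] h c e e' //=; rewrite (Prop_irrelevance e e'). Qed.

Lemma push_idn i n (h : (i <= n)%N) (c : oC i) o e e' :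
  @push _ (idn h c) o e = @push _ c o e'.
Proof.
case: i h c e e' => [|i]; case: n => [|n] h c e e' //=; last by rewrite (Prop_irrelevance e e').
by case: o e e' => a u /= e _; subst c; rewrite ccomp_idl.
Qed.

Lemma push_comp0 n (h : (0 < n)%N) (c1 c0 : oC n) k o e e0 e1 :
  @push _ (comp h c1 c0 k) o e = @push _ c1 (@push _ c0 o e0) e1.
Proof.
case: n h c1 c0 k e e0 e1 => [|n] h //= [b' c u1] [a b u0] /= k e e0 e1.
rewrite (Prop_irrelevance e e0) {e}; case: o e0 e1 => a' u /= e0; subst a' => /= e1.
by subst b'; rewrite (Prop_irrelevance e1 erefl) /= ccompA.
Qed.

Lemma push_compS i n (h : (i.+1 < n)%N) (c1 c0 : oC n) k o e e1 :
  @push _ (comp h c1 c0 k) o e = @push _ c1 o e1.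
Proof. by case: n h c1 c0 k e e1 => [|n] h //= c1 c0 k e e1; rewrite (Prop_irrelevance e e1). Qed.

Lemma push_compS0 i n (h : (i.+1 < n)%N) (c1 c0 : oC n) k o e e0 :
  @push _ (comp h c1 c0 k) o e = @push _ c0 o e0.
Proof.
case: n h c1 c0 k e e0 => [|n] h //= c1 c0 k e e0; case: i h k => [|i] h /= k; subst.
  by rewrite (Prop_irrelevance e e0).
by rewrite (Prop_irrelevance e e0).
Qed.

End Push.

(** The right adjoint of slicing under [x]. A cell of [coind] over [c] assigns cells of [Y] to all
    the ways of seeing [c] in the category under [x], that is to all objects over the
    source of [c]. The objects over the target of [c] need not be pushed forward from
    the source, hence the second component. *)
Section Coinduction.
Variables (C : category) (x : C) (Y : infcat).
Local Notation oC := (ofcat C).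

Record rcell n := RCell {
  rc : oC n;
  ry : forall o : under_ob x, u_ob o = src0 rc -> Y n;
  rz : forall o : under_ob x, u_ob o = trg0 rc -> Y 0%N;
  ryz : forall o (e : u_ob o = src0 rc), trg0 (ry e) = rz (u_ob_push e)
}.

Arguments ry {n} r {o} e.
Arguments rz {n} r {o} e.
Arguments ryz {n} r {o} e.

Lemma rcell_eq n (c c' : rcell n) : rc c = rc c' ->
  (forall o e e', ry c (o := o) e = ry c' (o := o) e') ->
  (forall o e e', rz c (o := o) e = rz c' (o := o) e') -> c = c'.
Proof.
case: c c' => [c y z yz] [c' y' z' yz'] /= ec ey ez; subst c'.
have Ey : y = y'.
  by apply: functional_extensionality_dep => o; apply: functional_extensionality_dep => e.
have Ez : z = z'.
  by apply: functional_extensionality_dep => o; apply: functional_extensionality_dep => e.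
by subst; congr RCell; apply: Prop_irrelevance.
Qed.

Lemma ry_congr n (c c' : rcell n) (o o' : under_ob x) e e' :
  c = c' -> o = o' -> ry c (o := o) e = ry c' (o := o') e'.
Proof. by move=> ? ?; subst; rewrite (Prop_irrelevance e e'). Qed.

Lemma rz_congr n (c c' : rcell n) (o o' : under_ob x) e e' :
  c = c' -> o = o' -> rz c (o := o) e = rz c' (o := o') e'.
Proof. by move=> ? ?; subst; rewrite (Prop_irrelevance e e'). Qed.

Lemma ryzE n (c : rcell n) (o o' : under_ob x) e e' :
  o' = @push _ _ _ (rc c) o e -> trg0 (ry c e) = rz c (o := o') e'.
Proof. by move=> eo; subst o'; rewrite ryz; apply: rz_congr. Qed.

Lemma ryz0 (c : rcell 0%N) (o : under_ob x) e e' : ry c (o := o) e = rz c (o := o) e'.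
Proof. by have := @ryzE 0 c o o e e' erefl; rewrite trg_id. Qed.

Lemma src0_src i n (h : (i <= n)%N) (c : oC n) : src0 (src h c) = src0 c.
Proof. exact: src_src. Qed.

Lemma src0_trg i n (h : (i.+1 <= n)%N) (c : oC n) : src0 (trg h c) = src0 c.
Proof. exact: src_trgW. Qed.

Lemma trg0_trgW i n (h : (i <= n)%N) (c : oC n) : trg0 (trg h c) = trg0 c.
Proof. exact: trg_trg. Qed.

Lemma trg0_srcS i n (h : (i.+1 <= n)%N) (c : oC n) : trg0 (src h c) = trg0 c.
Proof. exact: trg_srcW. Qed.

Lemma trg0_src0 n (h : (0 <= n)%N) (c : oC n) : trg0 (src h c) = src0 c.
Proof. by rewrite (bool_irrelevance h (leq0n n)) trg_id. Qed.

Lemma src0_trg0 n (h : (0 <= n)%N) (c : oC n) : src0 (trg h c) = trg0 c.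
Proof. by rewrite (bool_irrelevance h (leq0n n)) src_id. Qed.

Lemma src0_idn i n (h : (i <= n)%N) (c : oC i) : src0 (idn h c) = src0 c.
Proof. exact: src_idn_lo. Qed.

Lemma trg0_idn i n (h : (i <= n)%N) (c : oC i) : trg0 (idn h c) = trg0 c.
Proof. exact: trg_idn_lo. Qed.

Definition rsrc_z n (c : rcell n) i :
    forall (h : (i <= n)%N) (o : under_ob x), u_ob o = trg0 (src h (rc c)) -> Y 0%N :=
  match i with
  | 0 => fun h o e => src0 (ry c (o := o) (etrans e (trg0_src0 h (rc c))))
  | _.+1 => fun h o e => rz c (o := o) (etrans e (trg0_srcS h (rc c)))
  end.

Program Definition rsrc i n (h : (i <= n)%N) (c : rcell n) : rcell i :=
  @RCell i (src h (rc c))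
    (fun o e => src h (ry c (o := o) (etrans e (src0_src h (rc c)))))
    (@rsrc_z n c i h) _.
Next Obligation.
case: i h e => [|i] h e.
  by rewrite trg_id /=; apply/src_congr/ry_congr.
rewrite (trg_srcW _ _ (leq0n n)) //=; apply: ryzE.
exact: push_src.
Qed.

Definition rtrg_y n (c : rcell n) i :
    forall (h : (i <= n)%N) (o : under_ob x), u_ob o = src0 (trg h (rc c)) -> Y i :=
  match i with
  | 0 => fun h o e => rz c (o := o) (etrans e (src0_trg0 h (rc c)))
  | _.+1 => fun h o e => trg h (ry c (o := o) (etrans e (src0_trg h (rc c))))
  end.

Program Definition rtrg i n (h : (i <= n)%N) (c : rcell n) : rcell i :=
  @RCell i (trg h (rc c)) (@rtrg_y n c i h)
    (fun o e => rz c (o := o) (etrans e (trg0_trgW h (rc c)))) _.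
Next Obligation.
case: i h e => [|i] h e /=; first by rewrite trg_id; apply: rz_congr.
rewrite (trg_trg _ _ (leq0n n)); apply: ryzE.
exact: push_trg.
Qed.

Program Definition ridn i n (h : (i <= n)%N) (c : rcell i) : rcell n :=
  @RCell n (idn h (rc c))
    (fun o e => idn h (ry c (o := o) (etrans e (src0_idn h (rc c)))))
    (fun o e => rz c (o := o) (etrans e (trg0_idn h (rc c)))) _.
Next Obligation.
rewrite (trg_idn_lo (leq0n i)); apply: ryzE.
exact: push_idn.
Qed.

Lemma ry_rtrgS i n (h : (i <= n)%N) (c : rcell n) (o : under_ob x) e : (0 < i)%N ->
  exists e', ry (rtrg h c) (o := o) e = trg h (ry c (o := o) e').
Proof. by case: i h e => // i h e _; exists (etrans e (src0_trg h (rc c))). Qed.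

Lemma rz_rsrcS i n (h : (i <= n)%N) (c : rcell n) (o : under_ob x) e : (0 < i)%N ->
  exists e', rz (rsrc h c) (o := o) e = rz c (o := o) e'.
Proof. by case: i h e => // i h e _; exists (etrans e (trg0_srcS h (rc c))). Qed.

Lemma rz_trg0 n (c c' : rcell n) (o : under_ob x) e e' :
  rtrg (leq0n n) c = rtrg (leq0n n) c' -> rz c (o := o) e = rz c' (o := o) e'.
Proof.
move=> E; have e1 : u_ob o = src0 (rc (rtrg (leq0n n) c)).
  exact: (etrans e (esym (src0_trg0 _ _))).
have e2 : u_ob o = src0 (rc (rtrg (leq0n n) c')) by rewrite -E.
apply: etrans (etrans (ry_congr e1 e2 E erefl) _); exact: rz_congr.
Qed.

Section Comp.
Variables (n : nat) (c1 c0 : rcell n).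

Lemma rcomp_rc i (h : (i < n)%N) (k : rtrg (ltnW h) c0 = rsrc (ltnW h) c1) :
  trg (ltnW h) (rc c0) = src (ltnW h) (rc c1).
Proof. exact: (congr1 (@rc i) k). Qed.

Lemma rcomp_mid (h : (0 < n)%N) (k : rtrg (ltnW h) c0 = rsrc (ltnW h) c1) :
  trg0 (rc c0) = src0 (rc c1).
Proof.
by have := rcomp_rc k; rewrite (bool_irrelevance (ltnW h) (leq0n n)).
Qed.

(** For [0]-composition the upper cell is evaluated at the object pushed forward along the
    lower one; for other compositions both cells have the same objects over their source. *)
Lemma rcomp_y0 (h : (0 < n)%N) (k : rtrg (ltnW h) c0 = rsrc (ltnW h) c1)
  (o o' : under_ob x) e e' : o' = @push _ _ _ (rc c0) o e ->
  trg (ltnW h) (ry c0 (o := o) e) = src (ltnW h) (ry c1 (o := o') e').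
Proof.
move=> eo.
have ez : u_ob o' = trg0 (rc c0) by rewrite eo u_ob_push.
have e1 : u_ob o' = src0 (rc (rtrg (ltnW h) c0)) by exact: etrans ez (esym (src0_trg0 (ltnW h) (rc c0))).
have e2 : u_ob o' = src0 (rc (rsrc (ltnW h) c1)) by rewrite -k.
have E := ry_congr e1 e2 k erefl; rewrite /= in E.
rewrite (Prop_irrelevance e' (etrans e2 (src0_src (ltnW h) (rc c1)))) -E.
apply: (etrans (y := trg0 (ry c0 e))); first exact: trg_congr.
by rewrite (ryzE ez eo); apply: rz_congr.
Qed.

Lemma rcomp_yS i (h : (i.+1 < n)%N) (k : rtrg (ltnW h) c0 = rsrc (ltnW h) c1)
  (o : under_ob x) e e' :
  trg (ltnW h) (ry c0 (o := o) e) = src (ltnW h) (ry c1 (o := o) e').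
Proof.
have e1 : u_ob o = src0 (rc (rtrg (ltnW h) c0)) by exact: etrans e (esym (src0_trg (ltnW h) (rc c0))).
have e2 : u_ob o = src0 (rc (rsrc (ltnW h) c1)) by rewrite -k.
have E := ry_congr e1 e2 k erefl; rewrite /= in E.
rewrite (Prop_irrelevance e' (etrans e2 (src0_src (ltnW h) (rc c1)))) -E.
by rewrite (Prop_irrelevance e (etrans e1 (src0_trg (ltnW h) (rc c0)))).
Qed.

Lemma rcomp_zS i (h : (i.+1 < n)%N) (k : rtrg (ltnW h) c0 = rsrc (ltnW h) c1)
  (o : under_ob x) e e' : rz c0 (o := o) e = rz c1 (o := o) e'.
Proof.
have e1 : u_ob o = trg0 (rc (rtrg (ltnW h) c0)) by exact: etrans e (esym (trg0_trgW (ltnW h) (rc c0))).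
have e2 : u_ob o = trg0 (rc (rsrc (ltnW h) c1)) by rewrite -k.
have E := rz_congr e1 e2 k erefl; rewrite /= in E.
rewrite (Prop_irrelevance e' (etrans e2 (trg0_srcS (ltnW h) (rc c1)))) -E.
by rewrite (Prop_irrelevance e (etrans e1 (trg0_trgW (ltnW h) (rc c0)))).
Qed.

Definition rcomp_y i : forall (h : (i < n)%N) (k : rtrg (ltnW h) c0 = rsrc (ltnW h) c1)
    (o : under_ob x), u_ob o = src0 (comp h (rc c1) (rc c0) (rcomp_rc k)) -> Y n :=
  match i with
  | 0 => fun h k o e =>
      let e0 := etrans e (src0_compW (rcomp_rc k)) in
      comp h (ry c1 (o := push e0) (etrans (u_ob_push e0) (rcomp_mid k))) (ry c0 e0)
        (rcomp_y0 k _ erefl)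
  | _.+1 => fun h k o e =>
      let e0 := etrans e (src0_compW (rcomp_rc k)) in
      comp h (ry c1 (etrans e0 (src0_compS (rcomp_rc k)))) (ry c0 e0) (rcomp_yS k _ _)
  end.

Program Definition rcomp i (h : (i < n)%N) (k : rtrg (ltnW h) c0 = rsrc (ltnW h) c1) :
  rcell n :=
  @RCell n (comp h (rc c1) (rc c0) (rcomp_rc k)) (@rcomp_y i h k)
    (fun o e => rz c1 (o := o) (etrans e (trg0_compW (rcomp_rc k)))) _.
Next Obligation.
case: i h k e => [|i] h k e /=.
  rewrite {1}(bool_irrelevance (leq0n n) (ltnW h)) trg_comp.
  apply: (etrans (trg_congr (ltnW h) (leq0n n) erefl)); apply: ryzE.
  exact: push_comp0.
rewrite -(trg_trg (leq0n i.+1) (ltnW h)) trg_comp (trg_trg _ _ (leq0n n)); apply: ryzE.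
exact: push_compS.
Qed.

End Comp.

Program Definition coind : infcat :=
  @InfCat rcell rsrc rtrg ridn (fun i n h c1 c0 k => @rcomp n c1 c0 i h k)
    _ _ _ _ _ _ _ _ _ _ _ _ _ _ _ _ _ _ _ _ _.
Next Obligation.
apply: rcell_eq => [|o e e'|o e e'] /=; first exact: (@src_id oC).
  by rewrite src_id; apply: ry_congr.
case: n h x0 e e' => [|n] h c e e' /=; last exact: rz_congr.
by rewrite src_id; apply: ryz0.
Qed.
Next Obligation.
apply: rcell_eq => [|o e e'|o e e'] /=; [exact: (@trg_id oC)| |exact: rz_congr].
case: n h x0 e e' => [|n] h c e e' /=; first by apply/esym/ryz0.
by rewrite trg_id; apply: ry_congr.
Qed.
Next Obligation.
apply: rcell_eq => [|o e e'|o e e'] /=; first exact: (@src_src oC).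
  by rewrite (src_src _ _ hin); apply/src_congr/ry_congr.
case: i hij hin e e' => [|i] hij hin e e' /=.
  by rewrite (src_src _ _ (leq0n n)); apply/src_congr/ry_congr.
by case: j hij hjn e => [|j] hij hjn e //=; apply: rz_congr.
Qed.
Next Obligation.
apply: rcell_eq => [|o e e'|o e e'] /=; [exact: (@trg_trg oC)| |exact: rz_congr].
case: i hij hin e e' => [|i] hij hin e e' /=; first exact: rz_congr.
case: j hij hjn e => [|j] hij hjn e //=.
by rewrite (trg_trg _ _ hin); apply/trg_congr/ry_congr.
Qed.
Next Obligation.
apply: rcell_eq => [|o e e'|o e e'] /=; first exact: (@src_trg oC).
  case: j lt_ij hjn e => [|j] lt_ij hjn e //=.
  by rewrite (src_trgW _ _ hin) //; apply/src_congr/ry_congr.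
case: i lt_ij hin e e' => [|i] lt_ij hin e e' /=; last exact: rz_congr.
case: j lt_ij hjn e => [|j] lt_ij hjn e //=.
by rewrite (src_trgW _ _ (leq0n n)) //; apply/src_congr/ry_congr.
Qed.
Next Obligation.
apply: rcell_eq => [|o e e'|o e e'] /=; first exact: (@trg_src oC).
  case: i lt_ij hin e e' => [|i] lt_ij hin e e' /=.
    by case: j lt_ij hjn e => [|j] lt_ij hjn e //=; apply: rz_congr.
  by rewrite (trg_srcW _ _ hin) //; apply/trg_congr/ry_congr.
by case: j lt_ij hjn e => [|j] lt_ij hjn e //=; apply: rz_congr.
Qed.
Next Obligation.
apply: rcell_eq => [|o e e'|o e e'] /=; [exact: (@idn_id oC)| |exact: rz_congr].
by rewrite idn_id; apply: ry_congr.
Qed.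
Next Obligation.
apply: rcell_eq => [|o e e'|o e e'] /=; [exact: (@idn_idn oC)| |exact: rz_congr].
by rewrite (idn_idn _ _ hin); apply/idn_congr/ry_congr.
Qed.
Next Obligation.
apply: rcell_eq => [|o e e'|o e e'] /=; first exact: (@src_idn_hi oC).
  by rewrite (src_idn_hi hij); apply/idn_congr/ry_congr.
case: j hij hjn e e' => [|j] hij hjn e e' /=; last exact: rz_congr.
case: i x0 hij hin e e' => [|i] c hij hin e e' //=.
by rewrite (src_idn_lo (leq0n 0)) src_id; apply: ryz0.
Qed.
Next Obligation.
apply: rcell_eq => [|o e e'|o e e'] /=; [exact: (@trg_idn_hi oC)| |exact: rz_congr].
case: j hij hjn e e' => [|j] hij hjn e e' /=.
  by case: i x0 hij hin e e' => [|i] c hij hin e e' //=; rewrite idn_id; apply/esym/ryz0.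
by rewrite (trg_idn_hi hij); apply/idn_congr/ry_congr.
Qed.
Next Obligation.
apply: rcell_eq => [|o e e'|o e e'] /=; first exact: (@src_idn_lo oC).
  by rewrite (src_idn_lo hji); apply/src_congr/ry_congr.
case: j hji hjn e e' => [|j] hji hjn e e' /=; last exact: rz_congr.
by rewrite (src_idn_lo (leq0n i)); apply/src_congr/ry_congr.
Qed.
Next Obligation.
apply: rcell_eq => [|o e e'|o e e'] /=; [exact: (@trg_idn_lo oC)| |exact: rz_congr].
case: j hji hjn e e' => [|j] hji hjn e e' /=; first exact: rz_congr.
by rewrite (trg_idn_lo hji); apply/trg_congr/ry_congr.
Qed.
Next Obligation.
apply: rcell_eq => [|o e' e''|o e' e''] /=; first exact: (@src_comp oC).
  by case: i lt_in e e' e'' => [|i] lt_in e e' e'' /=; rewrite src_comp; apply/src_congr/ry_congr.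
case: i lt_in e e' e'' => [|i] lt_in e e' e'' /=; last exact: (esym (rcomp_zS e _ _)).
apply: (etrans (src_congr (leq0n n) (ltnW lt_in) erefl)); rewrite src_comp.
exact/src_congr/ry_congr.
Qed.
Next Obligation.
apply: rcell_eq => [|o e' e''|o e' e''] /=; [exact: (@trg_comp oC)| |exact: rz_congr].
case: i lt_in e e' e'' => [|i] lt_in e e' e'' /=; first exact: rz_congr.
by rewrite trg_comp; apply/trg_congr/ry_congr.
Qed.
Next Obligation.
apply: rcell_eq => [|o k k'|o k k'] /=; first exact: (@src_comp_hi oC).
  case: i lt_ij lt_in e e' k k' => [|i] lt_ij lt_in e e' k k' /=.
    apply: src_comp_hiE; apply/src_congr/ry_congr => //.
    by apply/esym/push_srcW.
  by apply: src_comp_hiE; apply/src_congr/ry_congr.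
by case: j lt_ij hjn e' k k' => [|j] // lt_ij hjn e' k k' /=; apply: rz_congr.
Qed.
Next Obligation.
apply: rcell_eq => [|o k k'|o k k'] /=; [exact: (@trg_comp_hi oC)| |exact: rz_congr].
case: j lt_ij hjn e' k k' => [|j] // lt_ij hjn e' k k'.
case: i lt_ij lt_in e e' k k' => [|i] lt_ij lt_in e e' k k' /=.
  apply: trg_comp_hiE; apply/trg_congr/ry_congr => //.
  exact/esym/push_trg.
by apply: trg_comp_hiE; apply/trg_congr/ry_congr.
Qed.
Next Obligation.
apply: rcell_eq => [|o k k'|o k k'] /=; [exact: (@comp_idr oC)| |exact: rz_congr].
have P : forall (h : (0 < n)%N) (o' : under_ob x) e',
    @push _ _ _ (idn (ltnW h) (src (ltnW h) (rc x0))) o' e' = o'.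
  move=> h o' e'; have e'' : u_ob o' = src0 (src (ltnW h) (rc x0)).
    by rewrite e' src0_idn.
  by rewrite (push_idn e' e'').
case: i lt_in e k => [|i] lt_in e k /=; rewrite comp_idrE.
- by apply: ry_congr => //; apply: P.
- by apply/idn_congr/src_congr/ry_congr => //; apply/esym/P.
- exact: ry_congr.
- exact/idn_congr/src_congr/ry_congr.
Qed.
Next Obligation.
apply: rcell_eq => [|o k k'|o k k'] /=; [exact: (@comp_idl oC)| |exact: rz_congr].
case: i lt_in e k => [|i] lt_in e k /=; rewrite comp_idlE.
- exact: ry_congr.
- apply: idn_congr; apply: esym.
  apply: (etrans (trg_congr (ltnW lt_in) (leq0n n) erefl)); exact: ryzE.
- exact: ry_congr.
- exact/idn_congr/trg_congr/ry_congr.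
Qed.
Next Obligation.
apply: rcell_eq => [|o u u'|o u u'] /=; [exact: (@idn_comp oC)| |exact: rz_congr].
case: i lt_in lt_ik e e' u u' => [|i] lt_in lt_ik e e' u u' /=.
  by apply: idn_compE; apply/idn_congr/ry_congr => //; apply: push_idn.
by apply: idn_compE; apply/idn_congr/ry_congr.
Qed.
Next Obligation.
apply: rcell_eq => [|o k k'|o k k'] /=; [exact: (@comp_assoc oC)| |exact: rz_congr].
case: i lt_in e10 e21 el er k k' => [|i] lt_in e10 e21 el er k k' /=.
  apply: comp_assocE; apply: ry_congr => //.
    exact: push_comp0.
  exact: push_congr.
by apply: comp_assocE; apply: ry_congr.
Qed.
Next Obligation.
apply: rcell_eq => [|o k k'|o k k'] /=; [exact: (@comp_exchange oC)| |].
  case: j lt_ij lt_jn ey ex eyx e1 e0 e10 k k' => [|j] // lt_ij lt_jn ey ex eyx e1 e0 e10 k k'.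
  case: i lt_ij lt_in eyx e1 e0 e10 k k' => [|i] lt_ij lt_in eyx e1 e0 e10 k k' /=.
    apply: (comp_exchangeE lt_ij); apply: ry_congr => //.
      exact: push_compS.
    exact: push_compS0.
  by apply: (comp_exchangeE lt_ij); apply: ry_congr.
exact: rz_congr.
Qed.

End Coinduction.
Arguments ry {C x Y n} r {o} e.
Arguments rz {C x Y n} r {o} e.

(** * Adjunction between slicing and coinduction *)

Section FibreProductMaps.
Variables (A B C D : infcat) (f : functor A C) (g : functor B C).

Program Definition fp_fst : functor (fprod f g) A :=
  @Functor (fprod f g) A (fun n x => fpl x) _ _ _ _.
Next Obligation. exact: comp_congr. Qed.

Program Definition fp_snd : functor (fprod f g) B :=
  @Functor (fprod f g) B (fun n x => fpr x) _ _ _ _.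
Next Obligation. exact: comp_congr. Qed.

Lemma fp_comm : fcomp f fp_fst = fcomp g fp_snd.
Proof. by apply: functor_eq => n x; apply: fp_eq. Qed.

Section Pairing.
Variables (a : functor D A) (b : functor D B) (e : fcomp f a = fcomp g b).

Lemma fp_pair_eq n (x : D n) : fap f (fap a x) = fap g (fap b x).
Proof. exact: (congr1 (fun h => fap h x) e). Qed.

Program Definition fp_pair : functor D (fprod f g) :=
  @Functor D (fprod f g) (fun n x => FPCell (fp_pair_eq x)) _ _ _ _.
Next Obligation. by apply: fpcell_eq; apply: fap_src. Qed.
Next Obligation. by apply: fpcell_eq; apply: fap_trg. Qed.
Next Obligation. by apply: fpcell_eq; apply: fap_idn. Qed.
Next Obligation. by apply: fpcell_eq; apply: fap_comp. Qed.

Lemma fp_fst_pair : fcomp fp_fst fp_pair = a. Proof. exact: functor_eq. Qed.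
Lemma fp_snd_pair : fcomp fp_snd fp_pair = b. Proof. exact: functor_eq. Qed.

End Pairing.

Lemma fp_ext (u v : functor D (fprod f g)) :
  fcomp fp_fst u = fcomp fp_fst v -> fcomp fp_snd u = fcomp fp_snd v -> u = v.
Proof.
move=> e1 e2; apply: functor_eq => n x; apply: fpcell_eq.
  exact: (congr1 (fun h => fap h x) e1).
exact: (congr1 (fun h => fap h x) e2).
Qed.

End FibreProductMaps.

Section MorCast.
Variable C : category.

Definition mor_cast (w : arrow C) (a b : C) (ea : dom w = a) (eb : cod w = b) : hom a b :=
  eq_rect _ (fun b => hom a b) (eq_rect _ (fun a => hom a (cod w)) (mor w) a ea) b eb.

Lemma mor_cast_congr (w w' : arrow C) (a b : C) ea eb ea' eb' :
  w = w' -> @mor_cast w a b ea eb = @mor_cast w' a b ea' eb'.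
Proof.
by move=> ew; subst w'; rewrite (Prop_irrelevance ea ea') (Prop_irrelevance eb eb').
Qed.

Lemma arrow_inj (a b : C) (u v : hom a b) : Arrow u = Arrow v -> u = v.
Proof. exact: (@mor_cast_congr (Arrow u) (Arrow v) a b erefl erefl erefl erefl). Qed.

Lemma mor_castK (w : arrow C) (a b : C) ea eb : Arrow (@mor_cast w a b ea eb) = w.
Proof. by case: w ea eb => a' b' u /= ea eb; subst. Qed.

End MorCast.

Section UnderLift.
Variables (C : category) (x : C).
Local Notation oC := (ofcat C).
Local Notation oU := (ofcat (under x)).
Local Notation q := (ofcat_map (under_forget x)).

(** The forgetful functor from the category under [x] is a discrete opfibration. *)
Lemma under_inj n (d d' : oU n) : fap q d = fap q d' -> src0 d = src0 d' -> d = d'.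
Proof.
case: n d d' => [|n] //= [o1 o2 u] [o1' o2' u'] /= e eo; subst o1'.
have eb : u_ob o2 = u_ob o2' := congr1 (@cod C) e.
case: o2 o2' u u' e eb => b v [b' v'] [u t] [u' t'] /= e eb; subst b'.
have ? := arrow_inj e; subst u'; have ? : v = v' by rewrite /= in t t'; rewrite -t -t'.
by subst v'; rewrite (Prop_irrelevance t t').
Qed.

Lemma push_mor n (c : oC n.+1) (o : under_ob x) (e : u_ob o = src0 c) :
  ccomp (mor_cast (w := c) (esym e) (erefl (cod c))) (u_mor o) = u_mor (push e).
Proof.
case: o c e => a v [a' b u] /= e; subst a'.
by rewrite (Prop_irrelevance (esym _) erefl).
Qed.

Definition olift n : forall (c : oC n) (o : under_ob x), u_ob o = src0 c -> oU n :=
  match n return forall (c : oC n) (o : under_ob x), u_ob o = src0 c -> oU n with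
  | 0 => fun _ o _ => o
  | n'.+1 => fun c o e => @Arrow (under x) o (@push C x n'.+1 c o e)
        (@UnderHom C x o (@push C x n'.+1 c o e) _ (push_mor e))
  end.

Lemma olift_over n (c : oC n) (o : under_ob x) (e : u_ob o = src0 c) : fap q (olift e) = c.
Proof.
by case: n c e => [|n] c e //; case: c e => a b u /= e; subst a.
Qed.

Lemma src0_olift n (c : oC n) (o : under_ob x) (e : u_ob o = src0 c) : src0 (olift e) = o.
Proof. by case: n c e. Qed.

Lemma trg0_olift n (c : oC n) (o : under_ob x) (e : u_ob o = src0 c) :
  trg0 (olift e) = push e.
Proof. by case: n c e. Qed.

Lemma oliftE n (d : oU n) (c : oC n) (o : under_ob x) (e : u_ob o = src0 c) :
  fap q d = c -> src0 d = o -> d = olift e.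
Proof. by move=> dc eo; apply: under_inj; rewrite ?olift_over ?src0_olift. Qed.

Lemma under_src0 n (d : oU n) : u_ob (src0 d : under_ob x) = src0 (fap q d).
Proof. by rewrite -fap_src. Qed.

Lemma under_trg0 n (d : oU n) : u_ob (trg0 d : under_ob x) = trg0 (fap q d).
Proof. by rewrite -fap_trg. Qed.

Lemma under_push n (d : oU n) (c : oC n) (o : under_ob x) (e : u_ob o = src0 c) :
  fap q d = c -> src0 d = o -> trg0 d = push e.
Proof. by move=> h1 h2; rewrite (oliftE e h1 h2) trg0_olift. Qed.

End UnderLift.

Section Slice.
Variables (C : category) (x : C) (P : infcat) (r : functor P (ofcat C)).
Local Notation oC := (ofcat C).
Local Notation oU := (ofcat (under x)).
Local Notation q := (ofcat_map (under_forget x)).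
Local Notation S := (slice r x).

Lemma slice_eq n (c c' : S n) :
  fpl c = fpl c' -> src0 (fpr c) = src0 (fpr c') -> c = c'.
Proof.
move=> el er; apply: fpcell_eq => //; apply: under_inj => //.
by rewrite -!(fp_eq (f := r)) el.
Qed.

(** The slice inherits unique lifting from the category under [x]: a cell over [b] is
    determined by its source. *)
Definition scell n (b : P n) (o : under_ob x) (e : u_ob o = src0 (fap r b)) : S n :=
  FPCell (f := r) (g := q) (esym (olift_over e)).

Lemma scell_uniq n (c : S n) (b : P n) (o : under_ob x) (e : u_ob o = src0 (fap r b)) :
  fpl c = b -> src0 (fpr c) = o -> c = scell e.
Proof. by move=> h1 h2; apply: slice_eq; rewrite // h2; apply/esym/src0_olift. Qed.

Lemma scell_congr n (b b' : P n) (o o' : under_ob x) e e' :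
  b = b' -> o = o' -> @scell n b o e = @scell n b' o' e'.
Proof. by move=> ? ?; subst; rewrite (Prop_irrelevance e e'). Qed.

Lemma slice_src0 n (c : S n) : u_ob (src0 (fpr c) : under_ob x) = src0 (fap r (fpl c)).
Proof. by rewrite (fp_eq c) -under_src0. Qed.

Lemma slice_trg0 n (c : S n) : u_ob (trg0 (fpr c) : under_ob x) = trg0 (fap r (fpl c)).
Proof. by rewrite (fp_eq c) -under_trg0. Qed.

Lemma slice_push n (c : S n) (o : under_ob x) (e : u_ob o = src0 (fap r (fpl c))) :
  src0 (fpr c) = o -> trg0 (fpr c) = push e.
Proof. by move=> eo; apply: under_push; rewrite ?(fp_eq c). Qed.

Lemma src_scell i n (h : (i <= n)%N) (b : P n) (o : under_ob x) e e' :
  src h (@scell n b o e) = @scell i (src h b) o e'.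
Proof. by apply: scell_uniq => //; exact: (etrans (@src_src oU _ _ _ _ _ (leq0n n) _) (src0_olift e)). Qed.

Lemma trg_scell i n (h : (i.+1 <= n)%N) (b : P n) (o : under_ob x) e e' :
  trg h (@scell n b o e) = @scell i.+1 (trg h b) o e'.
Proof. by apply: scell_uniq => //; exact: (etrans (@src_trgW oU _ _ _ _ _ (leq0n n) _ (ltn0Sn i)) (src0_olift e)). Qed.

Lemma trg0_scell n (h : (0 <= n)%N) (b : P n) (o : under_ob x) e e' :
  trg h (@scell n b o e) = @scell 0 (trg h b) (push e) e'.
Proof.
apply: scell_uniq => //; apply: (etrans (@src_id oU _ _ _)).
exact: (etrans (@trg_congr oU _ _ h (leq0n n) _ _ erefl) (trg0_olift e)).
Qed.

Lemma idn_scell i n (h : (i <= n)%N) (b : P i) (o : under_ob x) e e' :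
  idn h (@scell i b o e) = @scell n (idn h b) o e'.
Proof. by apply: scell_uniq => //; exact: (etrans (@src_idn_lo oU _ _ _ (leq0n i) _ _ _) (src0_olift e)). Qed.

Lemma scell_composable0 n (h : (0 <= n)%N) (b1 b0 : P n) (o : under_ob x) e0 e1 :
  trg h b0 = src h b1 ->
  trg h (@scell n b0 o e0) = src h (@scell n b1 (push e0) e1).
Proof.
move=> k; have e : u_ob (push e0) = src0 (fap r (src h b1)).
  by rewrite e1 fap_src (@src_src oC _ _ _ _ _ (leq0n n)).
rewrite (src_scell e1 e); have e' : u_ob (push e0) = src0 (fap r (trg h b0)) by rewrite k.
by rewrite (trg0_scell e'); apply: scell_congr.
Qed.

Lemma scell_composableS n i (h : (i.+1 <= n)%N) (b1 b0 : P n) (o : under_ob x) e0 e1 :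
  trg h b0 = src h b1 ->
  trg h (@scell n b0 o e0) = src h (@scell n b1 o e1).
Proof.
move=> k; have e : u_ob o = src0 (fap r (src h b1)).
  by rewrite e1 fap_src (@src_src oC _ _ _ _ _ (leq0n n)).
rewrite (src_scell e1 e); have e' : u_ob o = src0 (fap r (trg h b0)) by rewrite k.
by rewrite (trg_scell e0 e'); apply: scell_congr.
Qed.

Lemma comp0_scell n (h : (0 < n)%N) (b1 b0 : P n) k (o : under_ob x) e0 e1 k' e :
  comp h (@scell n b1 (push e0) e1) (@scell n b0 o e0) k' = @scell n (comp h b1 b0 k) o e.
Proof.
apply: scell_uniq; first exact: comp_congr.
exact: (etrans (@src0_compW oU _ _ _ _ _ _) (src0_olift e0)).
Qed.

Lemma compS_scell n i (h : (i.+1 < n)%N) (b1 b0 : P n) k (o : under_ob x) e0 e1 k' e :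
  comp h (@scell n b1 o e1) (@scell n b0 o e0) k' = @scell n (comp h b1 b0 k) o e.
Proof.
apply: scell_uniq; first exact: comp_congr.
exact: (etrans (@src0_compW oU _ _ _ _ _ _) (src0_olift e0)).
Qed.

End Slice.

Section Transpose.
Variables (C : category) (x : C) (Y : infcat).
Local Notation oC := (ofcat C).
Local Notation oU := (ofcat (under x)).
Local Notation q := (ofcat_map (under_forget x)).
Local Notation R := (coind x Y).

Program Definition coind_proj : functor R oC := @Functor R oC (fun n c => rc c) _ _ _ _.
Next Obligation. exact: (@comp_congr oC). Qed.

(** Transposition: a functor out of the slice of [P] is a functor from [P] to [coind] over the
    base, whose value at a cell collects the values at all the lifts of this cell. *)
Section Hat.
Variables (P : infcat) (r : functor P oC) (u : functor (slice r x) Y).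

Lemma hat_trg0 n (b : P n) : trg0 (fap r b) = src0 (fap r (trg0 b)).
Proof. by rewrite -fap_src src_id fap_trg. Qed.

Program Definition hat_cell n (b : P n) : rcell x Y n :=
  @RCell C x Y n (fap r b) (fun o e => fap u (scell e))
    (fun o e => fap u (scell (etrans e (hat_trg0 b)))) _.
Next Obligation.
rewrite -fap_trg; congr fap; exact: trg0_scell.
Qed.

Program Definition hat : functor P R := @Functor P R hat_cell _ _ _ _.
Next Obligation.
apply: rcell_eq => [|o e e'|o e e']; first exact: fap_src.
  by rewrite /= -fap_src; congr fap; apply/esym/src_scell.
case: i h e e' => [|i] h e e' /=.
  rewrite -fap_src; congr fap; apply: esym.
  apply: scell_uniq; first by apply: (etrans _ (esym (trg_id _ _))); apply: src_congr.
  apply: (etrans (@src_id oU _ _ _)); exact: src0_olift.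
congr fap; apply: scell_congr => //.
by rewrite (trg_srcW _ _ (leq0n n)).
Qed.
Next Obligation.
apply: rcell_eq => [|o e e'|o e e']; first exact: fap_trg.
  case: i h e e' => [|i] h e e' /=.
    by congr fap; apply: scell_congr => //; apply: trg_congr.
  by rewrite /= -fap_trg; congr fap; apply/esym/trg_scell.
by congr fap; apply: scell_congr => //; rewrite (trg_trg _ _ (leq0n n)).
Qed.
Next Obligation.
apply: rcell_eq => [|o e e'|o e e']; first exact: fap_idn.
  by rewrite /= -fap_idn; congr fap; apply/esym/idn_scell.
by congr fap; apply: scell_congr => //; rewrite (trg_idn_lo (leq0n i)).
Qed.
Next Obligation.
apply: rcell_eq => [|o k k'|o k k']; first exact: fap_comp.
  case: i h e e' k k' => [|i] h e e' k k' /=.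
    have e0 := etrans k' (src0_compW (rcomp_rc e')).
    have e1 := etrans (u_ob_push e0) (rcomp_mid e').
    rewrite -(comp0_scell (scell_composable0 (e0 := e0) e1 e) k).
    rewrite (Prop_irrelevance (etrans k' _) e0) (Prop_irrelevance (etrans (u_ob_push e0) _) e1).
    exact: fap_comp.
  have e0 := etrans k' (src0_compW (rcomp_rc e')).
  have e1 := etrans e0 (src0_compS (rcomp_rc e')).
  rewrite -(compS_scell (scell_composableS e0 e1 e) k).
  rewrite (Prop_irrelevance (etrans k' _) e0) (Prop_irrelevance (etrans e0 _) e1).
  exact: fap_comp.
congr fap; apply: scell_congr => //; exact: trg0_compW.
Qed.

Lemma coind_proj_hat : fcomp coind_proj hat = r.
Proof. exact: functor_eq. Qed.

End Hat.

Section Unhat.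
Variables (P : infcat) (r : functor P oC) (v : functor P R) (vr : fcomp coind_proj v = r).

Lemma unhat_rc n (b : P n) : rc (fap v b) = fap r b.
Proof. exact: (congr1 (fun g => fap g b) vr). Qed.

Lemma unhat_src0 n (c : slice r x n) :
  u_ob (src0 (fpr c) : under_ob x) = src0 (rc (fap v (fpl c))).
Proof. by rewrite unhat_rc; apply: slice_src0. Qed.

Lemma unhat_push n (c : slice r x n) e : trg0 (fpr c) = @push _ _ _ (rc (fap v (fpl c))) (src0 (fpr c)) e.
Proof. by apply: under_push => //; rewrite unhat_rc (fp_eq c). Qed.

Program Definition unhat : functor (slice r x) Y :=
  @Functor (slice r x) Y (fun n c => ry (fap v (fpl c)) (unhat_src0 c)) _ _ _ _.
Next Obligation.
have e : u_ob (src0 (fpr x0) : under_ob x) = src0 (rc (rsrc h (fap v (fpl x0)))).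
  exact: (etrans (unhat_src0 x0) (esym (src0_src h _))).
rewrite (ry_congr _ e (fap_src v h (fpl x0))); last exact: (@src_src oU _ _ _ _ _ (leq0n n) (fpr x0)).
by apply/src_congr/ry_congr.
Qed.
Next Obligation.
have E := fap_trg v h (fpl x0).
case: i h E => [|i] h E.
  have e : u_ob (trg0 (fpr x0) : under_ob x) = src0 (rc (rtrg h (fap v (fpl x0)))).
    apply: (etrans _ (esym (src0_trg0 h _))); rewrite (unhat_rc (fpl x0)); exact: slice_trg0.
  rewrite (ry_congr _ e E); last first.
    exact: (etrans (@src_id oU _ _ _) (@trg_congr oU _ _ h (leq0n n) _ _ erefl)).
  apply: (etrans _ (trg_congr (leq0n n) h erefl)).
  apply: esym; apply: (etrans (ryzE _ (unhat_push (unhat_src0 x0)))).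
    by rewrite unhat_rc slice_trg0.
  by move=> e'; apply: rz_congr.
have e : u_ob (src0 (fpr x0) : under_ob x) = src0 (rc (rtrg h (fap v (fpl x0)))).
  exact: (etrans (unhat_src0 x0) (esym (src0_trg h _))).
rewrite (ry_congr _ e E); last exact: (@src_trgW oU _ _ _ _ _ (leq0n n) (fpr x0) (ltn0Sn i)).
by apply/trg_congr/ry_congr.
Qed.
Next Obligation.
have e : u_ob (src0 (fpr x0) : under_ob x) = src0 (rc (ridn h (fap v (fpl x0)))).
  exact: (etrans (unhat_src0 x0) (esym (src0_idn h _))).
rewrite (ry_congr _ e (fap_idn v h (fpl x0))); last exact: (@src_idn_lo oU _ _ _ (leq0n i) _ _ (fpr x0)).
by apply/idn_congr/ry_congr.
Qed.
Next Obligation.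
have k := fap_composable v (congr1 (@fpl _ _ _ _ _ _) e).
have E := fap_comp (congr1 (@fpl _ _ _ _ _ _) e) k.
have e0 : u_ob (src0 (fpr x0) : under_ob x) = src0 (rc (comp h (fap v (fpl x1)) (fap v (fpl x0)) k)).
  exact: (etrans (unhat_src0 x0) (esym (src0_compW (rcomp_rc k)))).
rewrite (ry_congr _ e0 E); last exact: (@src0_compW oU _ _ h _ _ (congr1 (@fpr _ _ _ _ _ _) e)).
have e2 : trg (ltnW h) (fpr x0) = src (ltnW h) (fpr x1) := congr1 (@fpr _ _ _ _ _ _) e.
case: i h e e' k E e0 e2 => [|i] h e e' k E e0 e2 /=; apply: comp_congr; apply: ry_congr => //.
  rewrite -unhat_push; apply: (etrans (@trg_congr oU _ _ (leq0n n) (ltnW h) _ _ erefl)).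
  by rewrite e2; apply: src_congr.
apply: (etrans (esym (@src_trgW oU _ _ _ (leq0n i.+1) (ltnW h) (leq0n n) (fpr x0) (ltn0Sn i)))).
rewrite e2; exact: (@src_src oU _ _ _ (leq0n i.+1) (ltnW h) (leq0n n) (fpr x1)).
Qed.

End Unhat.

Lemma hat_unhat (P : infcat) (r : functor P oC) (v : functor P R)
  (vr : fcomp coind_proj v = r) : hat (unhat vr) = v.
Proof.
apply: functor_eq => n b; apply: rcell_eq => [|o e e'|o e e'] /=.
- by rewrite (unhat_rc vr).
- by apply: ry_congr => //; apply: src0_olift.
- have e1 : u_ob o = src0 (rc (rtrg (leq0n n) (fap v b))) by rewrite e' src_id.
  rewrite (ry_congr _ e1 (fap_trg v _ b)); first exact: rz_congr.
  by [].
Qed.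

Lemma unhat_hat (P : infcat) (r : functor P oC) (u : functor (slice r x) Y)
  (e : fcomp coind_proj (hat u) = r) : unhat e = u.
Proof.
apply: functor_eq => n c /=; congr fap.
by apply/esym/scell_uniq.
Qed.

Lemma hat_inj (P : infcat) (r : functor P oC) (u v : functor (slice r x) Y) :
  hat u = hat v -> u = v.
Proof.
move=> uv; have e := coind_proj_hat v; have e' := coind_proj_hat u.
rewrite -(unhat_hat e) -(unhat_hat e'); move: e e'; rewrite uv => e e'.
by rewrite (Prop_irrelevance e e').
Qed.

Lemma hat_slice_map (A B : infcat) (g : functor A B) (rA : functor A oC) (rB : functor B oC)
  (e : fcomp rB g = rA) (u : functor (slice rB x) Y) :
  hat (fcomp u (slice_map e x)) = fcomp (hat u) g.
Proof.
subst rA; apply: functor_eq => n b; apply: rcell_eq => [|o k k'|o k k'] //=.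
  by congr fap; apply: scell_uniq => //=; apply: src0_olift.
congr fap; by apply: scell_uniq => //=; apply: fap_trg.
Qed.

End Transpose.

(** * The slice of a polygraph is a polygraph *)

Section SliceAttach.
Variables (C : category) (x : C).
Local Notation oC := (ofcat C).
Local Notation oU := (ofcat (under x)).
Local Notation q := (ofcat_map (under_forget x)).
Variables (A B : infcat) (j : functor A B) (rA : functor A oC) (rB : functor B oC).
Variable (e : fcomp rB j = rA).
Variables (n : nat) (I : Type) (bd : I -> functor (sphere n) A) (gen : I -> functor (disk n) B).
Hypothesis sq : forall i, fcomp j (bd i) = fcomp (gen i) (sphere_incl n).

(** As the category under [x] is discretely opfibred over [C], a generator has one lift for
    each object over its source. *)
Record slice_index : Type := SliceIndex {
  si_gen : I;
  si_ob : under_ob x;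
  si_over : u_ob si_ob = src0 (fap rB (fap (gen si_gen) (disk_top n)))
}.

Definition slice_gen (k : slice_index) : functor (disk n) (slice rB x) :=
  cell_functor (scell (si_over k)).

Lemma slice_gen_fst (k : slice_index) : fcomp (fp_fst rB q) (slice_gen k) = gen (si_gen k).
Proof.
by apply: disk_ext; rewrite -[LHS]/(fap (fp_fst rB q) (fap (slice_gen k) _)) cell_functor_top.
Qed.

Lemma slice_bd_eq (k : slice_index) :
  fcomp rA (bd (si_gen k)) = fcomp q (fcomp (fcomp (fp_snd rB q) (slice_gen k)) (sphere_incl n)).
Proof.
by rewrite -e -!fcompA sq -slice_gen_fst !fcompA -fp_comm.
Qed.

Definition slice_bd (k : slice_index) : functor (sphere n) (slice rA x) :=
  fp_pair (slice_bd_eq k).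

Lemma slice_sq (k : slice_index) :
  fcomp (slice_map e x) (slice_bd k) = fcomp (slice_gen k) (sphere_incl n).
Proof.
apply: fp_ext; rewrite !fcompA.
  rewrite slice_gen_fst -sq -(fp_fst_pair (slice_bd_eq k)) fcompA.
  by congr (fcomp _ _); apply: functor_eq.
by rewrite -(fp_snd_pair (slice_bd_eq k)); congr (fcomp _ _); apply: functor_eq.
Qed.

End SliceAttach.

Section SliceAttachUniv.
Variables (C : category) (x : C).
Local Notation oC := (ofcat C).
Local Notation oU := (ofcat (under x)).
Local Notation q := (ofcat_map (under_forget x)).
Variables (A B : infcat) (j : functor A B) (rA : functor A oC) (rB : functor B oC).
Variable (e : fcomp rB j = rA).

(** The generator [i] corepresents, through the adjunction, all the given cells [h k]
    for [k] over [i] at once. *)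
Lemma slice_att_cell n (I : Type) (bd : I -> functor (sphere n) A)
  (gen : I -> functor (disk n) B)
  (sq : forall i, fcomp j (bd i) = fcomp (gen i) (sphere_incl n))
  (Y : infcat) (g : functor (slice rA x) Y)
  (h : slice_index x rB gen -> functor (disk n) Y) (i : I) :
  (forall k, fcomp g (slice_bd e sq k) = fcomp (h k) (sphere_incl n)) ->
  exists kappa : coind x Y n,
  [/\ rc kappa = fap rB (fap (gen i) (disk_top n)),
      forall o e1 e2, ry kappa (o := o) e1 =
        fap (h (@SliceIndex _ _ _ rB _ _ gen i o e2)) (disk_top n)
    & fcomp (hat g) (bd i) = fcomp (cell_functor kappa) (sphere_incl n)].
Proof.
case: n bd gen sq h => [|n] bd gen sq h gh.
  pose c := fap rB (fap (gen i) (disk_top 0)).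
  pose y (o : under_ob x) (k : u_ob o = src0 c) :=
    fap (h (@SliceIndex _ _ _ rB _ _ gen i o k)) (disk_top 0).
  have yz (o : under_ob x) (k : u_ob o = src0 c) : trg0 (y o k) = y (push k) (u_ob_push k).
    by rewrite trg_id (Prop_irrelevance (u_ob_push k) k).
  exists (@RCell C x Y 0 c y y yz); split=> //; last exact: sphere0_ext.
  by move=> o e1 e2 /=; rewrite (Prop_irrelevance e1 e2).
pose w b := fap (bd i) (sphere_top n b).
pose c := fap rB (fap (gen i) (disk_top n.+1)).
have wc b : fap rA (w b) = face b (leqnSn n) c.
  rewrite -e -[LHS]/(fap rB (fap (fcomp j (bd i)) (sphere_top n b))) sq.
  rewrite -[LHS]/(fap rB (fap (gen i) (fap (sphere_incl n.+1) (sphere_top n b)))).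
  by rewrite sphere_incl_top !fap_face.
have ct (o : under_ob x) : u_ob o = trg0 c -> u_ob o = src0 (fap rA (trg0 (w true))).
  move=> ->; rewrite -fap_src src_id fap_trg wc.
  exact: (esym (@trg_trg oC _ _ _ (leq0n n) (leqnSn n) (leq0n n.+1) c)).
have bdw b (o : under_ob x) (k : u_ob o = src0 c) :
  fap (h (@SliceIndex _ _ _ rB _ _ gen i o k)) (face b (leqnSn n) (disk_top n.+1)) =
  fap g (fap (slice_bd e sq (@SliceIndex _ _ _ rB _ _ gen i o k)) (sphere_top n b)).
  rewrite -sphere_incl_top -[LHS]/(fap (fcomp (h _) (sphere_incl n.+1)) _).
  by rewrite -gh.
have bdE b (o : under_ob x) (k : u_ob o = src0 c) :
  fpr (fap (slice_bd e sq (@SliceIndex _ _ _ rB _ _ gen i o k)) (sphere_top n b)) =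
  face b (leqnSn n) (olift k).
  rewrite -[LHS]/(fap (fcomp (fp_snd rB q) (slice_gen _)) (fap (sphere_incl n.+1) _)).
  rewrite sphere_incl_top fap_face.
  congr face; exact: (congr1 (fun s => fap (fp_snd rB q) s) (cell_functor_top _)).
pose y (o : under_ob x) (k : u_ob o = src0 c) :=
  fap (h (@SliceIndex _ _ _ rB _ _ gen i o k)) (disk_top n.+1).
pose z (o : under_ob x) (k : u_ob o = trg0 c) := fap g (scell (ct _ k)).
have yz (o : under_ob x) (k : u_ob o = src0 c) : trg0 (y o k) = z (push k) (u_ob_push k).
  rewrite -(trg_trg (leq0n n) (leqnSn n)) -fap_trg.
  rewrite (bdw true _ k : fap _ (trg (leqnSn n) (disk_top n.+1)) = _) -fap_trg.
  congr fap; apply: scell_uniq.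
    by [].
  apply: (etrans (@src_id oU _ _ _)).
  apply: (etrans (congr1 (fun d : oU n => trg0 d) (bdE true o k))).
  apply: (etrans (@trg_trg oU _ _ _ (leq0n n) (leqnSn n) (leq0n n.+1) _)).
  exact: trg0_olift.
exists (@RCell C x Y n.+1 c y z yz); split=> //.
  by move=> o e1 e2 /=; rewrite /y (Prop_irrelevance e1 e2).
apply: sphere_ext => b.
pose kappa : coind x Y n.+1 := @RCell C x Y n.+1 c y z yz.
rewrite -[RHS]/(fap (cell_functor kappa) (fap (sphere_incl n.+1) (sphere_top n b))).
rewrite sphere_incl_top fap_face cell_functor_top.
have src0_bd b' (o : under_ob x) (k : u_ob o = src0 c) : (b' = false) \/ (0 < n)%N ->
  src0 (fpr (fap (slice_bd e sq (@SliceIndex _ _ _ rB _ _ gen i o k)) (sphere_top n b'))) = o.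
  move=> hb; apply: (etrans (congr1 (fun d : oU n => src0 d) (bdE b' o k))).
  apply: (etrans _ (src0_olift k)); case: b' hb => [[]|] //.
    by move=> n0; apply: (@src_trgW oU).
  by move=> _; apply: (@src_src oU).
apply: rcell_eq => [|o e1 e2|o e1 e2].
- by rewrite -[LHS]/(fap rA (w b)) wc; case: b.
- rewrite -[LHS]/(fap g (scell (r := rA) (b := w b) e1)).
  case: b e1 e2 => e1 e2; last first.
    rewrite -[RHS]/(src (leqnSn n) (y o _)) -fap_src.
    rewrite (bdw false _ _ : fap _ (src (leqnSn n) (disk_top n.+1)) = _).
    by congr fap; apply/esym/scell_uniq => //; apply: src0_bd; left.
  case: (posnP n) => n0; last first.
    have [e3 ->] := @ry_rtrgS _ _ _ _ _ (leqnSn n) kappa o e2 n0.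
    rewrite -[RHS]/(trg (leqnSn n) (y o e3)).
    rewrite -fap_trg (bdw true _ _ : fap _ (trg (leqnSn n) (disk_top n.+1)) = _).
    by congr fap; apply/esym/scell_uniq => //; apply: src0_bd; right.
  subst n; rewrite -[RHS]/(z o (etrans e2 _)); congr fap; apply: scell_congr => //.
  by rewrite trg_id.
- rewrite -[LHS]/(fap g (scell (b := trg0 (w b)) (etrans e1 _))); move: (etrans e1 _) => e3.
  case: b e1 e2 e3 => e1 e2 e3.
    by rewrite -[RHS]/(z o (etrans e2 _)); congr fap; apply: scell_congr.
  case: (posnP n) => n0.
    subst n; rewrite -[RHS]/(src0 (y o (etrans e2 _))).
    apply: (etrans _ (src_congr (leqnSn 0) (leq0n 1) erefl)); rewrite -fap_src.
    rewrite (bdw false _ _ : fap _ (src (leqnSn 0) (disk_top 1)) = _).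
    congr fap; apply/esym/scell_uniq; first exact: (esym (@trg_id A _ _ (w false))).
    by apply: src0_bd; left.
  have [e4 ->] := @rz_rsrcS _ _ _ _ _ (leqnSn n) kappa o e2 n0.
  rewrite -[RHS]/(z o e4).
  congr fap; apply: scell_congr => //.
  by rewrite -!fap_trg; congr fap; apply/esym/(@sphere_top_parallel n true).
Qed.

End SliceAttachUniv.

(** The component [rz] of a cell of positive dimension is part of its boundary. *)
Lemma coind_disk_ext (C : category) (x : C) (Y : infcat) n
    (a b : functor (disk n) (coind x Y)) :
  fcomp a (sphere_incl n) = fcomp b (sphere_incl n) ->
  rc (fap a (disk_top n)) = rc (fap b (disk_top n)) ->
  (forall o e e', ry (fap a (disk_top n)) (o := o) e = ry (fap b (disk_top n)) (o := o) e') ->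
  a = b.
Proof.
move=> ab ec ey; apply: disk_ext; apply: rcell_eq => // o.
case: n a b ab ec ey => [|n] a b ab ec ey e e'.
  by rewrite -(ryz0 (e : u_ob o = src0 (rc (fap a (disk_top 0)))))
             -(ryz0 (e' : u_ob o = src0 (rc (fap b (disk_top 0))))).
apply: rz_trg0.
have E : trg (leqnSn n) (fap a (disk_top n.+1)) = trg (leqnSn n) (fap b (disk_top n.+1)).
  rewrite -!fap_trg -[trg _ _]/(face true (leqnSn n) (disk_top n.+1)) -sphere_incl_top.
  by rewrite -[LHS]/(fap (fcomp a _) _) ab.
have := congr1 (fun c => trg0 c) E.
by rewrite !(@trg_trg (coind x Y) _ _ _ _ _ (leq0n n.+1)).
Qed.

(** The transpose of a functor defined on the skeleton of the slice extends to a generator in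
    exactly one way once its values on the generators of the slice are given. *)
Lemma slice_attaches_cells (C : category) (x : C) (A B : infcat) (j : functor A B)
  (rA : functor A (ofcat C)) (rB : functor B (ofcat C)) (e : fcomp rB j = rA) n :
  attaches_cells n j -> attaches_cells n (slice_map e x).
Proof.
move=> [I [bd [gen [sq po]]]].
exists (slice_index x rB gen), (slice_bd e sq), (@slice_gen _ _ _ rB _ _ gen); split.
  exact: slice_sq.
move=> Y g h gh.
have kap i := boolp.cid (slice_att_cell i gh).
have [|u [[uj ug] uniq]] := po _ (hat g) (fun i => cell_functor (sval (kap i))).
  by move=> i; case: (svalP (kap i)).
have ur : fcomp (coind_proj x Y) u = rB.
  apply: (attaches_cells_ext sq po); first by rewrite -fcompA uj coind_proj_hat.
  move=> i; rewrite -fcompA ug; apply: disk_ext.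
  rewrite -[LHS]/(fap (coind_proj x Y) (fap (cell_functor (sval (kap i))) (disk_top n))).
  by rewrite cell_functor_top; case: (svalP (kap i)).
exists (unhat ur); split; first split.
- apply: hat_inj; rewrite hat_slice_map hat_unhat //.
- move=> [i o ko]; apply: disk_ext.
  rewrite -[LHS]/(fap (unhat ur) (fap (cell_functor (scell ko)) (disk_top n))).
  rewrite cell_functor_top.
  have E : fap u (fap (gen i) (disk_top n)) = sval (kap i).
    rewrite -[LHS]/(fap (fcomp u (gen i)) (disk_top n)) ug; exact: cell_functor_top.
  have [k1 k2 _] := svalP (kap i).
  have k3 : u_ob o = src0 (rc (sval (kap i))) by rewrite k1.
  rewrite -(k2 _ k3 ko); apply: ry_congr => //; exact: src0_olift.
move=> v [vj vg].
apply: hat_inj; rewrite hat_unhat; apply: uniq; split.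
  by rewrite -vj hat_slice_map.
move=> i; have [k1 k2 k3] := svalP (kap i); set kappa := sval (kap i) in k1 k2 k3 *.
have vtop o (k : u_ob o = src0 (fap rB (fap (gen i) (disk_top n)))) :
    fap v (scell k) = fap (h (@SliceIndex _ _ _ rB _ _ gen i o k)) (disk_top n).
  by rewrite -vg -[RHS]/(fap v (fap (cell_functor (scell k)) (disk_top n))) cell_functor_top.
have vbd : fcomp (fcomp (hat v) (gen i)) (sphere_incl n) =
    fcomp (cell_functor kappa) (sphere_incl n).
  by rewrite -fcompA -sq fcompA -(hat_slice_map e v) vj k3.
apply: coind_disk_ext; [exact: vbd|by rewrite cell_functor_top k1|move=> o e1].
by rewrite cell_functor_top => e2; rewrite (k2 _ _ e1); apply: vtop.
Qed.

(** A left adjoint preserves the pushouts and the colimit by which a polygraph is built. *)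
Theorem slice_polygraph (C : category) (x : C) (P : infcat) (r : functor P (ofcat C)) :
  polygraph P -> polygraph (slice r x).
Proof.
move=> [sk [j [k [sk0 att cocone colim]]]].
pose rk n := fcomp r (k n).
have jk n : fcomp (rk n.+1) (j n) = rk n by rewrite /rk -fcompA cocone.
have kk n : fcomp r (k n) = rk n by [].
exists (fun n => slice (rk n) x), (fun n => slice_map (jk n) x), (fun n => slice_map (kk n) x).
split.
- by move=> c; apply: sk0; apply: (fpl c).
- by move=> n; apply: slice_attaches_cells.
- move=> n; apply: functor_eq => m c; apply: fpcell_eq => //=.
  by rewrite -(cocone n).
move=> Y g gS.
have [n|u [uk uniq]] := colim _ (fun n => hat (g n)).
  by rewrite -(hat_slice_map (jk n)) gS.
have ur : fcomp (coind_proj x Y) u = r.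
  by apply: (colimit_ext cocone colim) => n; rewrite -fcompA uk coind_proj_hat.
exists (unhat ur); split.
  by move=> n; apply: hat_inj; rewrite hat_slice_map hat_unhat uk.
move=> v vk; apply: hat_inj; rewrite hat_unhat; apply: uniq => n.
by rewrite -(hat_slice_map (kk n)) vk.
Qed.

(** * Slices of trivial fibrations *)

(** The slice of [p] is a base change of [p]. *)
Lemma slice_trivial_fibration (C : category) (x : C) (P X' : infcat) (p : functor P X')
  (r : functor P (ofcat C)) (s : functor X' (ofcat C)) (e : fcomp s p = r) :
  trivial_fibration p -> trivial_fibration (slice_map e x).
Proof.
move=> fib n a b ab.
pose q := ofcat_map (under_forget x).
have [|l la lb] := fib n (fcomp (fp_fst r q) a) (fcomp (fp_fst s q) b).
  by rewrite -fcompA -ab !fcompA; congr (fcomp _ _); apply: functor_eq.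
have lq : fcomp r l = fcomp q (fcomp (fp_snd s q) b).
  by rewrite -e -fcompA lb !fcompA fp_comm.
exists (fp_pair lq); apply: fp_ext.
- by rewrite fcompA fp_fst_pair.
- rewrite fcompA fp_snd_pair -fcompA -ab fcompA.
  by congr (fcomp _ _); apply: functor_eq.
- by rewrite -lb -[in RHS](fp_fst_pair lq) !fcompA; congr (fcomp _ _); apply: functor_eq.
- by rewrite -[in RHS](fp_snd_pair lq) fcompA; congr (fcomp _ _); apply: functor_eq.
Qed.

Lemma slice_resolution (C : category) (x : C) (P X' : infcat) (p : functor P X')
  (r : functor P (ofcat C)) (s : functor X' (ofcat C)) (e : fcomp s p = r) :
  polygraphic_resolution p -> polygraphic_resolution (slice_map e x).
Proof.
by move=> [pol fib]; split; [apply: slice_polygraph|apply: slice_trivial_fibration].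
Qed.

(** * Relatively projective presheaves *)

Definition mk_additive (A B : zmodType) (f : A -> B) (fB : zmod_morphism f) : {additive A -> B} :=
  HB.pack_for {additive A -> B} f (GRing.isZmodMorphism.Build A B f fB).

Record presheaf (C : category) := Presheaf {
  psh_ob :> C -> zmodType;
  psh_res : forall a b, hom a b -> {additive psh_ob b -> psh_ob a};
  psh_id : forall a m, psh_res (cid a) m = m;
  psh_comp : forall a b c (g : hom b c) (f : hom a b) m,
    psh_res (ccomp g f) m = psh_res f (psh_res g m)
}.

Section Cover.
Variables (C : category) (S : Type) (ob : S -> C).

Definition arrows_to x := {classic {a : S & hom x (ob a)}}.

Section CoverOf.
Variable F : presheaf C.

Definition cover_fam (x : C) (k : arrows_to x) : zmodType :=
  F (ob (projT1 (k : {a : S & hom x (ob a)}))).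

(** The left Kan extension of the values of [F] at the objects of [S], viewed as a discrete
    category. *)
Definition cover_ob (x : C) : zmodType := dirsum (@cover_fam x).

Definition cinj x a (f : hom x (ob a)) : F (ob a) -> cover_ob x :=
  @ds_inj (arrows_to x) (@cover_fam x) (existT _ a f).

Lemma cinj_additive x a (f : hom x (ob a)) : zmod_morphism (cinj f).
Proof. exact: (@ds_inj_additive (arrows_to x) (@cover_fam x) (existT _ a f)). Qed.
HB.instance Definition _ x a (f : hom x (ob a)) :=
  GRing.isZmodMorphism.Build (F (ob a)) (cover_ob x) (cinj f) (cinj_additive f).

Definition clift x (A : zmodType) (phi : forall a, hom x (ob a) -> {additive F (ob a) -> A}) :
    {additive cover_ob x -> A} :=
  @ds_lift (arrows_to x) (@cover_fam x) A
    (fun k => phi (projT1 (k : {a : S & hom x (ob a)})) (projT2 (k : {a : S & hom x (ob a)}))).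

Lemma clift_inj x (A : zmodType) (phi : forall a, hom x (ob a) -> {additive F (ob a) -> A})
    a (f : hom x (ob a)) (m : F (ob a)) :
  clift phi (cinj f m) = phi a f m.
Proof. exact: ds_lift_inj. Qed.

Lemma cext x (A : zmodType) (g h : {additive cover_ob x -> A}) :
  (forall a (f : hom x (ob a)) m, g (cinj f m) = h (cinj f m)) -> forall w, g w = h w.
Proof. by move=> gh; apply: ds_ext => -[a f] m; apply: gh. Qed.

Definition cover_res x y (g : hom x y) : {additive cover_ob y -> cover_ob x} :=
  clift (fun a f => cinj (ccomp f g) : {additive F (ob a) -> cover_ob x}).

Lemma cover_res_inj x y (g : hom x y) a (f : hom y (ob a)) m :
  cover_res g (cinj f m) = cinj (ccomp f g) m.
Proof. exact: clift_inj. Qed.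

Lemma cover_res_id x w : cover_res (cid x) w = w.
Proof.
apply: (@cext _ _ (cover_res (cid x)) idfun) => a f m.
by rewrite cover_res_inj ccomp_idr.
Qed.

Lemma cover_res_comp x y z (g : hom y z) (f : hom x y) w :
  cover_res (ccomp g f) w = cover_res f (cover_res g w).
Proof.
apply: (@cext _ _ (cover_res (ccomp g f)) (cover_res f \o cover_res g)) => a h m /=.
by rewrite !cover_res_inj ccompA.
Qed.

Definition cover : presheaf C := Presheaf cover_res_id cover_res_comp.

Definition counit x : {additive cover x -> F x} := clift (fun a f => psh_res F f).

Lemma counit_inj x a (f : hom x (ob a)) m : counit x (cinj f m) = psh_res F f m.
Proof. exact: clift_inj. Qed.

Lemma counit_nat x y (g : hom x y) w :
  counit x (psh_res cover g w) = psh_res F g (counit y w).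
Proof.
apply: (@cext _ _ (counit x \o cover_res g) (psh_res F g \o counit y)) => a f m /=.
by rewrite cover_res_inj !counit_inj psh_comp.
Qed.

(** Equivalently, [F] is a direct summand of a sum of representables tensored with abelian
    groups; as these groups are arbitrary, this is projectivity relative to the sequences of
    presheaves which split at every object of [S]. *)
Definition rel_projective :=
  exists s : forall x, {additive F x -> cover x},
    (forall x y (g : hom x y) m, s x (psh_res F g m) = psh_res cover g (s y m)) /\
    forall x m, counit x (s x m) = m.

End CoverOf.

Arguments cinj F {x a} f m.

Section CoverMap.
Variables (F G : presheaf C) (phi : forall a, {additive F (ob a) -> G (ob a)}).

Definition cover_map x : {additive cover F x -> cover G x} :=
  clift (fun a f => cinj G f \o phi a : {additive F (ob a) -> cover G x}).

Lemma cover_map_inj x a (f : hom x (ob a)) m :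
  cover_map x (cinj F f m) = cinj G f (phi a m).
Proof. exact: clift_inj. Qed.

Lemma cover_map_nat x y (g : hom x y) w :
  cover_map x (psh_res (cover F) g w) = psh_res (cover G) g (cover_map y w).
Proof.
apply: (@cext _ _ _ (cover_map x \o cover_res F g) (cover_res G g \o cover_map y)) => a f m /=.
by rewrite cover_res_inj !cover_map_inj cover_res_inj.
Qed.

End CoverMap.

Section ProdPsh.
Variables F G : presheaf C.

Section Pairing.
Variables (A B A' B' : zmodType) (f : {additive A -> A'}) (g : {additive B -> B'}).
Definition pair_map (m : A * B) : A' * B' := (f m.1, g m.2).
Lemma pair_map_additive : zmod_morphism pair_map.
Proof. by move=> [a b] [a' b']; rewrite /pair_map /= !raddfB. Qed.
HB.instance Definition _ :=
  GRing.isZmodMorphism.Build (A * B)%type (A' * B')%type pair_map pair_map_additive.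
End Pairing.

Lemma prod_psh_id a (m : F a * G a) :
  pair_map (psh_res F (cid a)) (psh_res G (cid a)) m = m.
Proof. by rewrite /pair_map !psh_id; case: m. Qed.

Lemma prod_psh_comp a b c (g : hom b c) (f : hom a b) (m : F c * G c) :
  pair_map (psh_res F (ccomp g f)) (psh_res G (ccomp g f)) m =
  pair_map (psh_res F f) (psh_res G f) (pair_map (psh_res F g) (psh_res G g) m).
Proof. by rewrite /pair_map !psh_comp. Qed.

Definition prod_psh : presheaf C :=
  @Presheaf C (fun x => (F x * G x)%type : zmodType)
    (fun a b f => pair_map (psh_res F f) (psh_res G f)) prod_psh_id prod_psh_comp.

Definition inj1 x (m : F x) : prod_psh x := (m, 0).
Definition inj2 x (m : G x) : prod_psh x := (0, m).
Lemma inj1_additive x : zmod_morphism (@inj1 x).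
Proof. by move=> m m'; congr pair; rewrite /= ?subr0. Qed.
Lemma inj2_additive x : zmod_morphism (@inj2 x).
Proof. by move=> m m'; congr pair; rewrite /= ?subr0. Qed.
HB.instance Definition _ x :=
  GRing.isZmodMorphism.Build (F x) (prod_psh x) (@inj1 x) (@inj1_additive x).
HB.instance Definition _ x :=
  GRing.isZmodMorphism.Build (G x) (prod_psh x) (@inj2 x) (@inj2_additive x).

Lemma rel_projective_prod : rel_projective F -> rel_projective G -> rel_projective prod_psh.
Proof.
move=> [s [sn se]] [t [tn te]].
pose i1 x := cover_map (fun a => @inj1 (ob a) : {additive F (ob a) -> prod_psh (ob a)}) x.
pose i2 x := cover_map (fun a => @inj2 (ob a) : {additive G (ob a) -> prod_psh (ob a)}) x.
have c1 x w : counit prod_psh x (i1 x w) = inj1 (counit F x w).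
  apply: (@cext _ _ _ (counit prod_psh x \o i1 x) (@inj1 x \o counit F x)) => a f m.
  rewrite -[LHS]/(counit prod_psh x (i1 x (cinj F f m))) -[RHS]/(inj1 (counit F x (cinj F f m))).
  by rewrite /i1 cover_map_inj !counit_inj /inj1 /= /pair_map /= raddf0.
have c2 x w : counit prod_psh x (i2 x w) = inj2 (counit G x w).
  apply: (@cext _ _ _ (counit prod_psh x \o i2 x) (@inj2 x \o counit G x)) => a f m.
  rewrite -[LHS]/(counit prod_psh x (i2 x (cinj G f m))) -[RHS]/(inj2 (counit G x (cinj G f m))).
  by rewrite /i2 cover_map_inj !counit_inj /inj2 /= /pair_map /= raddf0.
pose u x (m : prod_psh x) : cover prod_psh x := i1 x (s x m.1) + i2 x (t x m.2).
have uadd x : zmod_morphism (u x).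
  by move=> m m'; rewrite /u /= !raddfB opprD addrACA.
exists (fun x => mk_additive (uadd x)).
split=> [x y g m|x m]; rewrite /= /u.
  by rewrite /i1 /i2 sn tn !cover_map_nat raddfD.
by rewrite raddfD /= c1 c2 se te; case: m => a b; congr pair; rewrite /= ?addr0 ?add0r.
Qed.

End ProdPsh.

End Cover.

Arguments cinj {C S ob} F {x a} f m.

(** * Acyclicity of complexes of relatively projective presheaves *)

Section Kernel.
Variables (A B : zmodType) (f : {additive A -> B}).

Definition in_ker : {pred A} := fun z => f z == 0.
Lemma in_ker_closed : zmod_closed in_ker.
Proof.
split=> [|x y]; rewrite /in_mem /= /in_ker ?raddf0 // => /eqP hx /eqP hy.
by rewrite raddfB hx hy subrr.
Qed.
HB.instance Definition _ := GRing.isZmodClosed.Build A in_ker in_ker_closed.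

Record ker := Ker { ker_val : A; ker_prop : ker_val \in in_ker }.
HB.instance Definition _ := [isSub for ker_val].
HB.instance Definition _ := [Choice of ker by <:].
HB.instance Definition _ := [SubChoice_isSubZmodule of ker by <:].

Lemma ker_eq (x y : ker) : ker_val x = ker_val y -> x = y.
Proof. exact: val_inj. Qed.

Lemma kerP (x : ker) : f (ker_val x) = 0.
Proof. by case: x => x /= /eqP. Qed.

Lemma ker_valB (x y : ker) : ker_val (x - y) = ker_val x - ker_val y.
Proof. exact: (raddfB (val : ker -> A)). Qed.

Lemma ker_val0 : ker_val 0 = 0.
Proof. exact: (raddf0 (val : ker -> A)). Qed.

Lemma ker_val_additive : zmod_morphism ker_val.
Proof. exact: ker_valB. Qed.
HB.instance Definition _ := GRing.isZmodMorphism.Build ker A ker_val ker_val_additive.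

Section Lift.
Variables (D : zmodType) (g : {additive D -> A}) (fg : forall z, f (g z) = 0).
Lemma in_ker_lift z : g z \in in_ker. Proof. by rewrite /in_mem /= /in_ker fg. Qed.
Definition ker_lift_fun z := Ker (in_ker_lift z).
Lemma ker_lift_additive : zmod_morphism ker_lift_fun.
Proof. by move=> x y; apply: ker_eq; rewrite ker_valB /= raddfB. Qed.
Definition ker_lift : {additive D -> ker} := mk_additive ker_lift_additive.
End Lift.
End Kernel.

Record pcomplex (C : category) := PComplex {
  pc :> nat -> presheaf C;
  pd : forall n x, {additive pc n.+1 x -> pc n x};
  pd_nat : forall n x y (f : hom x y) m, pd n x (psh_res (pc n.+1) f m) = psh_res (pc n) f (pd n y m);
  pd_pd : forall n x m, pd n x (pd n.+1 x m) = 0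
}.

Definition pcycle (C : category) (D : pcomplex C) n (x : C) : D n x -> Prop :=
  match n return D n x -> Prop with
  | 0 => fun _ => True
  | m.+1 => fun z => pd D m x z = 0
  end.

Definition acyclic_at (C : category) (D : pcomplex C) n (x : C) :=
  forall z : D n x, pcycle z -> exists w, pd D n x w = z.

Section CoverComplex.
Variables (C : category) (S : Type) (ob : S -> C).

Section CoverOf.
Variable D : pcomplex C.
Local Notation G n := (cover ob (D n)).

Definition cover_d n x : {additive G n.+1 x -> G n x} :=
  cover_map (fun a => pd D n (ob a)) x.

Lemma cover_d_nat n x y (f : hom x y) m :
  cover_d n x (psh_res (G n.+1) f m) = psh_res (G n) f (cover_d n y m).
Proof. exact: cover_map_nat. Qed.

Lemma cover_dd n x m : cover_d n x (cover_d n.+1 x m) = 0.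
Proof.
apply: (@cext _ _ _ _ _ _ (cover_d n x \o cover_d n.+1 x) \0) => a f z.
rewrite -[LHS]/(cover_d n x (cover_d n.+1 x (cinj (D n.+2) f z))) -[RHS]/(0 : cover_ob _ _ _).
by rewrite /cover_d !cover_map_inj pd_pd raddf0.
Qed.

Definition cover_complex : pcomplex C := PComplex cover_d_nat cover_dd.

Lemma cover_dE n x (w : G n.+1 x) (k : arrows_to ob x) :
  ds_val (cover_d n x w) k = pd D n _ (ds_val w k).
Proof.
have ev_add m : zmod_morphism (fun w : G m x => ds_val w k : cover_fam (D m) k) by [].
pose ev m := mk_additive (ev_add m).
apply: (@cext _ _ _ _ _ _ (ev n \o cover_d n x) (pd D n _ \o ev n.+1)) => a f m.
rewrite -[LHS]/(ds_val (cover_d n x (cinj (D n.+1) f m)) k).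
rewrite -[RHS]/(pd D n _ (ds_val (cinj (D n.+1) f m) k)).
rewrite /cover_d cover_map_inj /=.
have [e|ne] := pselect (existT _ a f = k).
  by subst k; rewrite !ds_inj_funE.
by rewrite !ds_inj_fun0 // raddf0.
Qed.

Lemma cover_cycle n x (z : cover_complex n x) (k : arrows_to ob x) :
  pcycle z -> pcycle (D := D) (ds_val z k : D n (ob (projT1 (k : {a : S & hom x (ob a)})))).
Proof.
case: n z => [|n] z zc //.
exact: (etrans (esym (cover_dE z k)) (congr1 (fun w : G n x => ds_val w k) zc)).
Qed.

Lemma counit_d n x (w : G n.+1 x) :
  counit ob (D n) x (cover_d n x w) = pd D n x (counit ob (D n.+1) x w).
Proof.
apply: (@cext _ _ _ _ _ _ (counit ob (D n) x \o cover_d n x)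
  (pd D n x \o counit ob (D n.+1) x)) => a f m.
rewrite -[LHS]/(counit ob (D n) x (cover_d n x (cinj (D n.+1) f m))).
rewrite -[RHS]/(pd D n x (counit ob (D n.+1) x (cinj (D n.+1) f m))).
by rewrite /cover_d cover_map_inj !counit_inj pd_nat.
Qed.

(** The cover is a sum of copies of the values of [D] at the objects of [S]. *)
Lemma cover_acyclic n x :
  (forall a, acyclic_at D n (ob a)) -> acyclic_at cover_complex n x.
Proof.
move=> ac z zc.
have pre (k : arrows_to ob x) :
    {v : cover_fam (D n.+1) k | pd D n _ v = ds_val z k & (ds_val z k = 0 -> v = 0)}.
  apply: boolp.cid2; have [z0|nz] := pselect (ds_val z k = 0).
    by exists 0; rewrite // raddf0.
  have [|v dv] := ac (projT1 (k : {a : S & hom x (ob a)})) (ds_val z k).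
    exact: cover_cycle.
  by exists v.
have fin : finite_set [set k | s2val (pre k) <> 0].
  apply: sub_finite_set (ds_fin z) => k /= h h0; apply: h.
  exact: (s2valP' (pre k) h0).
exists (DirSum fin : G n.+1 x); apply: dirsum_eq => k.
by rewrite [LHS]cover_dE /=; apply: (s2valP (pre k)).
Qed.

(** The kernel of the counit, which plays the part of a syzygy. *)
Definition syz_ob n x : zmodType := ker (counit ob (D n) x).

Lemma syz_res_subproof n x y (f : hom x y) (z : syz_ob n y) :
  counit ob (D n) x ((psh_res (G n) f \o @ker_val _ _ _) z) = 0.
Proof. by rewrite /= counit_nat kerP raddf0. Qed.

Definition syz_res n x y (f : hom x y) : {additive syz_ob n y -> syz_ob n x} :=
  ker_lift (syz_res_subproof f).

Lemma syz_res_id n x z : syz_res n (cid x) z = z.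
Proof. by apply: ker_eq => /=; apply: (@psh_id _ (G n)). Qed.

Lemma syz_res_comp n x y z (g : hom y z) (f : hom x y) m :
  syz_res n (ccomp g f) m = syz_res n f (syz_res n g m).
Proof. by apply: ker_eq => /=; apply: (@psh_comp _ (G n)). Qed.

Definition syz n : presheaf C := Presheaf (@syz_res_id n) (@syz_res_comp n).

Lemma syz_d_subproof n x (z : syz n.+1 x) :
  counit ob (D n) x ((cover_d n x \o @ker_val _ _ _) z) = 0.
Proof. by rewrite /= counit_d kerP raddf0. Qed.

Definition syz_d n x : {additive syz n.+1 x -> syz n x} := ker_lift (@syz_d_subproof n x).

Lemma syz_d_nat n x y (f : hom x y) m :
  syz_d n x (psh_res (syz n.+1) f m) = psh_res (syz n) f (syz_d n y m).
Proof. by apply: ker_eq => /=; apply: cover_d_nat. Qed.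

Lemma syz_dd n x m : syz_d n x (syz_d n.+1 x m) = 0.
Proof. by apply: ker_eq; rewrite ker_val0 /=; apply: cover_dd. Qed.

Definition syz_complex : pcomplex C := PComplex syz_d_nat syz_dd.

(** A section of the counit makes the syzygy a direct summand of the cover. *)
Lemma rel_projective_syz n : rel_projective ob (D n) -> rel_projective ob (syz n).
Proof.
move=> [s [sn se]].
pose pr x (w : G n x) : G n x := w - s x (counit ob (D n) x w).
have pr_add x : zmod_morphism (pr x).
  move=> w w'; rewrite /pr [counit _ _ _ _]raddfB [s _ _]raddfB !opprB addrACA [RHS]addrACA; congr (_ + _).
  exact: addrC.
have pr_ker x w : counit ob (D n) x (mk_additive (pr_add x) w) = 0.
  by rewrite /= /pr raddfB se subrr.
pose pi x : {additive G n x -> syz n x} := ker_lift (pr_ker x).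
pose t x : {additive G n x -> cover ob (syz n) x} :=
  clift (fun a f => cinj (syz n) f \o (pi (ob a) \o cinj (D n) (cid (ob a)))
    : {additive D n (ob a) -> cover ob (syz n) x}).
have t_inj x a (f : hom x (ob a)) m :
    t x (cinj (D n) f m) = cinj (syz n) f (pi (ob a) (cinj (D n) (cid (ob a)) m)).
  exact: clift_inj.
exists (fun x => t x \o @ker_val _ _ _); split=> [x y g m|x m].
  rewrite /=; move: (ker_val m) => w.
  apply: (@cext _ _ _ _ _ _ (t x \o psh_res (G n) g) (psh_res (cover ob (syz n)) g \o t y)).
  move=> a f z.
  rewrite -[LHS]/(t x (cover_res ob (D n) g (cinj (D n) f z))).
  rewrite -[RHS]/(cover_res ob (syz n) g (t y (cinj (D n) f z))).
  by rewrite cover_res_inj !t_inj cover_res_inj.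
have E w : counit ob (syz n) x (t x w) = pi x w.
  apply: (@cext _ _ _ _ _ _ (counit ob (syz n) x \o t x) (pi x)) => a f z.
  rewrite -[LHS]/(counit ob (syz n) x (t x (cinj (D n) f z))) t_inj counit_inj.
  apply: ker_eq => /=; rewrite /pr raddfB /= -sn -counit_nat.
  by rewrite cover_res_inj ccomp_idl [psh_res _ f _]cover_res_inj ccomp_idl.
rewrite -[LHS]/(counit ob (syz n) x (t x (ker_val m))) E.
by apply: ker_eq; rewrite /= /pr kerP raddf0 subr0.
Qed.

(** The counit is surjective with the syzygies as kernel, so these inherit acyclicity from the
    cover and from [D]. *)
Lemma syz_acyclic a n : rel_projective ob (D n.+2) ->
  (forall b m, acyclic_at D m (ob b)) -> acyclic_at syz_complex n (ob a).
Proof.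
move=> [s [sn se]] ac z zc.
have [|w dw] := @cover_acyclic n (ob a) (fun b => ac b n) (ker_val z).
  case: n s sn se z zc => [|n] s sn se z zc //.
  by have := congr1 (@ker_val _ _ _) zc; rewrite ker_val0.
have [|v dv] := ac a n.+1 (counit ob (D n.+1) (ob a) w).
  by rewrite /= -counit_d [cover_d _ _ _]dw kerP.
have k : counit ob (D n.+1) (ob a) (w - cover_d n.+1 (ob a) (s _ v)) = 0.
  by rewrite raddfB counit_d se dv subrr.
have k' : w - cover_d n.+1 (ob a) (s _ v) \in in_ker (counit ob (D n.+1) (ob a)).
  by rewrite /in_mem /= /in_ker k.
exists (Ker k'); apply: ker_eq => /=.
by rewrite raddfB cover_dd subr0.
Qed.

End CoverOf.

(** Dimension shifting: the complex of covers is acyclic, so that a cycle of degree [n]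
    can be corrected as soon as the complex of syzygies is acyclic in degree [n - 1]. *)
Theorem rel_projective_acyclic n (D : pcomplex C) :
  (forall m, rel_projective ob (D m)) ->
  (forall a m, acyclic_at D m (ob a)) -> forall x, acyclic_at D n x.
Proof.
elim: n D => [|n IHn] D proj ac x z zc.
  have [s [sn se]] := proj 0%N.
  have [//|w dw] := @cover_acyclic D 0 x (fun b => ac b 0%N) (s x z).
  by exists (counit ob (D 1%N) x w); rewrite -counit_d [cover_d _ _ _ _]dw se.
have [s [sn se]] := proj n.+1.
(* The differential of [w] is a cycle of syzygies, so it bounds a syzygy [v] by induction; the
   cycle [w - v] of covers is then a boundary, and the counit sends [w - v] to [z]. *)
pose w := s x z.
have k : cover_d D n x w \in in_ker (counit ob (D n) x).
  by rewrite /in_mem /= /in_ker counit_d se [pd _ _ _ _]zc.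
have [|||v dv] := IHn (syz_complex D) _ _ x (Ker k).
- by move=> m; apply: rel_projective_syz.
- by move=> a m; apply: syz_acyclic.
- case: n {IHn} s sn se z zc @w k => [|n] // s sn se z zc w k.
  by apply: ker_eq; rewrite ker_val0 /=; apply: cover_dd.
have [|u du] := @cover_acyclic D n.+1 x (fun b => ac b n.+1) (w - ker_val v).
  by rewrite /= raddfB -[cover_d _ _ _ (ker_val v)]/(ker_val (syz_d D n x v)) [syz_d _ _ _ _]dv subrr.
by exists (counit ob (D n.+2) x u); rewrite -counit_d [cover_d _ _ _ _]du raddfB se kerP subr0.
Qed.

End CoverComplex.

(** * Quasi-isomorphisms *)

Section Qiso.
Variables (C : category) (D1 D2 : pcomplex C).
Variables (phi : forall n x, {additive D1 n x -> D2 n x}).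
Hypothesis phi_nat : forall n x y (f : hom x y) m,
  phi n x (psh_res (D1 n) f m) = psh_res (D2 n) f (phi n y m).
Hypothesis phi_d : forall n x m, phi n x (pd D1 n x m) = pd D2 n x (phi n.+1 x m).

(** Surjectivity and injectivity in homology, phrased with cycles and boundaries in order to
    avoid quotients of presheaves. *)
Definition qsurj_at x n := forall z' : D2 n x, pcycle z' ->
  exists z : D1 n x, pcycle z /\ exists w, z' = phi n x z + pd D2 n x w.

Definition qinj_at x n := forall z : D1 n x, pcycle z ->
  forall w, phi n x z = pd D2 n x w -> exists v, z = pd D1 n x v.

Definition cone_ob n : presheaf C :=
  if n is m.+1 then prod_psh (D2 m.+1) (D1 m) else D2 0%N.

Definition cone_d_fun n x : cone_ob n.+1 x -> cone_ob n x :=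
  match n return cone_ob n.+1 x -> cone_ob n x with
  | 0 => fun b => pd D2 0 x b.1 + phi 0 x b.2
  | m.+1 => fun b => (pd D2 m.+1 x b.1 + phi m.+1 x b.2, - pd D1 m x b.2)
  end.

Lemma cone_d_additive n x : zmod_morphism (@cone_d_fun n x).
Proof.
case: n => [|n] [b c] [b' c'] /=; first by rewrite !raddfB opprD addrACA.
congr pair; rewrite /=; first by rewrite !raddfB opprD addrACA.
by rewrite raddfB opprB opprK addrC.
Qed.

Definition cone_d n x : {additive cone_ob n.+1 x -> cone_ob n x} :=
  mk_additive (@cone_d_additive n x).

Lemma cone_d_nat n x y (f : hom x y) m :
  cone_d n x (psh_res (cone_ob n.+1) f m) = psh_res (cone_ob n) f (cone_d n y m).
Proof.
case: n m => [|n] [b c] /=; rewrite /pair_map /=.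
  by rewrite pd_nat phi_nat raddfD.
by rewrite !pd_nat phi_nat raddfD raddfN.
Qed.

Lemma cone_dd n x m : cone_d n x (cone_d n.+1 x m) = 0.
Proof.
case: n m => [|n] [b c] /=.
  by rewrite raddfD pd_pd add0r raddfN phi_d subrr.
congr pair; rewrite /=; first by rewrite raddfD pd_pd add0r raddfN phi_d subrr.
by rewrite raddfN pd_pd !oppr0.
Qed.

Definition cone : pcomplex C := PComplex cone_d_nat cone_dd.

Lemma qiso_acyclic x : (forall n, qsurj_at x n) -> (forall n, qinj_at x n) ->
  forall n, acyclic_at cone n x.
Proof.
move=> sur inj [|n] z zc.
  have [y [_ [w ->]]] := sur 0%N z I; exists (w, y) => /=; exact: addrC.
case: z zc => b c zc.
have [bc cc] : pd D2 n x b + phi n x c = 0 /\ pcycle c.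
  case: n b c zc => [|n] b c; first by move=> /= h.
  by case=> h1 h2; split=> //=; apply: oppr_inj; rewrite h2 oppr0.
have [|v cv] := inj n c cc (- b).
  by rewrite raddfN; apply/eqP; rewrite -addr_eq0 addrC bc.
have [|z [zc' [w bw]]] := sur n.+1 (b + phi n.+1 x v).
  by rewrite /= raddfD -phi_d -cv bc.
exists (w, z - v); congr pair; rewrite /=.
  by rewrite raddfB addrA [_ + phi _ _ z]addrC -bw addrK.
by rewrite raddfB opprB -cv [pd _ _ _ _]zc' subr0.
Qed.

Lemma acyclic_qsurj x n : (forall n, acyclic_at cone n x) -> qsurj_at x n.
Proof.
move=> ac; case: n => [|n] z zc.
  by have [[b c] <-] := ac 0%N z I; exists c; split=> //; exists b; rewrite addrC.
have [|[b c] /= [e1 e2]] := ac n.+1 (z, 0).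
  by case: n z zc => [|n] z zc; rewrite /= ?oppr0 raddf0 addr0 [pd _ _ _ _]zc ?raddf0 ?oppr0.
exists c; split; first by apply: oppr_inj; rewrite oppr0.
by exists b; rewrite -e1 addrC.
Qed.

Lemma acyclic_qinj x n : (forall n, acyclic_at cone n x) -> qinj_at x n.
Proof.
move=> ac z zc w zw.
have [|[b c] /= [e1 e2]] := ac n.+1 (- w, z).
  case: n z zc w zw => [|n] z zc w zw /=; rewrite raddfN zw addrC subrr //.
  by rewrite [pd _ _ _ _]zc oppr0.
by exists (- c); rewrite raddfN e2.
Qed.

Variables (S : Type) (ob : S -> C).
Hypothesis proj1 : forall n, rel_projective ob (D1 n).
Hypothesis proj2 : forall n, rel_projective ob (D2 n).

(** A map of complexes of relatively projective presheaves which is a quasi-isomorphism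
    on the objects of [S] is one everywhere: apply acyclicity to its cone. *)
Theorem rel_projective_qiso :
  (forall a n, qsurj_at (ob a) n) -> (forall a n, qinj_at (ob a) n) ->
  forall x n, qsurj_at x n /\ qinj_at x n.
Proof.
move=> sur inj x n.
have ac m : acyclic_at cone m x.
  apply: (@rel_projective_acyclic _ _ ob m cone) => [[|k]|a k].
  - exact: proj2.
  - by apply: rel_projective_prod.
  - exact: qiso_acyclic.
by split; [apply: acyclic_qsurj|apply: acyclic_qinj].
Qed.

End Qiso.

Section HomologyBij.
Variables (C D : complex) (phi : chain_map C D) (n : nat).

Lemma is_cycle_cyc (E : complex) (z : cycle E n) : cyc_val z \in is_cycle E n.
Proof. by case: z. Qed.

Lemma homology_bijE :
  bijective (homology_map phi (n := n)) <->
  (forall z' : D n, z' \in is_cycle D n ->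
    exists z : C n, z \in is_cycle C n /\ exists w, z' = phi n z + cdiff D n w) /\
  (forall z : C n, z \in is_cycle C n ->
    forall w, phi n z = cdiff D n w -> exists v, z = cdiff C n v).
Proof.
have h0 E : hclass (0 : cycle E n) = 0 by rewrite /hclass raddf0.
split=> [bij|[sur inj]].
  split=> [z' zc|z zc w zw].
    have [g _ gK] := bij.
    have := gK (hclass (Cycle zc)); rewrite -[g _]hreprK homology_map_class.
    move=> /esym /hclassP[w /= hw].
    by exists (cyc_val (hrepr (g (hclass (Cycle zc))))); split;
      [apply: is_cycle_cyc|exists w; rewrite -hw addrC subrK].
  have : hclass (Cycle zc) = hclass 0.
    apply: (bij_inj bij); rewrite h0 raddf0 homology_map_class -h0.
    by apply/hclassP; exists w; rewrite subr0.
  by move=> /hclassP[v hv]; exists v; rewrite -hv subr0.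
have injH : injective (homology_map phi (n := n)).
  suff ker0 q : homology_map phi (n := n) q = 0 -> q = 0.
    by move=> q r qr; apply/eqP; rewrite -subr_eq0; apply/eqP/ker0;
      apply: (etrans (homology_map_additive phi q r)); rewrite qr subrr.
  rewrite -[q]hreprK homology_map_class -(h0 D).
  move=> /hclassP[w]; rewrite subr0 => /= hw.
  have [v hv] := inj _ (is_cycle_cyc _) w hw.
  by rewrite -(h0 C); apply/hclassP; exists v; rewrite subr0.
have surH q : exists p, homology_map phi (n := n) p = q.
  have [z [zc [w hw]]] := sur _ (is_cycle_cyc (hrepr q)).
  exists (hclass (Cycle zc)); rewrite homology_map_class -[RHS]hreprK.
  apply/esym/hclassP; exists w; rewrite hw /=.
  by rewrite addrC addKr.
pose g q := sval (boolp.cid (surH q)).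
have gK q : homology_map phi (n := n) (g q) = q by exact: (svalP (boolp.cid (surH q))).
by exists g => // p; apply: injH; rewrite gK.
Qed.

End HomologyBij.

(** * Lifting derivations on polygraphs *)

(** Contravariant actions of the 1-cells of [P] on a single abelian group, in which the
    unit of an object acts by a projection onto the part living over that object. *)
Record cmodule (P : infcat) := CModule {
  mcar :> zmodType;
  mact : P 1%N -> {additive mcar -> mcar};
  mact_comp : forall v u e t, mact (comp (ltn0Sn 0) v u e) t = mact u (mact v t);
  mact_two_cell : forall (al : P 2%N) t,
    mact (src (leqnSn 1) al) t = mact (trg (leqnSn 1) al) t
}.

Section CellAction.
Variables (P : infcat) (M : cmodule P).

Definition mid (a : P 0%N) : {additive M -> M} := mact M (idn (leq0n 1) a).

(** Higher cells act through any of their one-dimensional faces. *)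
Definition kact k (hk : (0 < k)%N) (x : P k) : {additive M -> M} := mact M (trg hk x).

Lemma mact_mid (u : P 1%N) t : mact M u (mid (trg0 u) t) = mact M u t.
Proof.
have e : trg (ltnW (ltn0Sn 0)) u = src (ltnW (ltn0Sn 0)) (idn (leq0n 1) (trg0 u)).
  by rewrite (src_idn_lo (leqnn 0)) src_id; apply: trg_congr.
by rewrite /mid -(mact_comp e) comp_idlE //; apply/idn_congr/trg_congr.
Qed.

Lemma mid_mact (u : P 1%N) t : mid (src0 u) (mact M u t) = mact M u t.
Proof.
have e : trg (ltnW (ltn0Sn 0)) (idn (leq0n 1) (src0 u)) = src (ltnW (ltn0Sn 0)) u.
  by rewrite (trg_idn_lo (leqnn 0)) trg_id; apply: src_congr.
by rewrite /mid -(mact_comp e) comp_idrE //; apply/idn_congr/src_congr.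
Qed.

Lemma midK (a : P 0%N) t : mid a (mid a t) = mid a t.
Proof.
rewrite -[in RHS](mact_mid (idn (leq0n 1) a)); congr (mact _ _ (mid _ _)).
by rewrite (trg_idn_lo (leqnn 0)) trg_id.
Qed.

Lemma kact_src1 k (hk : (0 < k)%N) (hk' : (1 < k)%N) (x : P k) t :
  mact M (src hk x) t = kact hk x t.
Proof.
rewrite /kact -(src_trgW (leqnSn 1) hk' hk x) // mact_two_cell.
by rewrite (trg_trg _ _ hk).
Qed.

Lemma kact_src j k (hj : (0 < j)%N) (hjk : (j <= k)%N) (hk : (0 < k)%N) (x : P k) t :
  kact hj (src hjk x) t = kact hk x t.
Proof.
rewrite /kact; case: j hj hjk => // -[|j] hj hjk; last by rewrite (trg_srcW _ _ hk).
rewrite trg_id; case: k hjk hk x => // -[|k] hjk hk x.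
  by rewrite src_id trg_id.
by rewrite (src_congr hjk hk erefl) kact_src1.
Qed.

Lemma kact_trg j k (hj : (0 < j)%N) (hjk : (j <= k)%N) (hk : (0 < k)%N) (x : P k) t :
  kact hj (trg hjk x) t = kact hk x t.
Proof. by rewrite /kact (trg_trg _ _ hk). Qed.

Lemma kact_idn j k (hj : (0 < j)%N) (hjk : (j <= k)%N) (hk : (0 < k)%N) (x : P j) t :
  kact hk (idn hjk x) t = kact hj x t.
Proof. by rewrite /kact (trg_idn_lo hj). Qed.

Lemma kact_idn0 k (h : (0 <= k)%N) (hk : (0 < k)%N) (a : P 0%N) t :
  kact hk (idn h a) t = mid a t.
Proof. by rewrite /kact (trg_idn_hi (leq0n 1)). Qed.

Lemma kact_comp0 k (h : (0 < k)%N) (hk : (0 < k)%N) (x1 x0 : P k) e t :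
  kact hk (comp h x1 x0 e) t = kact hk x0 (kact hk x1 t).
Proof.
have [e' E] := trg_comp_hiW (ltn0Sn 0) hk e.
by rewrite /kact E mact_comp.
Qed.

Lemma kact_compl i k (h : (i.+1 < k)%N) (hk : (0 < k)%N) (x1 x0 : P k) e t :
  kact hk (comp h x1 x0 e) t = kact hk x1 t.
Proof.
by rewrite -(kact_trg (ltn0Sn i) (ltnW h)) trg_comp kact_trg.
Qed.

Lemma kact_composable i k (h : (i.+1 < k)%N) (hk : (0 < k)%N) (x1 x0 : P k) t :
  trg (ltnW h) x0 = src (ltnW h) x1 -> kact hk x0 t = kact hk x1 t.
Proof.
move=> e; rewrite -(kact_trg (ltn0Sn i) (ltnW h)) e; exact: kact_src.
Qed.

Lemma kact_compW k (hk : (0 < k)%N) i : (0 < i)%N -> forall (h : (i < k)%N) (x1 x0 : P k) e,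
  (forall t, kact hk (comp h x1 x0 e) t = kact hk x1 t) /\
  (forall t, kact hk x1 t = kact hk x0 t).
Proof.
by case: i => // i _ h x1 x0 e; split=> t; [apply: kact_compl|apply/esym; apply: kact_composable e].
Qed.

Lemma kact_mid k (hk : (0 < k)%N) (x : P k) a t : trg0 x = a -> kact hk x (mid a t) = kact hk x t.
Proof.
move=> <-; rewrite /kact -[in RHS]mact_mid; congr (mact _ _ (mid _ _)).
by rewrite (trg_trg _ _ (leq0n k)).
Qed.

Lemma mid_kact k (hk : (0 < k)%N) (x : P k) a t : src0 x = a -> mid a (kact hk x t) = kact hk x t.
Proof.
move=> <-; rewrite /kact -[in RHS]mid_mact; congr (mid _ _).
by rewrite (src_trgW _ _ (leq0n k)).
Qed.

End CellAction.

Section Derivation.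
Variables (P : infcat) (M A : cmodule P) (n : nat).

(** Crossed homomorphisms for the action of 1-cells: the Leibniz rule governs [0]-composition,
    and all the other compositions are additive. *)
Record derivation (delta : P n -> M -> A) : Prop := Derivation {
  der_add : forall c, zmod_morphism (delta c);
  der_trg : forall c t, delta c (mid M (trg0 c) t) = delta c t;
  der_src : forall c t, mid A (src0 c) (delta c t) = delta c t;
  der_comp0 : forall (h : (0 < n)%N) x1 x0 e t,
    delta (comp h x1 x0 e) t = kact A h x0 (delta x1 t) + delta x0 (kact M h x1 t);
  der_compS : forall i (h : (i.+1 < n)%N) x1 x0 e t,
    delta (comp h x1 x0 e) t = delta x1 t + delta x0 t
}.

End Derivation.

(** A unit is idempotent for composition, so its derivative is twice itself. *)
Lemma der_unit (P : infcat) (M A : cmodule P) n (delta : P n.+1 -> M -> A) : derivation delta ->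
  forall i (h : (i < n.+1)%N) (h' : (i <= n.+1)%N) (x : P i) t, delta (idn h' x) t = 0.
Proof.
move=> der i h h' x t; set y := idn h' x.
have e : trg (ltnW h) y = src (ltnW h) y.
  by rewrite /y (trg_idn_hi (leqnn i)) (src_idn_hi (leqnn i)).
have E : comp h y y e = y.
  by apply: comp_idrE; rewrite {1}/y (src_idn_hi (leqnn i)) idn_id; apply: idn_congr.
apply: (@addIr _ (delta y t)); rewrite add0r -[in RHS]E.
case: i h h' x @y e E => [|i] h h' x y e E; last by rewrite (der_compS der).
rewrite (der_comp0 der) /y !kact_idn0.
have E1 : mid A x (delta (idn h' x) t) = delta (idn h' x) t.
  by rewrite -[RHS](der_src der) (src_idn_lo (leqnn 0)) src_id.
have E2 : delta (idn h' x) (mid M x t) = delta (idn h' x) t.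
  by rewrite -[RHS](der_trg der) (trg_idn_lo (leqnn 0)) trg_id.
by rewrite E1 E2.
Qed.

(** The infinity-category over [P] whose sections are the derivations lifting [delta]
    along [eps]: an [n.+1]-cell carries a possible value of the derivation, a cell of higher
    dimension those of its [n.+1]-dimensional source and target, and a cell of lower
    dimension nothing. *)
Section Lifting.
Variables (P : infcat) (M A B : cmodule P) (n : nat).
Variables (delta : P n.+1 -> M -> B) (eps : {additive A -> B}) (kappa : {additive B -> A}).
Hypothesis der : derivation delta.
Hypothesis eps_act : forall u t, eps (mact A u t) = mact B u (eps t).
Hypothesis kappaK : forall t, eps (kappa t) = t.

Record lprop k (c : P k) (lo hi : M -> A) : Prop := LProp {
  lp_addl : zmod_morphism lo;
  lp_addh : zmod_morphism hi;
  lp_trgl : forall t, lo (mid M (trg0 c) t) = lo t;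
  lp_trgh : forall t, hi (mid M (trg0 c) t) = hi t;
  lp_srcl : forall t, mid A (src0 c) (lo t) = lo t;
  lp_srch : forall t, mid A (src0 c) (hi t) = hi t;
  lp_lowl : (k <= n)%N -> forall t, lo t = 0;
  lp_lowh : (k <= n)%N -> forall t, hi t = 0;
  lp_eq : (k <= n.+1)%N -> forall t, lo t = hi t;
  lp_epsl : forall h t, eps (lo t) = delta (src h c) t;
  lp_epsh : forall h t, eps (hi t) = delta (trg h c) t
}.

Record lcell k := LCell {
  lc : P k;
  lo : M -> A;
  hi : M -> A;
  lcP : lprop lc lo hi
}.

Lemma lcell_eq k (x y : lcell k) :
  lc x = lc y -> (forall t, lo x t = lo y t) -> (forall t, hi x t = hi y t) -> x = y.
Proof.
case: x y => [c l h p] [c' l' h' p'] /= ec /funext el /funext eh; subst.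
by congr LCell; apply: Prop_irrelevance.
Qed.

(** Faces of dimension at most [n] carry no value. *)
Definition cut i (f : M -> A) (t : M) : A := if (i <= n)%N then 0 else f t.

Lemma cut_add i f : zmod_morphism f -> zmod_morphism (cut i f).
Proof. by move=> fB x y; rewrite /cut; case: ifP; rewrite ?subr0. Qed.

Program Definition lsrc i k (h : (i <= k)%N) (x : lcell k) : lcell i :=
  @LCell i (src h (lc x)) (cut i (lo x)) (cut i (if (i <= n.+1)%N then lo x else hi x)) _.
Next Obligation.
have p := lcP x.
split.
- exact: cut_add (lp_addl p).
- by apply: cut_add; case: ifP => _; [exact: (lp_addl p)|exact: (lp_addh p)].
- move=> t; rewrite /cut; case: ifP => // /negbT; rewrite -ltnNge => ni.
  by rewrite (trg_srcW _ _ (leq0n k)) ?(lp_trgl p) //; lia.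
- move=> t; rewrite /cut; case: ifP => // /negbT; rewrite -ltnNge => ni.
  by rewrite (trg_srcW _ _ (leq0n k)); [case: ifP => _; rewrite ?(lp_trgl p) ?(lp_trgh p)|lia].
- move=> t; rewrite /cut; case: ifP => _; first by rewrite raddf0.
  by rewrite (src_src _ _ (leq0n k)) (lp_srcl p).
- move=> t; rewrite /cut; case: ifP => _; first by rewrite raddf0.
  by rewrite (src_src _ _ (leq0n k)); case: ifP => _; rewrite ?(lp_srcl p) ?(lp_srch p).
- by move=> e t; rewrite /cut e.
- by move=> e t; rewrite /cut e.
- by move=> e t; rewrite /cut e.
- move=> hn t; rewrite /cut leqNgt hn /= (src_src _ _ (leq_trans hn h)).
  exact: (lp_epsl p).
- move=> hn t; rewrite /cut leqNgt hn /=; case: ifP => e.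
    have ei : i = n.+1 by lia.
    by subst i; rewrite trg_id (lp_epsl p).
  rewrite (trg_srcW _ _ (leq_trans hn h)); last lia.
  exact: (lp_epsh p).
Qed.

Program Definition ltrg i k (h : (i <= k)%N) (x : lcell k) : lcell i :=
  @LCell i (trg h (lc x)) (cut i (if (i <= n.+1)%N then hi x else lo x)) (cut i (hi x)) _.
Next Obligation.
have p := lcP x.
split.
- by apply: cut_add; case: ifP => _; [exact: (lp_addh p)|exact: (lp_addl p)].
- exact: cut_add (lp_addh p).
- move=> t; rewrite /cut; case: ifP => // _.
  by rewrite (trg_trg _ _ (leq0n k)); case: ifP => _; rewrite ?(lp_trgl p) ?(lp_trgh p).
- move=> t; rewrite /cut; case: ifP => // _.
  by rewrite (trg_trg _ _ (leq0n k)) (lp_trgh p).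
- move=> t; rewrite /cut; case: ifP => [_|/negbT]; first by rewrite raddf0.
  rewrite -ltnNge => ni; rewrite (src_trgW _ _ (leq0n k)); last lia.
  by case: ifP => _; rewrite ?(lp_srcl p) ?(lp_srch p).
- move=> t; rewrite /cut; case: ifP => [_|/negbT]; first by rewrite raddf0.
  by rewrite -ltnNge => ni; rewrite (src_trgW _ _ (leq0n k)) ?(lp_srch p) //; lia.
- by move=> e t; rewrite /cut e.
- by move=> e t; rewrite /cut e.
- by move=> e t; rewrite /cut e.
- move=> hn t; rewrite /cut leqNgt hn /=; case: ifP => e.
    have ei : i = n.+1 by lia.
    by subst i; rewrite src_id (lp_epsh p).
  rewrite (src_trgW _ _ (leq_trans hn h)); last lia.
  exact: (lp_epsl p).
- move=> hn t; rewrite /cut leqNgt hn /= (trg_trg _ _ (leq_trans hn h)).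
  exact: (lp_epsh p).
Qed.

Program Definition lidn i k (h : (i <= k)%N) (x : lcell i) : lcell k :=
  @LCell k (idn h (lc x)) (lo x) (hi x) _.
Next Obligation.
have p := lcP x.
split; try by case: p.
- by move=> t; rewrite (trg_idn_lo (leq0n i)) (lp_trgl p).
- by move=> t; rewrite (trg_idn_lo (leq0n i)) (lp_trgh p).
- by move=> t; rewrite (src_idn_lo (leq0n i)) (lp_srcl p).
- by move=> t; rewrite (src_idn_lo (leq0n i)) (lp_srch p).
- by move=> e; apply: (lp_lowl p); lia.
- by move=> e; apply: (lp_lowh p); lia.
- by move=> e; apply: (lp_eq p); lia.
- move=> hn t; have [ni|ni] := leqP n.+1 i.
    by rewrite (src_idn_lo ni) (lp_epsl p).
  by rewrite (src_idn_hi (ltnW ni)) (der_unit der) // (lp_lowl p) ?raddf0.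
- move=> hn t; have [ni|ni] := leqP n.+1 i.
    by rewrite (trg_idn_lo ni) (lp_epsh p).
  by rewrite (trg_idn_hi (ltnW ni)) (der_unit der) // (lp_lowh p) ?raddf0.
Qed.

(** The value at an i-composite forced by the values at its factors. *)
Definition leibniz i k (hk : (0 < k)%N) (x1 x0 : P k) (f1 f0 : M -> A) (t : M) : A :=
  if i is 0 then kact A hk x0 (f1 t) + f0 (kact M hk x1 t) else f1 t + f0 t.

Lemma leibniz_pos i k (hk : (0 < k)%N) (x1 x0 : P k) f1 f0 t :
  (0 < i)%N -> leibniz i hk x1 x0 f1 f0 t = f1 t + f0 t.
Proof. by case: i. Qed.

Lemma leibniz_add i k (hk : (0 < k)%N) (x1 x0 : P k) f1 f0 :
  zmod_morphism f1 -> zmod_morphism f0 -> zmod_morphism (leibniz i hk x1 x0 f1 f0).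
Proof.
move=> a1 a0 t t'; rewrite /leibniz; case: i => [|i].
  by rewrite a1 !raddfB a0 opprD addrACA.
by rewrite a1 a0 opprD addrACA.
Qed.

Lemma leibniz_trg i k (h : (i < k)%N) (hk : (0 < k)%N) (x1 x0 : P k) (f1 f0 : M -> A) e :
  (forall t, f1 (mid M (trg0 x1) t) = f1 t) -> (forall t, f0 (mid M (trg0 x0) t) = f0 t) ->
  forall t, leibniz i hk x1 x0 f1 f0 (mid M (trg0 (comp h x1 x0 e)) t) = leibniz i hk x1 x0 f1 f0 t.
Proof.
move=> h1 h0 t; rewrite trg0_compW /leibniz; case: i h e => [|i] h e.
  by rewrite h1 kact_mid.
by rewrite h1 -(trg0_compS e) h0.
Qed.

Lemma leibniz_src i k (h : (i < k)%N) (hk : (0 < k)%N) (x1 x0 : P k) (f1 f0 : M -> A) e :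
  (forall t, mid A (src0 x1) (f1 t) = f1 t) -> (forall t, mid A (src0 x0) (f0 t) = f0 t) ->
  forall t, mid A (src0 (comp h x1 x0 e)) (leibniz i hk x1 x0 f1 f0 t) = leibniz i hk x1 x0 f1 f0 t.
Proof.
move=> h1 h0 t; rewrite src0_compW /leibniz; case: i h e => [|i] h e; rewrite raddfD h0.
  by rewrite mid_kact.
by rewrite (src0_compS e) h1.
Qed.

Lemma leibniz_eps i k (h : (i < k)%N) (hk : (0 < k)%N) (hn : (n.+1 <= k)%N) (hin : (i < n.+1)%N)
    (x1 x0 : P k) (f1 f0 : M -> A) e b :
  (forall t, eps (f1 t) = delta (face b hn x1) t) ->
  (forall t, eps (f0 t) = delta (face b hn x0) t) ->
  forall t, eps (leibniz i hk x1 x0 f1 f0 t) = delta (face b hn (comp h x1 x0 e)) t.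
Proof.
move=> h1 h0 t.
have [e' ->] : exists e', face b hn (comp h x1 x0 e) = comp hin (face b hn x1) (face b hn x0) e'.
  by case: b {h1 h0}; [apply: (trg_comp_hiW hin hn)|apply: (src_comp_hiW hin hn)].
have ka (N : cmodule P) (hp : (0 < n.+1)%N) (x : P k) u :
    kact N hp (face b hn x) u = kact N hk x u.
  by case: b {h1 h0 e'}; [apply: kact_trg|apply: kact_src].
rewrite /leibniz; case: i h e hin e' ka => [|i] h e hin e' ka; rewrite raddfD.
  by rewrite (der_comp0 der) h0 eps_act h1 !ka.
by rewrite (der_compS der) h0 h1.
Qed.

(** Along a cell of dimension above [n] the pairs [(lo, hi)] are composed like the arrows
    of a codiscrete category: the outer ends are kept. *)
Program Definition lcomp i k (h : (i < k)%N) (x1 x0 : lcell k)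
    (e : ltrg (ltnW h) x0 = lsrc (ltnW h) x1) : lcell k :=
  let hk := leq_ltn_trans (leq0n i) h in
  @LCell k (comp h (lc x1) (lc x0) (congr1 (@lc i) e))
    (if (i <= n)%N then leibniz i hk (lc x1) (lc x0) (lo x1) (lo x0) else lo x0)
    (if (i <= n)%N then leibniz i hk (lc x1) (lc x0) (hi x1) (hi x0) else hi x1) _.
Next Obligation.
have p1 := lcP x1; have p0 := lcP x0; set hk := leq_ltn_trans _ _.
have ec : trg (ltnW h) (lc x0) = src (ltnW h) (lc x1) := congr1 (@lc i) e.
rewrite (Prop_irrelevance (congr1 _ e) ec); split.
- by case: ifP => _; [apply: leibniz_add; [apply: (lp_addl p1)|apply: (lp_addl p0)]|apply: (lp_addl p0)].
- by case: ifP => _; [apply: leibniz_add; [apply: (lp_addh p1)|apply: (lp_addh p0)]|apply: (lp_addh p1)].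
- case: ifP => hin; first by apply: leibniz_trg; [apply: lp_trgl p1|apply: lp_trgl p0].
  case: i h e @hk ec hin => [|i] // h e hk ec hin t.
  by rewrite trg0_compW -(trg0_compS ec) (lp_trgl p0).
- case: ifP => hin; first by apply: leibniz_trg; [apply: lp_trgh p1|apply: lp_trgh p0].
  by move=> t; rewrite trg0_compW (lp_trgh p1).
- case: ifP => hin; first by apply: leibniz_src; [apply: lp_srcl p1|apply: lp_srcl p0].
  by move=> t; rewrite src0_compW (lp_srcl p0).
- case: ifP => hin; first by apply: leibniz_src; [apply: lp_srch p1|apply: lp_srch p0].
  case: i h e @hk ec hin => [|i] // h e hk ec hin t.
  by rewrite src0_compW (src0_compS ec) (lp_srch p1).
- move=> kn t; have -> : (i <= n)%N by lia.
  by rewrite /leibniz; case: (i); rewrite ?(lp_lowl p1 kn) ?(lp_lowl p0 kn) ?raddf0 addr0.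
- move=> kn t; have -> : (i <= n)%N by lia.
  by rewrite /leibniz; case: (i); rewrite ?(lp_lowh p1 kn) ?(lp_lowh p0 kn) ?raddf0 addr0.
- move=> kn t; have -> : (i <= n)%N by lia.
  by rewrite /leibniz; case: (i); rewrite ?(lp_eq p1 kn) ?(lp_eq p0 kn).
- move=> hn t; case: ifPn => hin.
    apply: (@leibniz_eps _ _ h _ hn hin _ _ _ _ ec false) => u.
      exact: (lp_epsl p1).
    exact: (lp_epsl p0).
  rewrite (lp_epsl p0 hn); congr delta; rewrite -ltnNge in hin.
  rewrite -[LHS](src_src hin (ltnW h)) -[RHS](src_src hin (ltnW h)); congr src.
  by rewrite src_comp.
- move=> hn t; case: ifPn => hin.
    apply: (@leibniz_eps _ _ h _ hn hin _ _ _ _ ec true) => u.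
      exact: (lp_epsh p1).
    exact: (lp_epsh p0).
  rewrite (lp_epsh p1 hn); congr delta; rewrite -ltnNge in hin.
  rewrite -[LHS](trg_trg hin (ltnW h)) -[RHS](trg_trg hin (ltnW h)); congr trg.
  by rewrite trg_comp.
Qed.

Section Composable.
Variables (i k : nat) (h : (i < k)%N) (x1 x0 : lcell k).
Hypothesis e : ltrg (ltnW h) x0 = lsrc (ltnW h) x1.

Lemma lcomp_lo t : (n.+1 < i)%N -> lo x0 t = lo x1 t.
Proof.
move=> hn; have := congr1 (fun c => lo c t) e.
by rewrite /= /cut leqNgt (ltnW hn) /= leqNgt hn.
Qed.

Lemma lcomp_hi t : (n.+1 < i)%N -> hi x0 t = hi x1 t.
Proof.
move=> hn; have := congr1 (fun c => hi c t) e.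
by rewrite /= /cut leqNgt (ltnW hn) /= leqNgt hn.
Qed.

End Composable.

Lemma cut_leibniz i j k (hjk : (j <= k)%N) (hk : (0 < k)%N) (hj : (0 < j)%N) b
    (x1 x0 : P k) (f1 f0 : M -> A) t :
  cut j (leibniz i hk x1 x0 f1 f0) t =
  leibniz i hj (face b hjk x1) (face b hjk x0) (cut j f1) (cut j f0) t.
Proof.
have ka (N : cmodule P) (x : P k) u : kact N hj (face b hjk x) u = kact N hk x u.
  by case: b; [apply: kact_trg|apply: kact_src].
rewrite /cut /leibniz; case: ifP => _; case: i => [|i]; rewrite ?raddf0 ?addr0 //.
by rewrite !ka.
Qed.

Ltac cut_cases := rewrite /cut; repeat case: leqP => ?; try by []; try (exfalso; lia).

Ltac cut_low p := cut_cases;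
  first [ by rewrite (lp_eq p) //; lia | by rewrite (lp_lowl p) //; lia
        | by rewrite (lp_lowh p) //; lia].

Program Definition lifting : infcat :=
  @InfCat lcell lsrc ltrg lidn lcomp
    _ _ _ _ _ _ _ _ _ _ _ _ _ _ _ _ _ _ _ _ _.
Next Obligation.
have p := lcP x; apply: lcell_eq => [|t|t] /=; first exact: src_id.
  by cut_low p.
by cut_low p.
Qed.
Next Obligation.
have p := lcP x; apply: lcell_eq => [|t|t] /=; first exact: trg_id.
  by cut_low p.
by cut_low p.
Qed.
Next Obligation. by apply: lcell_eq => [|t|t] /=; [exact: src_src| |]; cut_cases. Qed.
Next Obligation. by apply: lcell_eq => [|t|t] /=; [exact: trg_trg| |]; cut_cases. Qed.
Next Obligation. by apply: lcell_eq => [|t|t] /=; [exact: src_trg| |]; cut_cases. Qed.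
Next Obligation. by apply: lcell_eq => [|t|t] /=; [exact: trg_src| |]; cut_cases. Qed.
Next Obligation. by apply: lcell_eq => //=; apply: idn_id. Qed.
Next Obligation. by apply: lcell_eq => //=; apply: idn_idn. Qed.
Next Obligation.
have p := lcP x; apply: lcell_eq => [|t|t] /=; first exact: src_idn_hi.
  by cut_low p.
by cut_low p.
Qed.
Next Obligation.
have p := lcP x; apply: lcell_eq => [|t|t] /=; first exact: trg_idn_hi.
  by cut_low p.
by cut_low p.
Qed.
Next Obligation. by apply: lcell_eq => [|t|t] //=; apply: src_idn_lo. Qed.
Next Obligation. by apply: lcell_eq => [|t|t] //=; apply: trg_idn_lo. Qed.
Next Obligation.
apply: lcell_eq => [|t|t] /=; first exact: src_comp.
  by cut_cases.
by cut_cases; rewrite (lcomp_hi e).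
Qed.
Next Obligation.
apply: lcell_eq => [|t|t] /=; first exact: trg_comp.
  by cut_cases; rewrite (lcomp_lo e).
by cut_cases.
Qed.
Next Obligation.
apply: lcell_eq => [|t|t] /=; first exact: src_comp_hi.
  have [hin|hin] := leqP i n; last by cut_cases.
  exact: (cut_leibniz i hjn _ _ false).
have [hin|hin] := leqP i n; last by cut_cases.
by case: (j <= n.+1)%N; apply: (cut_leibniz i hjn _ _ false).
Qed.
Next Obligation.
apply: lcell_eq => [|t|t] /=; first exact: trg_comp_hi.
  have [hin|hin] := leqP i n; last by cut_cases.
  by case: (j <= n.+1)%N; apply: (cut_leibniz i hjn _ _ true).
have [hin|hin] := leqP i n; last by cut_cases.
exact: (cut_leibniz i hjn _ _ true).
Qed.
Next Obligation.
have p := lcP x; apply: lcell_eq => [|t|t] /=; first exact: comp_idr.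
  have [hin|hin] := leqP i n; last by cut_cases.
  by rewrite /cut hin /leibniz; case: i lt_in e hin => [|i] lt_in e hin;
    rewrite addr0 // kact_idn0 ?(bool_irrelevance (ltnW lt_in) (leq0n n0)) (lp_srcl p).
have [hin|hin] := leqP i n; last by cut_cases.
by rewrite /cut hin /leibniz; case: i lt_in e hin => [|i] lt_in e hin;
  rewrite addr0 // kact_idn0 ?(bool_irrelevance (ltnW lt_in) (leq0n n0)) (lp_srch p).
Qed.
Next Obligation.
have p := lcP x; apply: lcell_eq => [|t|t] /=; first exact: comp_idl.
  have [hin|hin] := leqP i n; last by cut_cases.
  by rewrite /cut hin /leibniz; case: i lt_in e hin => [|i] lt_in e hin;
    rewrite ?raddf0 add0r // kact_idn0 (bool_irrelevance (ltnW lt_in) (leq0n n0)) (lp_trgl p).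
have [hin|hin] := leqP i n; last by cut_cases.
by rewrite /cut hin /leibniz; case: i lt_in e hin => [|i] lt_in e hin;
  rewrite ?raddf0 add0r // kact_idn0 (bool_irrelevance (ltnW lt_in) (leq0n n0)) (lp_trgh p).
Qed.
Next Obligation.
apply: lcell_eq => [|t|t] /=; first exact: idn_comp.
  case: ifP => // hin; rewrite /leibniz; case: i lt_in lt_ik e e' hin => [|i] lt_in lt_ik e e' hin //.
  by rewrite !(@kact_idn _ _ _ _ (leq_ltn_trans (leq0n 0) lt_in)).
case: ifP => // hin; rewrite /leibniz; case: i lt_in lt_ik e e' hin => [|i] lt_in lt_ik e e' hin //.
by rewrite !(@kact_idn _ _ _ _ (leq_ltn_trans (leq0n 0) lt_in)).
Qed.
Next Obligation.
have ad : forall (f : M -> A), zmod_morphism f -> forall u v, f (u + v) = f u + f v.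
  by move=> f fB u v; apply: (raddfD (mk_additive fB)).
apply: lcell_eq => [|t|t] /=; first exact: comp_assoc.
  case hin : (i <= n)%N => //=; rewrite /leibniz.
  case: i lt_in e10 e21 el er hin => [|i] lt_in e10 e21 el er hin; last by rewrite addrA.
  by rewrite !kact_comp0 raddfD addrA.
case hin : (i <= n)%N => //=; rewrite /leibniz.
case: i lt_in e10 e21 el er hin => [|i] lt_in e10 e21 el er hin; last by rewrite addrA.
by rewrite !kact_comp0 raddfD addrA.
Qed.
Next Obligation.
have j0 : (0 < j)%N by apply: leq_ltn_trans lt_ij.
set hk := leq_ltn_trans (leq0n i) lt_in.
have [ky1 ky2] := kact_compW M hk j0 (congr1 (@lc _) ey).
have [kx1 kx2] := kact_compW A hk j0 (congr1 (@lc _) ex).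
have main (f1 f0 g1 g0 : M -> A) t :
    leibniz i hk (comp lt_jn (lc y1) (lc y0) (congr1 (@lc j) ey))
            (comp lt_jn (lc x1) (lc x0) (congr1 (@lc j) ex))
      (fun u => f1 u + f0 u) (fun u => g1 u + g0 u) t =
    leibniz i hk (lc y1) (lc x1) f1 g1 t + leibniz i hk (lc y0) (lc x0) f0 g0 t.
  rewrite /leibniz; case: (i); last by move=> _; exact: addrACA.
  by rewrite kx1 ky1 raddfD addrACA (kx2 (f0 t)) -ky2.
have main0 (f g : M -> A) t :
    leibniz i hk (comp lt_jn (lc y1) (lc y0) (congr1 (@lc j) ey))
            (comp lt_jn (lc x1) (lc x0) (congr1 (@lc j) ex)) f g t =
    leibniz i hk (lc y0) (lc x0) f g t.
  by rewrite /leibniz; case: (i) => //; rewrite kx1 ky1 kx2 ky2.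
have main1 (f g : M -> A) t :
    leibniz i hk (comp lt_jn (lc y1) (lc y0) (congr1 (@lc j) ey))
            (comp lt_jn (lc x1) (lc x0) (congr1 (@lc j) ex)) f g t =
    leibniz i hk (lc y1) (lc x1) f g t.
  by rewrite /leibniz; case: (i) => //; rewrite kx1 ky1.
have twj (h : (0 < n0)%N) (c1 c0 : P n0) f1 f0 : leibniz j h c1 c0 f1 f0 = fun u => f1 u + f0 u.
  by apply/funext => u; apply: leibniz_pos.
apply: lcell_eq => [|t|t] /=; first exact: (comp_exchange lt_ij).
  rewrite !twj; have [hin|hin] := leqP i n; have [hjn|hjn] := leqP j n.
  - exact: main.
  - exact: main0.
  - by exfalso; lia.
  - by [].
rewrite !twj; have [hin|hin] := leqP i n; have [hjn|hjn] := leqP j n.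
- exact: main.
- exact: main1.
- by exfalso; lia.
- by [].
Qed.

Program Definition lifting_proj : functor lifting P :=
  @Functor lifting P (fun k x => lc x) _ _ _ _.
Next Obligation. exact: comp_congr. Qed.

Lemma lprop0 k (c : P k) : (k <= n)%N -> lprop c (fun=> 0) (fun=> 0).
Proof.
move=> kn; split=> //; try by move=> *; rewrite ?subr0 ?raddf0.
  by move=> h; exfalso; lia.
by move=> h; exfalso; lia.
Qed.

(** Only [n.+1]-cells leave a choice, and there the additive section [kappa] provides one; in higher
    dimension the values are read off the boundary, and they are compatible with [eps] because
    [delta] only depends on the [n.+1]-dimensional faces. *)
Lemma lifting_fibration : trivial_fibration lifting_proj.
Proof.
apply: trivial_fibration_of_cells => [a|k u v c par su tv].
  by exists (LCell (lprop0 a (leq0n n))).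
have pu := lcP u; have pv := lcP v.
have tc : trg0 c = trg0 (lc v) by rewrite -[lc v]tv (trg_trg _ _ (leq0n k.+1)).
have sc : src0 c = src0 (lc u) by rewrite -[lc u]su (src_src _ _ (leq0n k.+1)).
have [kn|nk] := ltnP k n.
  exists (LCell (lprop0 c kn)); split=> //; apply: lcell_eq => [|t|t] //=.
  - by cut_cases; rewrite (lp_lowl pu) // ltnW.
  - by cut_cases; rewrite (lp_lowh pu) // ltnW.
  - by cut_cases; rewrite (lp_lowl pv) // ltnW.
  - by cut_cases; rewrite (lp_lowh pv) // ltnW.
have [kn|{}nk] := leqP k n.
  have ? : k = n by lia.
  (* The section [kappa] need not commute with the action of units, hence the projection. *)
  subst k; pose f t := mid A (src0 c) (kappa (delta c t)).
  have p : lprop c f f.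
    split; rewrite ?ltnn //.
    - by move=> t t'; rewrite /f (der_add der) !raddfB.
    - by move=> t t'; rewrite /f (der_add der) !raddfB.
    - by move=> t; rewrite /f (der_trg der).
    - by move=> t; rewrite /f (der_trg der).
    - by move=> t; rewrite /f midK.
    - by move=> t; rewrite /f midK.
    - by move=> h t; rewrite src_id /f eps_act kappaK (der_src der).
    - by move=> h t; rewrite trg_id /f eps_act kappaK (der_src der).
  exists (LCell p); split=> //; apply: lcell_eq => [|t|t] //=.
  - by cut_cases; rewrite (lp_lowl pu).
  - by cut_cases; rewrite (lp_lowh pu).
  - by cut_cases; rewrite (lp_lowl pv).
  - by cut_cases; rewrite (lp_lowh pv).
have k0 : (0 < k)%N by lia.
have tuv : trg0 (lc u) = trg0 (lc v).
  by have := congr1 (@lc _) (par true 0%N (leq0n k) k0).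
have suv : src0 (lc u) = src0 (lc v).
  by have := congr1 (@lc _) (par false 0%N (leq0n k) k0).
have p : lprop c (lo u) (hi v).
  split; rewrite ?tc ?sc.
  - exact: lp_addl pu.
  - exact: lp_addh pv.
  - by rewrite -tuv; apply: lp_trgl pu.
  - exact: lp_trgh pv.
  - exact: lp_srcl pu.
  - by rewrite suv; apply: lp_srch pv.
  - lia.
  - lia.
  - lia.
  - move=> h t; rewrite (lp_epsl pu nk) -[lc u]su; congr delta; exact: src_src.
  - move=> h t; rewrite (lp_epsh pv nk) -[lc v]tv; congr delta; exact: trg_trg.
have low t : (n.+1 < k)%N -> lo u t = lo v t.
  move=> kn; have := congr1 (fun x => lo x t) (par false n.+1 (ltnW kn) kn).
  by rewrite /= /cut ltnn.
have high t : (n.+1 < k)%N -> hi u t = hi v t.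
  move=> kn; have := congr1 (fun x => hi x t) (par true n.+1 (ltnW kn) kn).
  by rewrite /= /cut ltnn.
exists (LCell p); split=> //; apply: lcell_eq => [|t|t] //=.
- by cut_cases.
- by cut_cases; [apply: (lp_eq pu)|rewrite high].
- by cut_cases; [apply/esym/(lp_eq pv)|rewrite low].
- by cut_cases.
Qed.

Lemma derivation_lift_pos : polygraph P ->
  exists2 sigma : P n.+1 -> M -> A, derivation sigma & forall c t, eps (sigma c t) = delta c t.
Proof.
move=> pol; have [s sK] := polygraph_section pol lifting_fibration.
have sc k (c : P k) : lc (fap s c) = c by exact: (congr1 (fun g => fap g c) sK).
exists (fun c => lo (fap s c)); last first.
  by move=> c t; rewrite (lp_epsl (lcP (fap s c)) (leqnn _)) src_id sc.
split=> [c|c t|c t|h x1 x0 e t|i h x1 x0 e t].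
- exact: lp_addl (lcP (fap s c)).
- by have := lp_trgl (lcP (fap s c)) t; rewrite sc.
- by have := lp_srcl (lcP (fap s c)) t; rewrite sc.
- have e' := fap_composable s e; rewrite (fap_comp e e') /=.
  by rewrite !sc !(bool_irrelevance (leq_ltn_trans _ _) h).
- have e' := fap_composable s e; rewrite (fap_comp e e') /=.
  by have -> : (i.+1 <= n)%N by [].
Qed.

End Lifting.

(** Derivations on a polygraph are free on the generators, hence they lift along maps that
    are additively split. *)
Theorem derivation_lift (P : infcat) (M A B : cmodule P) n (delta : P n -> M -> B)
    (eps : {additive A -> B}) (kappa : {additive B -> A}) :
  derivation delta ->
  (forall u t, eps (mact A u t) = mact B u (eps t)) ->
  (forall t, eps (kappa t) = t) ->
  polygraph P ->
  exists2 sigma : P n -> M -> A, derivation sigma & forall c t, eps (sigma c t) = delta c t.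
Proof.
case: n delta => [|n] delta der eps_act kappaK pol; last exact: (derivation_lift_pos der).
(* There is no composition in degree 0, hence no Leibniz rule to satisfy. *)
exists (fun c t => mid A (src0 c) (kappa (delta c t))).
  split=> //.
  - by move=> c t t'; rewrite (der_add der) !raddfB.
  - by move=> c t; rewrite (der_trg der).
  - by move=> c t; rewrite midK.
by move=> c t; rewrite /mid eps_act kappaK (der_src der).
Qed.

(** * Coefficient systems and chain groups *)

(** The cellular module of a contravariant coefficient system: the sum of all its groups,
    on which a 1-cell acts by zero away from its target. *)
Section TotalModule.
Variables (P : infcat) (K : P 0%N -> zmodType).
Variable res : forall a b : P 0%N, hom1 a b -> {additive K b -> K a}.
Hypothesis res_id : forall a m, res (hom1_id a) m = m.
Hypothesis res_comp : forall a b c (v : hom1 b c) (u : hom1 a b) m,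
  res (hom1_comp v u) m = res u (res v m).
Hypothesis res_two_cell : forall a b (u v : hom1 a b), two_cell u v ->
  forall m, res u m = res v m.

Definition total_fam (a : {classic P 0%N}) : zmodType := K (a : P 0%N).
Definition total : zmodType := dirsum total_fam.

Definition tinj (a : P 0%N) : K a -> total := @ds_inj _ total_fam (a : {classic P 0%N}).
Lemma tinj_additive a : zmod_morphism (@tinj a).
Proof. exact: (@ds_inj_additive _ total_fam (a : {classic P 0%N})). Qed.
HB.instance Definition _ a := GRing.isZmodMorphism.Build (K a) total (@tinj a) (@tinj_additive a).

Definition tval (a : P 0%N) (t : total) : K a := ds_val t (a : {classic P 0%N}).
Lemma tval_additive a : zmod_morphism (tval a). Proof. by []. Qed.
HB.instance Definition _ a := GRing.isZmodMorphism.Build total (K a) (tval a) (tval_additive a).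

Lemma tvalK a (m : K a) : tval a (tinj m) = m.
Proof. exact: (@ds_inj_funE _ total_fam (a : {classic P 0%N})). Qed.

Lemma tval_off a b (m : K a) : a <> b -> tval b (tinj m) = 0.
Proof. by move=> ab; apply: (@ds_inj_fun0 _ total_fam (a : {classic P 0%N})). Qed.

Lemma total_eq (t t' : total) : (forall a, tval a t = tval a t') -> t = t'.
Proof. by move=> tt; apply: dirsum_eq => a; apply: tt. Qed.

Lemma total_ext (A : zmodType) (g h : {additive total -> A}) :
  (forall a (m : K a), g (tinj m) = h (tinj m)) -> forall t, g t = h t.
Proof. by move=> gh; apply: ds_ext. Qed.

Definition total_act_at (u : P 1%N) (b : P 0%N) : {additive K b -> total} :=
  match pselect (trg0 u = b) with
  | left e => @tinj (src0 u) \o res (Hom1 u erefl e)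
  | right _ => \0
  end.

Definition total_act (u : P 1%N) : {additive total -> total} :=
  @ds_lift _ total_fam total (fun b => total_act_at u (b : P 0%N)).

Lemma total_act_inj a b (u : hom1 a b) (m : K b) : total_act u (tinj m) = tinj (res u m).
Proof.
rewrite /total_act [LHS](@ds_lift_inj _ total_fam) /total_act_at.
case: pselect => [e|]; last by rewrite h1_trg.
case: u e => u s t e /=; subst a; congr tinj.
by rewrite (Prop_irrelevance e t).
Qed.

Lemma total_act_off (u : P 1%N) b (m : K b) : trg0 u <> b -> total_act u (tinj m) = 0.
Proof.
move=> ne; rewrite /total_act [LHS](@ds_lift_inj _ total_fam) /total_act_at.
by case: pselect.
Qed.

Lemma total_act_comp v u (e : trg (ltnW (ltn0Sn 0)) u = src (ltnW (ltn0Sn 0)) v) t :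
  total_act (comp (ltn0Sn 0) v u e) t = total_act u (total_act v t).
Proof.
have e' : trg0 u = src0 v.
  by rewrite (trg_congr (leq0n 1) (ltnW (ltn0Sn 0)) erefl) e; apply: src_congr.
pose v1 := Hom1 v erefl erefl; pose u1 := Hom1 u erefl e'.
have E : (hom1_comp v1 u1 : P 1%N) = comp (ltn0Sn 0) v u e by apply: comp_congr.
apply: (total_ext (g := total_act _) (h := total_act u \o total_act v)) => b m.
rewrite -[RHS]/(total_act u (total_act v (tinj m))).
have [eb|nb] := pselect (trg0 v = b); last first.
  rewrite (total_act_off _ nb) raddf0 total_act_off //.
  by rewrite -E h1_trg.
subst b; rewrite -E total_act_inj res_comp.
by rewrite -[v in RHS]/(v1 : P 1%N) total_act_inj -[u in RHS]/(u1 : P 1%N) total_act_inj.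
Qed.

Lemma total_act_two_cell (al : P 2%N) t :
  total_act (src (leqnSn 1) al) t = total_act (trg (leqnSn 1) al) t.
Proof.
set u := src _ al; set v := trg _ al.
have su : src0 v = src0 u by rewrite (src_trgW _ _ (leq0n 2)) // (src_src _ _ (leq0n 2)).
have tu : trg0 v = trg0 u by rewrite (trg_trg _ _ (leq0n 2)) (trg_srcW _ _ (leq0n 2)).
pose u1 := Hom1 u erefl erefl; pose v1 := Hom1 v su tu.
apply: (total_ext (g := total_act u) (h := total_act v)) => b m.
have [eb|nb] := pselect (trg0 u = b); last by rewrite !total_act_off // tu.
subst b; rewrite -[u]/(u1 : P 1%N) -[v]/(v1 : P 1%N) !total_act_inj.
by congr tinj; apply: res_two_cell; exists al.
Qed.

Definition total_module : cmodule P := CModule total_act_comp total_act_two_cell.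

Lemma tval_act a b (u : hom1 a b) t : tval a (total_act u t) = res u (tval b t).
Proof.
apply: (total_ext (g := tval a \o total_act u) (h := res u \o tval b)) => c m.
rewrite -[LHS]/(tval a (total_act u (tinj m))) -[RHS]/(res u (tval b (tinj m))).
have [eb|nb] := pselect (b = c).
  by subst c; rewrite total_act_inj !tvalK.
rewrite total_act_off ?h1_trg // raddf0 tval_off ?raddf0 //.
by move=> cb; apply: nb.
Qed.

Lemma tval_act_off a (u : P 1%N) t : src0 u <> a -> tval a (total_act u t) = 0.
Proof.
move=> ne; apply: (total_ext (g := tval a \o total_act u) (h := \0)) => c m.
rewrite -[LHS]/(tval a (total_act u (tinj m))) -[RHS]/(0 : K a).
have [e|nc] := pselect (trg0 u = c); last by rewrite total_act_off ?raddf0.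
by rewrite -[u]/(Hom1 u erefl e : P 1%N) total_act_inj tval_off.
Qed.

Lemma tval_mid a t : tval a (mid total_module a t) = tval a t.
Proof. by rewrite -[RHS]res_id -tval_act. Qed.

Lemma mid_tinj a (m : K a) : mid total_module a (tinj m) = tinj m.
Proof. by rewrite -[in RHS](res_id m) -total_act_inj. Qed.

End TotalModule.

Section TotalMap.
Variables (P : infcat) (K K' : P 0%N -> zmodType) (f : forall a, {additive K a -> K' a}).

Definition total_map : {additive total K -> total K'} :=
  @ds_lift _ (total_fam K) (total K')
    (fun a => @tinj P K' (a : P 0%N) \o f (a : P 0%N)).

Lemma total_map_inj a (m : K a) : total_map (tinj m) = tinj (f a m).
Proof. exact: (@ds_lift_inj _ (total_fam K)). Qed.

Lemma tval_map a t : tval a (total_map t) = f a (tval a t).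
Proof.
apply: (total_ext (g := tval a \o total_map) (h := f a \o tval a)) => c m.
rewrite -[LHS]/(tval a (total_map (tinj m))) -[RHS]/(f a (tval a (tinj m))) total_map_inj.
have [e|ne] := pselect (c = a); first by subst c; rewrite !tvalK.
by rewrite !tval_off // raddf0.
Qed.

End TotalMap.

(** Chains are presented by generators and relations, so an additive map out of them is a
    function on generators compatible with composites. *)
Section ChainLift.
Variables (X : infcat) (M : local_system X) (n : nat) (A : zmodType).
Variable phi : forall (x : X n) (a : X 0%N), trg0 x = a -> M a -> A.
Hypothesis phi_add : forall x a e, zmod_morphism (@phi x a e).
Hypothesis phi_comp0 : forall (h : (0 < n)%N) (x1 x0 : X n) c (a b : X 0%N)
  (e10 : trg0 (comp h x1 x0 c) = a) (e1 : trg0 x1 = a) (e0 : trg0 x0 = b)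
  (u : hom1 b a) (m : M a), (u : X 1%N) = trg h x1 ->
  phi e10 m = phi e1 m + phi e0 (ls_res M u m).
Hypothesis phi_compS : forall i (h : (i.+1 < n)%N) (x1 x0 : X n) c (a : X 0%N)
  (e10 : trg0 (comp h x1 x0 c) = a) (e1 : trg0 x1 = a) (e0 : trg0 x0 = a) (m : M a),
  phi e10 m = phi e1 m + phi e0 m.

Definition chain_pre : {additive prechain M n -> A} :=
  pre_ext (fun x => mk_additive (phi_add (erefl (trg0 x)))).

Lemma chain_pre_gen x a (e : trg0 x = a) m : chain_pre (pregen e m) = phi e m.
Proof. by rewrite /chain_pre pre_ext_gen; subst a. Qed.

Lemma chain_pre_rel (z z' : prechain M n) : chain_rel z z' -> chain_pre z = chain_pre z'.
Proof.
case=> [h x1 x0 c a b e10 e1 e0 u m hu|[|i] // _ h x1 x0 c a e10 e1 e0 m].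
  by rewrite raddfD /= !chain_pre_gen; apply: phi_comp0.
by rewrite raddfD /= !chain_pre_gen; apply: phi_compS.
Qed.

Definition chain_lift : {additive chain M n -> A} := aq_lift chain_pre_rel.

Lemma chain_lift_gen x a (e : trg0 x = a) m : chain_lift (gen e m) = phi e m.
Proof. exact: (etrans (aq_lift_pi chain_pre_rel _) (chain_pre_gen e m)). Qed.

End ChainLift.

Lemma ls_res_congr (X : infcat) (M : local_system X) (a b : X 0%N) (u v : hom1 a b) m :
  (u : X 1%N) = v -> ls_res M u m = ls_res M v m.
Proof. by move=> uv; rewrite (hom1_eq uv). Qed.

(** Chains are functorial in the infinity-category and in the coefficients. *)
Section Push.
Variables (Q Q' : infcat) (L : local_system Q) (L' : local_system Q') (g : functor Q Q').
Variable theta : forall a, {additive L a -> L' (fap g a)}.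
Hypothesis theta_nat : forall a b (u : hom1 a b) m,
  theta a (ls_res L u m) = ls_res L' (map_hom1 g u) (theta b m).

Definition chain_push_phi n (x : Q n) a (e : trg0 x = a) (m : L a) : chain L' n :=
  gen (fap_trg0 g e) (theta a m).

Lemma chain_push_add n (x : Q n) a (e : trg0 x = a) : zmod_morphism (chain_push_phi e).
Proof. by move=> m m'; rewrite /chain_push_phi !raddfB. Qed.

Lemma chain_push_comp0 n (h : (0 < n)%N) (x1 x0 : Q n) c (a b : Q 0%N)
  (e10 : trg0 (comp h x1 x0 c) = a) (e1 : trg0 x1 = a) (e0 : trg0 x0 = b)
  (u : hom1 b a) (m : L a) : (u : Q 1%N) = trg h x1 ->
  chain_push_phi e10 m = chain_push_phi e1 m + chain_push_phi e0 (ls_res L u m).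
Proof.
move=> hu; rewrite /chain_push_phi theta_nat.
have c' := fap_composable g c; have cE := fap_comp c c'.
move: (fap_trg0 g e10); rewrite cE => e10'.
by apply: gen_comp0; rewrite /= hu fap_trg.
Qed.

Lemma chain_push_compS n i (h : (i.+1 < n)%N) (x1 x0 : Q n) c (a : Q 0%N)
  (e10 : trg0 (comp h x1 x0 c) = a) (e1 : trg0 x1 = a) (e0 : trg0 x0 = a) (m : L a) :
  chain_push_phi e10 m = chain_push_phi e1 m + chain_push_phi e0 m.
Proof.
rewrite /chain_push_phi; have c' := fap_composable g c; have cE := fap_comp c c'.
by move: (fap_trg0 g e10); rewrite cE => e10'; apply: gen_compS.
Qed.

Definition chain_push n : {additive chain L n -> chain L' n} :=
  chain_lift (@chain_push_add n) (@chain_push_comp0 n) (@chain_push_compS n).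

Lemma chain_push_gen n (x : Q n) a (e : trg0 x = a) (m : L a) :
  chain_push n (gen e m) = gen (fap_trg0 g e) (theta a m).
Proof. exact: chain_lift_gen. Qed.

Lemma chain_push_diff n z : chain_push n (chain_diff L n z) = chain_diff L' n (chain_push n.+1 z).
Proof.
apply: (@chain_ext _ _ _ _ (chain_push n \o chain_diff L n) (chain_diff L' n \o chain_push n.+1)) => x a e m.
rewrite -[LHS]/(chain_push n (chain_diff L n (gen e m))).
rewrite -[RHS]/(chain_diff L' n (chain_push n.+1 (gen e m))) chain_push_gen !chain_diff_gen.
case: n x e {z} => [|n] x e.
  pose u := Hom1 x erefl e.
  have e1 : trg0 (trg0 x) = a by rewrite trg_id.
  have e0 : trg0 (src0 x) = src0 x by rewrite trg_id.
  have f1 : trg0 (trg0 (fap g x)) = fap g a by rewrite trg_id -fap_trg e.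
  have f0 : trg0 (src0 (fap g x)) = fap g (src0 x) by rewrite trg_id -fap_src.
  rewrite (@diff_gen0 _ L x a _ e u e1 e0) // raddfB !chain_push_gen theta_nat.
  rewrite (@diff_gen0 _ L' (fap g x) _ _ (fap_trg0 g e) (map_hom1 g u) f1 f0) //.
  by congr (_ - _); apply: gen_congr; rewrite ?fap_trg ?fap_src.
have e1 : trg0 (trg (leqnSn n.+1) x) = a by rewrite trg0_trg.
have e0 : trg0 (src (leqnSn n.+1) x) = a by rewrite trg0_src.
have f1 : trg0 (trg (leqnSn n.+1) (fap g x)) = fap g a by rewrite -fap_trg -fap_trg e1.
have f0 : trg0 (src (leqnSn n.+1) (fap g x)) = fap g a by rewrite -fap_src -fap_trg e0.
rewrite (@diff_genS _ L _ _ _ e e1 e0) raddfB !chain_push_gen.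
rewrite (@diff_genS _ L' _ _ _ (fap_trg0 g e) f1 f0).
by congr (_ - _); apply: gen_congr; rewrite ?fap_trg ?fap_src.
Qed.

End Push.

(** * The presheaf of chain complexes of the slices *)

(** The category [C] with an initial object [None] added: the chains of [P] itself become
    the value at [None] of the presheaf of the chains of the slices. *)
Section Plus.
Variable C : category.

Definition plus_hom (x y : option C) : Type :=
  match x, y with
  | None, _ => unit
  | Some a, Some b => hom a b
  | Some _, None => Empty_set
  end.

Definition plus_id (x : option C) : plus_hom x x :=
  match x with Some a => cid a | None => tt end.

Definition plus_comp (x y z : option C) : plus_hom y z -> plus_hom x y -> plus_hom x z :=
  match x, y, z return plus_hom y z -> plus_hom x y -> plus_hom x z with
  | None, _, _ => fun _ _ => tt
  | Some a, Some b, Some c => fun g f => ccomp (g : hom b c) f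
  | Some _, Some _, None => fun g _ => g
  | Some _, None, _ => fun _ f => match f with end
  end.

Program Definition plus : category := @Category (option C) plus_hom plus_id plus_comp _ _ _.
Next Obligation.
move: a b f => [a|] [b|] //= f; [exact: ccomp_idl|by case: f|by case: f].
Qed.
Next Obligation. move: a b f => [a|] [b|] //= f; [exact: ccomp_idr|by case: f|by case: f]. Qed.
Next Obligation. by move: a b c d h g f => [a|] [b|] [c|] [d|] //= h g f; apply: ccompA. Qed.

End Plus.

(** Slices are contravariant in the object: precomposition with [f : a -> b] sends the slice under
    [b] to the slice under [a]. *)
Section UnderPre.
Variables (C : category) (a b : C) (f : hom a b).

Definition under_pre_ob (o : under_ob b) : under_ob a := UnderOb (ccomp (u_mor o) f).

Lemma under_pre_tri (o o' : under_ob b) (h : under_hom o o') :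
  ccomp (u_hom h) (u_mor (under_pre_ob o)) = u_mor (under_pre_ob o').
Proof. by rewrite /= ccompA u_tri. Qed.

Program Definition under_pre : cfunctor (under b) (under a) :=
  @CFunctor (under b) (under a) under_pre_ob
    (fun o o' h => @UnderHom C a (under_pre_ob o) (under_pre_ob o') (u_hom h) (under_pre_tri h)) _ _.
Next Obligation. exact: under_hom_eq. Qed.
Next Obligation. exact: under_hom_eq. Qed.

Lemma under_pre_over :
  fcomp (ofcat_map (under_forget a)) (ofcat_map under_pre) = ofcat_map (under_forget b).
Proof. by apply: functor_eq => -[|n] x. Qed.

End UnderPre.

Section SlicePre.
Variables (C : category) (P : infcat) (r : functor P (ofcat C)).
Local Notation q x := (ofcat_map (under_forget x)).

Definition slice_proj (x : C) : functor (slice r x) P := fp_fst r (q x).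

Section Along.
Variables (a b : C) (f : hom a b).

Lemma slice_pre_eq : fcomp r (slice_proj b) =
  fcomp (q a) (fcomp (ofcat_map (under_pre f)) (fp_snd r (q b))).
Proof. by rewrite fcompA under_pre_over; apply: fp_comm. Qed.

Definition slice_pre : functor (slice r b) (slice r a) := fp_pair slice_pre_eq.

End Along.

Lemma slice_pre_ob (a b : C) (f : hom a b) n (c : slice r b n) :
  src0 (fpr (fap (slice_pre f) c)) = under_pre_ob f (src0 (fpr c)).
Proof. by rewrite -[LHS]/(src0 (fap (ofcat_map (under_pre f)) (fpr c))) -fap_src. Qed.

Variable N : local_system P.

Definition slice_system (x : C) : local_system (slice r x) := pullback (slice_proj x) N.

Lemma pre_nat (a b : C) (f : hom a b) (o o' : slice r b 0%N) (u : hom1 o o') m :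
  ls_res (slice_system b) u m = ls_res (slice_system a) (map_hom1 (slice_pre f) u) m.
Proof.
exact: (@ls_res_congr P N (fpl o) (fpl o') (map_hom1 (slice_proj b) u)
  (map_hom1 (slice_proj a) (map_hom1 (slice_pre f) u)) m erefl).
Qed.

Lemma proj_nat (a : C) (o o' : slice r a 0%N) (u : hom1 o o') m :
  ls_res (slice_system a) u m = ls_res N (map_hom1 (slice_proj a) u) m.
Proof. by []. Qed.

Definition push_pre (a b : C) (f : hom a b) n :
    {additive chain (slice_system b) n -> chain (slice_system a) n} :=
  @chain_push _ _ (slice_system b) (slice_system a) (slice_pre f) (fun o => idfun) (@pre_nat a b f) n.

Definition push_proj (a : C) n : {additive chain (slice_system a) n -> chain N n} :=
  @chain_push _ _ (slice_system a) N (slice_proj a) (fun o => idfun) (@proj_nat a) n.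

Lemma push_pre_gen (a b : C) (f : hom a b) n (x : slice r b n) o (e : trg0 x = o)
    (m : slice_system b o) :
  push_pre f n (gen e m) =
  gen (M := slice_system a) (fap_trg0 (slice_pre f) e) (m : slice_system a (fap (slice_pre f) o)).
Proof. exact: chain_push_gen. Qed.

Lemma push_proj_gen (a : C) n (x : slice r a n) o (e : trg0 x = o) (m : slice_system a o) :
  push_proj a n (gen e m) =
  gen (M := N) (fap_trg0 (slice_proj a) e) (m : N (fpl o)).
Proof. exact: chain_push_gen. Qed.

Definition slice_chain n (x : plus C) : zmodType :=
  match x with Some a => chain (slice_system a) n | None => chain N n end.

Definition slice_res n (x y : plus C) : hom x y -> {additive slice_chain n y -> slice_chain n x} :=
  match x, y return plus_hom x y -> {additive slice_chain n y -> slice_chain n x} with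
  | None, None => fun _ => idfun
  | None, Some b => fun _ => push_proj b n
  | Some a, Some b => fun f => push_pre f n
  | Some a, None => fun f => match f with end
  end.

Lemma slice_gen_eq (a : C) n (x y : slice r a n) o o' (e : trg0 x = o) (e' : trg0 y = o')
    (m : N (fpl o)) (m' : N (fpl o')) :
  fpl x = fpl y -> src0 (fpr x) = src0 (fpr y) ->
  (forall k : fpl o = fpl o', eq_rect _ (fun b => N b) m _ k = m') ->
  gen (M := slice_system a) e m = gen (M := slice_system a) e' m'.
Proof.
move=> xy oxy mm; have E : x = y by apply: slice_eq.
by subst y o o'; rewrite -(mm erefl).
Qed.

Lemma slice_res_id n (x : plus C) m : @slice_res n x x (cid x) m = m.
Proof.
case: x m => [a|] m //.
apply: (chain_ext (g := @slice_res n (Some a) (Some a) (@cid (plus C) (Some a))) (h := idfun)).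
move=> c o e k; rewrite [LHS]push_pre_gen; apply: slice_gen_eq => //.
  rewrite slice_pre_ob; case: (src0 _) => ? ?; rewrite /under_pre_ob /=.
  by rewrite ccomp_idr.
by move=> e'; rewrite (Prop_irrelevance e' erefl).
Qed.

Lemma slice_res_comp n (x y z : plus C) (g : hom y z) (f : hom x y) m :
  slice_res n (ccomp g f) m = slice_res n f (slice_res n g m).
Proof.
move: x y z g f m => [a|] [b|] [c|] g f m;
  [|by case: g|by case: f|by case: f| |by case: g|by rewrite /slice_res|by rewrite /slice_res].
- apply: (chain_ext (g := push_pre _ n) (h := push_pre f n \o push_pre g n)) => k o e l.
  rewrite -[RHS]/(push_pre f n (push_pre g n (gen e l))) !push_pre_gen.
  apply: slice_gen_eq => //; last by move=> e'; rewrite (Prop_irrelevance e' erefl).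
  by rewrite !slice_pre_ob /under_pre_ob /= ccompA.
- apply: (chain_ext (g := push_proj _ n) (h := push_proj b n \o push_pre g n)) => k o e l.
  rewrite -[RHS]/(push_proj b n (push_pre g n (gen e l))) push_pre_gen !push_proj_gen.
  exact: gen_congr.
Qed.

Definition slice_presheaf n : presheaf (plus C) :=
  Presheaf (@slice_res_id n) (@slice_res_comp n).

Definition slice_diff n (x : plus C) : {additive slice_presheaf n.+1 x -> slice_presheaf n x} :=
  match x with Some a => chain_diff (slice_system a) n | None => chain_diff N n end.

Lemma slice_diff_nat n (x y : plus C) (f : hom x y) m :
  slice_diff n x (psh_res (slice_presheaf n.+1) f m) =
  psh_res (slice_presheaf n) f (slice_diff n y m).
Proof.
move: x y f m => [a|] [b|] f m; [|by case: f| |by []].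
- exact: (esym (chain_push_diff _ _)).
- exact: (esym (chain_push_diff _ _)).
Qed.

Lemma slice_diff_diff n (x : plus C) m : slice_diff n x (slice_diff n.+1 x m) = 0.
Proof. by case: x m => [a|] m; apply: chain_diff_diff. Qed.

Definition slice_complex : pcomplex (plus C) := PComplex slice_diff_nat slice_diff_diff.

End SlicePre.

(** * The chains of the slices of a polygraph are relatively projective *)

Section HomOf.
Variable C : category.
Local Notation oC := (ofcat C).

(** The ends of a 1-cell of [ofcat C] are prescribed up to equality only, hence the cast. *)
Definition hom_of (a b : oC 0%N) (u : hom1 a b) : hom a b :=
  mor_cast (w := (u : oC 1%N)) (h1_src u) (h1_trg u).

Lemma hom_of_congr (a b : oC 0%N) (u v : hom1 a b) :
  (u : oC 1%N) = v -> hom_of u = hom_of v.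
Proof. exact: mor_cast_congr. Qed.

Lemma hom_of_id (a : oC 0%N) : hom_of (hom1_id a) = cid a.
Proof. exact: (@mor_cast_congr C (Arrow (cid a)) (Arrow (cid a)) a a _ _ erefl erefl). Qed.

Lemma hom_of_comp (a b c : oC 0%N) (v : hom1 b c) (u : hom1 a b) :
  hom_of (hom1_comp v u) = ccomp (hom_of v) (hom_of u).
Proof.
apply: arrow_inj; rewrite mor_castK.
case: v u => [[b' c' g] sv tv] [[a' b'' f] su tu]; rewrite /hom_of /=.
set A := Arrow (ccomp _ _); suff E k : @acomp C (Arrow g) (Arrow f) k = A by apply: E.
rewrite {}/A; move: sv tv su tu k => /= sv tv su tu k; subst.
by rewrite /acomp /= (Prop_irrelevance k erefl).
Qed.

Lemma hom_of_two_cell (a b : oC 0%N) (u v : hom1 a b) : two_cell u v -> hom_of u = hom_of v.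
Proof. by case=> al [su tv]; apply: hom_of_congr; rewrite -su -tv. Qed.

Lemma under_ob_eq (x : C) (o o' : under_ob x) (e : u_ob o = u_ob o') :
  eq_rect _ (hom x) (u_mor o) _ e = u_mor o' -> o = o'.
Proof. by case: o o' e => a u [b v] /= e; subst b => /= ->. Qed.

Lemma push_hom_of (x : C) n (h : (0 < n)%N) (w : oC n) (o : under_ob x) (e : u_ob o = src0 w)
    (a b : oC 0%N) (U : hom1 a b) (ea : u_ob o = a) (eb : u_ob (push e) = b) :
  (U : oC 1%N) = trg h w ->
  eq_rect _ (hom x) (u_mor (push e)) _ eb =
  ccomp (hom_of U) (eq_rect _ (hom x) (u_mor o) _ ea).
Proof.
case: n h w e eb => [|n] // h w e eb Uw; case: o e ea eb => c v /= e ea eb.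
case: U Uw => [[c' d f] sU tU] /= Uw; subst w.
move: sU tU e ea eb => /= sU tU e ea eb; subst c a b.
by rewrite (Prop_irrelevance ea erefl) (Prop_irrelevance eb erefl).
Qed.

End HomOf.

Section PresheafModule.
Variables (C : category) (P : infcat) (r : functor P (ofcat C)) (F : presheaf (plus C)).

(** A presheaf on the base acts on the cells of [P] through its values at the images of their
    ends. *)
Definition psh_fam (a : P 0%N) : zmodType := F (Some (fap r a : C)).

Definition psh_act (a b : P 0%N) (u : hom1 a b) : {additive psh_fam b -> psh_fam a} :=
  @psh_res _ F (Some (fap r a : C)) (Some (fap r b : C)) (hom_of (map_hom1 r u)).

Lemma psh_act_id (a : P 0%N) m : psh_act (hom1_id a) m = m.
Proof. by rewrite /psh_act map_hom1_id hom_of_id; apply: (@psh_id _ F). Qed.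

Lemma psh_act_comp (a b c : P 0%N) (v : hom1 b c) (u : hom1 a b) m :
  psh_act (hom1_comp v u) m = psh_act u (psh_act v m).
Proof. by rewrite /psh_act map_hom1_comp hom_of_comp -psh_comp. Qed.

Lemma psh_act_two_cell (a b : P 0%N) (u v : hom1 a b) : two_cell u v ->
  forall m, psh_act u m = psh_act v m.
Proof. by move=> uv m; rewrite /psh_act (hom_of_two_cell (map_two_cell r uv)). Qed.

Definition psh_module : cmodule P := total_module psh_act_comp psh_act_two_cell.

End PresheafModule.

Section UniversalDerivation.
Variables (C : category) (P : infcat) (r : functor P (ofcat C)) (N : local_system P).
Local Notation D n := (slice_presheaf r N n).
Local Notation oC := (ofcat C).

Definition ls_module : cmodule P := total_module (@ls_res_comp _ N) (@ls_res_two_cell _ N).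
Local Notation T := ls_module.

Definition dgen n (x : C) (c : P n) (o : under_ob x) (e : u_ob o = src0 (fap r c)) (t : T) :
    D n (Some x) :=
  gen (M := slice_system r N x) (erefl (trg0 (scell e))) (tval (trg0 c) t : N (trg0 c)).

Lemma dgen_add n (x : C) (c : P n) (o : under_ob x) (e : u_ob o = src0 (fap r c)) :
  zmod_morphism (dgen e).
Proof. by move=> t t'; rewrite /dgen !raddfB. Qed.

Lemma tval_cast (a b : P 0%N) (k : a = b) (t : T) :
  eq_rect _ (fun b => N b) (tval a t) _ k = tval b t.
Proof. by case: _ / k. Qed.

Lemma dgen_gen n (x : C) (y : slice r x n) w (ew : trg0 y = w) (t : T)
    (c : P n) (o : under_ob x) (e : u_ob o = src0 (fap r c)) :
  fpl y = c -> src0 (fpr y) = o ->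
  gen (M := slice_system r N x) ew (tval (fpl w) t : N (fpl w)) = dgen e t.
Proof.
move=> yc yo; apply: slice_gen_eq => //; first by rewrite yo; apply/esym/src0_olift.
by move=> k; apply: tval_cast.
Qed.

Lemma dgen_congr n (x : C) (c c' : P n) (o o' : under_ob x) e e' t :
  c = c' -> o = o' -> @dgen n x c o e t = @dgen n x c' o' e' t.
Proof. by move=> ? ?; subst; rewrite (Prop_irrelevance e e'). Qed.

Lemma dgen_pre n (x y : C) (f : hom x y) (c : P n) (o : under_ob y) e e' t :
  push_pre r N f n (@dgen n y c o e t) = @dgen n x c (under_pre_ob f o) e' t.
Proof.
rewrite /dgen push_pre_gen; apply: dgen_gen => //.
by rewrite slice_pre_ob; congr under_pre_ob; apply: src0_olift.
Qed.

Lemma dgen_comp0 n (x : C) (h : (0 < n)%N) (c1 c0 : P n) k (o : under_ob x) e e0 e1 t :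
  @dgen n x (comp h c1 c0 k) o e t =
  @dgen n x c1 (@push _ _ _ (fap r c0) o e0) e1 t + @dgen n x c0 o e0 (kact T h c1 t).
Proof.
have k' : trg (ltnW h) (scell e0) = src (ltnW h) (scell e1) by apply: scell_composable0.
have E := comp0_scell k' e.
have w : trg0 (comp h (scell e1) (scell e0) k') = trg0 (scell e1) by apply: trg0_compW.
rewrite -(@dgen_gen _ _ _ _ w t) ?E //; last exact: src0_olift.
have s : src0 (trg h (scell e1)) = trg0 (scell e0).
  rewrite (src_trgW _ _ (leq0n n)) // (src_congr (leq0n n) (ltnW h) erefl) -k'.
  exact: trg_congr.
have tt' : trg0 (trg h (scell e1)) = trg0 (scell e1) by apply: trg_trg.
pose u : hom1 (trg0 (scell e0)) (trg0 (scell e1)) := Hom1 (trg h (scell e1)) s tt'.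
rewrite (gen_comp0 (M := slice_system r N x) w erefl (erefl (trg0 (scell e0))) (u := u)) //.
congr (_ + gen _ _).
pose v : hom1 (trg0 c0) (trg0 c1) := map_hom1 (slice_proj r x) u.
exact: (esym (tval_act (@ls_res P N) v t)).
Qed.

Lemma dgen_compS n (x : C) i (h : (i.+1 < n)%N) (c1 c0 : P n) k (o : under_ob x) e e0 e1 t :
  @dgen n x (comp h c1 c0 k) o e t = @dgen n x c1 o e1 t + @dgen n x c0 o e0 t.
Proof.
have k' : trg (ltnW h) (scell e0) = src (ltnW h) (scell e1) by apply: scell_composableS.
have E := compS_scell k' e.
have w1 : trg0 (comp h (scell e1) (scell e0) k') = trg0 (scell e1) by apply: trg0_compW.
have w0 : trg0 (scell e0) = trg0 (scell e1) by apply: (trg0_compS k').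
have d0 := esym (dgen_gen w0 t e0 erefl (src0_olift e0)).
have d10 : dgen e t =
    gen (M := slice_system r N x) w1 (tval (fpl (trg0 (scell e1))) t : N (trg0 c1)).
  by apply/esym/dgen_gen; rewrite E //; apply: src0_olift.
by rewrite d10 d0 (gen_compS (M := slice_system r N x) (ltn0Sn i) w1 erefl w0).
Qed.

Lemma src0_fap n (c : P n) : fap r (src0 c) = src0 (fap r c).
Proof. exact: fap_src. Qed.

Definition unit_ob (x : C) : under_ob x := UnderOb (cid x).

(** The universal derivation, sending a cell to itself seen in the slice under its own
    source. *)
Definition udelta n (c : P n) (t : T) : psh_module r (D n) :=
  @tinj P (psh_fam r (D n)) (src0 c) (dgen (o := unit_ob (fap r (src0 c))) (src0_fap c) t).

Lemma udeltaE n (c : P n) (a : P 0%N) (e : u_ob (unit_ob (fap r a)) = src0 (fap r c)) t :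
  src0 c = a -> udelta c t = @tinj P (psh_fam r (D n)) a (dgen e t).
Proof. by move=> ea; subst a; rewrite /udelta (Prop_irrelevance e (src0_fap c)). Qed.

Lemma udelta_derivation n : derivation (@udelta n).
Proof.
split=> [c t t'|c t|c t|h x1 x0 k t|i h x1 x0 k t].
- by rewrite /udelta dgen_add raddfB.
- by rewrite /udelta /dgen (tval_mid (@ls_res_id P N)).
- exact: (mid_tinj (@psh_act_id _ _ r (D n))).
- have s10 : src0 (comp h x1 x0 k) = src0 x0 by apply: src0_compW.
  have e10 : u_ob (unit_ob (fap r (src0 x0))) = src0 (fap r (comp h x1 x0 k)).
    by rewrite -src0_fap s10.
  rewrite (udeltaE e10 t s10).
  have e0 := src0_fap x0 : u_ob (unit_ob (fap r (src0 x0))) = src0 (fap r x0).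
  have kk : trg0 x0 = src0 x1.
    by rewrite (trg_congr (leq0n n) (ltnW h) erefl) k; apply: src_congr.
  have e1 : u_ob (push e0) = src0 (fap r x1) by rewrite u_ob_push -fap_trg kk src0_fap.
  rewrite (dgen_comp0 e10 e1) raddfD; congr (_ + _); last first.
    by rewrite (udeltaE e0).
  have su : src0 (trg h x0) = src0 x0 by rewrite (src_trgW _ _ (leq0n n)).
  have tu : trg0 (trg h x0) = src0 x1 by rewrite (trg_trg _ _ (leq0n n)).
  pose u : hom1 (src0 x0) (src0 x1) := Hom1 (trg h x0) su tu.
  rewrite /kact -[trg h x0]/(u : P 1%N) [RHS]total_act_inj; congr tinj.
  have eb : u_ob (push e0) = fap r (src0 x1) by rewrite e1 -src0_fap.
  have e' : u_ob (under_pre_ob (hom_of (map_hom1 r u)) (unit_ob (fap r (src0 x1)))) =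
    src0 (fap r x1) by apply: src0_fap.
  transitivity (push_pre r N (hom_of (map_hom1 r u)) n
    (dgen (o := unit_ob (fap r (src0 x1))) (src0_fap x1) t)); last by [].
  rewrite (dgen_pre _ e'); apply: dgen_congr => //.
  apply: (@under_ob_eq _ _ (push e0)
    (under_pre_ob (hom_of (map_hom1 r u)) (unit_ob (fap r (src0 x1)))) eb).
  rewrite (@push_hom_of _ _ _ h _ _ _ _ _ (map_hom1 r u) (erefl : u_ob (unit_ob _) = _) eb).
    by rewrite /= ccomp_idl ccomp_idr.
  exact: fap_trg.
- have s10 : src0 (comp h x1 x0 k) = src0 x0 by apply: src0_compW.
  have e10 : u_ob (unit_ob (fap r (src0 x0))) = src0 (fap r (comp h x1 x0 k)).
    by rewrite -src0_fap s10.
  have e0 := src0_fap x0 : u_ob (unit_ob (fap r (src0 x0))) = src0 (fap r x0).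
  have s01 := src0_compS k.
  have e1 : u_ob (unit_ob (fap r (src0 x0))) = src0 (fap r x1) by rewrite -src0_fap s01.
  rewrite (udeltaE e10 t s10) (udeltaE e0 t) // (udeltaE e1 t) //.
  by rewrite (dgen_compS e10 e0 e1) raddfD.
Qed.

End UniversalDerivation.

Section TotalMapAct.
Variables (P : infcat) (K K' : P 0%N -> zmodType).
Variables (res : forall a b : P 0%N, hom1 a b -> {additive K b -> K a}).
Variables (res' : forall a b : P 0%N, hom1 a b -> {additive K' b -> K' a}).
Variable (f : forall a, {additive K a -> K' a}).
Hypothesis f_nat : forall a b (u : hom1 a b) m, f a (res u m) = res' u (f b m).

Lemma total_map_act u t :
  total_map f (total_act res u t) = total_act res' u (total_map f t).
Proof.
apply: total_eq => a; rewrite tval_map.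
have [e|ne] := pselect (src0 u = a); last by rewrite !tval_act_off // raddf0.
by rewrite -[u]/(Hom1 u e erefl : P 1%N) !tval_act f_nat tval_map.
Qed.

End TotalMapAct.

Section Splitting.
Variables (C : category) (P : infcat) (r : functor P (ofcat C)) (N : local_system P).
Local Notation D n := (slice_presheaf r N n).
Local Notation oC := (ofcat C).
Local Notation T := (ls_module N).
Local Notation S := (@Some C : C -> plus C).
Local Notation G n := (cover S (D n)).

Section Degree.
Variable n : nat.
Variable sigma : P n -> T -> psh_module r (G n).
Hypothesis sigma_der : derivation sigma.
Hypothesis sigma_delta : forall c t (a : P 0%N),
  counit S (D n) (Some (fap r a : C)) (tval a (sigma c t)) = tval a (udelta r c t).

Definition ev (x : plus C) (c : P n) (a : P 0%N) (al : hom x (Some (fap r a : C))) (t : T) :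
  G n x := psh_res (G n) al (tval a (sigma c t)).

Lemma ev_add (x : plus C) c (a : P 0%N) (al : hom x (Some (fap r a : C))) : zmod_morphism (ev c al).
Proof.
by move=> t t'; rewrite /ev (der_add sigma_der) !raddfB.
Qed.

Lemma ev_comp0 (x : plus C) (h : (0 < n)%N) (c1 c0 : P n) k (a1 a0 : P 0%N) (u : hom1 a0 a1)
    (al : hom x (Some (fap r a0 : C))) t :
  (u : P 1%N) = trg h c0 ->
  ev (comp h c1 c0 k) al t =
  ev c1 (ccomp (hom_of (map_hom1 r u) : hom (Some (fap r a0 : C) : plus C) (Some (fap r a1 : C))) al) t
  + ev c0 al (kact T h c1 t).
Proof.
move=> uc; rewrite /ev (der_comp0 sigma_der) !raddfD; congr (_ + _).
rewrite psh_comp; congr (psh_res _ _ _).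
by rewrite /kact -uc; apply: tval_act.
Qed.

Lemma ev_compS (x : plus C) i (h : (i.+1 < n)%N) (c1 c0 : P n) k (a : P 0%N)
    (al : hom x (Some (fap r a : C))) t :
  ev (comp h c1 c0 k) al t = ev c1 al t + ev c0 al t.
Proof. by rewrite /ev (der_compS sigma_der) !raddfD. Qed.

Lemma ev_counit (x : plus C) (c : P n) (al : hom x (Some (fap r (src0 c) : C))) t :
  counit S (D n) x (ev c al t) =
  psh_res (D n) al (dgen (o := unit_ob (fap r (src0 c))) (src0_fap r c) t).
Proof. by rewrite /ev counit_nat sigma_delta /udelta tvalK. Qed.

Lemma kact_tinj (h : (0 < n)%N) (c1 : P n) (a b : P 0%N) (u : hom1 b a) (m : N a) :
  (u : P 1%N) = trg h c1 ->
  kact T h c1 (@tinj P N a m) = @tinj P N b (ls_res N u m).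
Proof. by move=> uc; rewrite /kact -uc; apply: total_act_inj. Qed.

(** Splitting over the slice under [x]: the object over the source of a cell is pulled out
    of the cell. *)
Section AtSome.
Variable x : C.

Definition under_mor (o : under_ob x) (a : P 0%N) (e : u_ob o = fap r a) : hom x (fap r a : C) :=
  eq_rect _ (hom x) (u_mor o) _ e.

Lemma under_mor_congr (o o' : under_ob x) (a : P 0%N) e e' : o = o' -> @under_mor o a e = @under_mor o' a e'.
Proof. by move=> ?; subst; rewrite (Prop_irrelevance e e'). Qed.

Lemma source_over (y : slice r x n) (a : P 0%N) : src0 (fpl y) = a -> u_ob (src0 (fpr y)) = fap r a.
Proof. by move=> <-; rewrite slice_src0 fap_src. Qed.

Definition source_mor (y : slice r x n) (a : P 0%N) (e : src0 (fpl y) = a) : hom x (fap r a : C) :=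
  under_mor (source_over e).

Definition some_phi (y : slice r x n) w (_ : trg0 y = w) (m : slice_system r N x w) :
    G n (Some x) :=
  @ev (Some x) (fpl y) (src0 (fpl y)) (source_mor (erefl (src0 (fpl y)))) (@tinj P N (fpl w) m).

Lemma some_phiE (y : slice r x n) w (ew : trg0 y = w) (m : slice_system r N x w) a
    (e : src0 (fpl y) = a) :
  some_phi ew m = @ev (Some x) (fpl y) a (source_mor e) (@tinj P N (fpl w) m).
Proof. by subst a. Qed.

Lemma some_add (y : slice r x n) w (ew : trg0 y = w) : zmod_morphism (some_phi ew).
Proof. by move=> m m'; rewrite /some_phi [tinj _]raddfB ev_add. Qed.

Lemma some_comp0 (h : (0 < n)%N) (y1 y0 : slice r x n) k (a b : slice r x 0%N)
  (e10 : trg0 (comp h y1 y0 k) = a) (e1 : trg0 y1 = a) (e0 : trg0 y0 = b)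
  (u : hom1 b a) (m : slice_system r N x a) : (u : slice r x 1%N) = trg h y1 ->
  some_phi e10 m = some_phi e1 m + some_phi e0 (ls_res (slice_system r N x) u m).
Proof.
move=> hu; pose kl : trg (ltnW h) (fpl y0) = src (ltnW h) (fpl y1) := congr1 (@fpl _ _ _ _ _ _) k.
have s10 : src0 (fpl (comp h y1 y0 k)) = src0 (fpl y0) := src0_compW kl.
rewrite (some_phiE e10 m s10) (some_phiE e0 _ erefl).
have su : src0 (trg h (fpl y0)) = src0 (fpl y0) by rewrite (src_trgW _ _ (leq0n n)).
have tu : trg0 (trg h (fpl y0)) = src0 (fpl y1).
  by rewrite (trg_trg _ _ (leq0n n)) (trg_congr (leq0n n) (ltnW h) erefl) kl; apply: src_congr.
pose v : hom1 (src0 (fpl y0)) (src0 (fpl y1)) := Hom1 (trg h (fpl y0)) su tu.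
have E := @ev_comp0 (Some x) h _ _ kl _ _ v (source_mor (erefl (src0 (fpl y0)))) (@tinj P N (fpl a) m) erefl.
have -> : source_mor s10 = source_mor (erefl (src0 (fpl y0))).
  apply: under_mor_congr; exact: (@src0_compW (ofcat (under x)) _ _ h _ _ (congr1 (@fpr _ _ _ _ _ _) k)).
rewrite -[LHS]/(@ev (Some x) (comp h (fpl y1) (fpl y0) kl) _ (source_mor (erefl (src0 (fpl y0)))) _) {}E.
congr (_ + _); last first.
  congr ev; have hv : (map_hom1 (slice_proj r x) u : P 1%N) = trg h (fpl y1).
    by rewrite /= hu.
  exact: (kact_tinj m hv).
congr ev.
have eo : trg0 (fpr y0) = src0 (fpr y1).
  rewrite (@trg_congr (ofcat (under x)) _ _ (leq0n n) (ltnW h) _ _ erefl).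
  have kr : trg (ltnW h) (fpr y0) = src (ltnW h) (fpr y1) := congr1 (@fpr _ _ _ _ _ _) k.
  by rewrite kr; apply: src_congr.
have e : u_ob (src0 (fpr y0)) = src0 (fap r (fpl y0)) by apply: slice_src0.
have eb : u_ob (push e) = fap r (src0 (fpl y1)).
  by rewrite -(slice_push e erefl) eo; apply: source_over.
have E' := @push_hom_of _ _ _ h _ _ e _ _ (map_hom1 r v) (source_over erefl) eb
  (fap_trg r h (fpl y0)).
apply: (etrans (y := under_mor eb)); first exact: (esym E').
by apply: under_mor_congr; rewrite -(slice_push e erefl).
Qed.

Lemma some_compS i (h : (i.+1 < n)%N) (y1 y0 : slice r x n) k (a : slice r x 0%N)
  (e10 : trg0 (comp h y1 y0 k) = a) (e1 : trg0 y1 = a) (e0 : trg0 y0 = a)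
  (m : slice_system r N x a) : some_phi e10 m = some_phi e1 m + some_phi e0 m.
Proof.
pose kl : trg (ltnW h) (fpl y0) = src (ltnW h) (fpl y1) := congr1 (@fpl _ _ _ _ _ _) k.
pose kr := congr1 (@fpr _ _ _ _ _ _) k.
have s10 : src0 (fpl (comp h y1 y0 k)) = src0 (fpl y0) := src0_compW kl.
have s1 : src0 (fpl y1) = src0 (fpl y0) := esym (src0_compS kl).
rewrite (some_phiE e10 m s10) (some_phiE e0 _ erefl) (some_phiE e1 _ s1).
have -> : source_mor s10 = source_mor (erefl (src0 (fpl y0))).
  by apply: under_mor_congr; apply: (@src0_compW (ofcat (under x)) _ _ h _ _ kr).
have -> : source_mor s1 = source_mor (erefl (src0 (fpl y0))).
  by apply: under_mor_congr; apply/esym/(@src0_compS (ofcat (under x)) _ _ h _ _ kr).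
exact: (@ev_compS (Some x) _ h _ _ kl).
Qed.

Definition some_split : {additive D n (Some x) -> G n (Some x)} :=
  chain_lift some_add some_comp0 some_compS.

Lemma some_split_gen (y : slice r x n) w (ew : trg0 y = w) (m : slice_system r N x w) :
  some_split (gen ew m) = some_phi ew m.
Proof. exact: chain_lift_gen. Qed.

Lemma some_counit z : counit S (D n) (Some x) (some_split z) = z.
Proof.
apply: (@chain_ext _ (slice_system r N x) n _ (counit S (D n) (Some x) \o some_split) idfun).
move=> y w ew m; rewrite -[LHS]/(counit S (D n) (Some x) (some_split (gen ew m))).
rewrite some_split_gen [LHS]ev_counit -[RHS]/(gen ew m).
have e' : u_ob (under_pre_ob (source_mor (erefl (src0 (fpl y)))) (unit_ob (fap r (src0 (fpl y))))) =
  src0 (fap r (fpl y)) := src0_fap r (fpl y).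
apply: (etrans (dgen_pre _ e' _)).
rewrite -(dgen_gen ew _ e' erefl) ?tvalK //.
apply: (@under_ob_eq _ _ _ (under_pre_ob _ (unit_ob (fap r (src0 (fpl y))))) (source_over erefl)).
exact: (esym (ccomp_idl _)).
Qed.

End AtSome.

Lemma source_mor_pre (x x' : C) (f : hom x x') (y : slice r x' n) (a : P 0%N)
    (e : src0 (fpl y) = a) (e' : src0 (fpl (fap (slice_pre r f) y)) = a) :
  source_mor e' = ccomp (source_mor e) f.
Proof.
apply: (etrans (y := @under_mor x (under_pre_ob f (src0 (fpr y))) a (source_over e))).
  by apply: under_mor_congr; apply: slice_pre_ob.
rewrite /source_mor; move: (source_over e); case: (src0 (fpr y)) => b v /= k.
by rewrite /under_mor; case: _ / k.
Qed.

Definition none_phi (c : P n) w (_ : trg0 c = w) (m : N w) : G n None :=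
  @ev None c (src0 c) tt (@tinj P N w m).

Lemma none_add (c : P n) w (ew : trg0 c = w) : zmod_morphism (none_phi ew).
Proof. by move=> m m'; rewrite /none_phi [tinj _]raddfB ev_add. Qed.

Lemma none_phiE (c : P n) w (ew : trg0 c = w) (m : N w) a :
  src0 c = a -> none_phi ew m = @ev None c a tt (@tinj P N w m).
Proof. by move=> e; subst a. Qed.

Lemma none_comp0 (h : (0 < n)%N) (c1 c0 : P n) k (a b : P 0%N)
  (e10 : trg0 (comp h c1 c0 k) = a) (e1 : trg0 c1 = a) (e0 : trg0 c0 = b)
  (u : hom1 b a) (m : N a) : (u : P 1%N) = trg h c1 ->
  none_phi e10 m = none_phi e1 m + none_phi e0 (ls_res N u m).
Proof.
move=> hu; have s10 : src0 (comp h c1 c0 k) = src0 c0 := src0_compW k.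
rewrite (none_phiE e10 m s10) (none_phiE e0 _ erefl).
have su : src0 (trg h c0) = src0 c0 by rewrite (src_trgW _ _ (leq0n n)).
have tu : trg0 (trg h c0) = src0 c1.
  by rewrite (trg_trg _ _ (leq0n n)) (trg_congr (leq0n n) (ltnW h) erefl) k; apply: src_congr.
rewrite (@ev_comp0 None h _ _ k _ _ (Hom1 (trg h c0) su tu)) //; congr (_ + ev _ _ _).
exact: (kact_tinj m hu).
Qed.

Lemma none_compS i (h : (i.+1 < n)%N) (c1 c0 : P n) k (a : P 0%N)
  (e10 : trg0 (comp h c1 c0 k) = a) (e1 : trg0 c1 = a) (e0 : trg0 c0 = a) (m : N a) :
  none_phi e10 m = none_phi e1 m + none_phi e0 m.
Proof.
have s10 : src0 (comp h c1 c0 k) = src0 c0 := src0_compW k.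
have s1 : src0 c1 = src0 c0 := esym (src0_compS k).
by rewrite (none_phiE e10 m s10) (none_phiE e0 _ erefl) (none_phiE e1 _ s1) ev_compS.
Qed.

Definition none_split : {additive D n None -> G n None} :=
  chain_lift none_add none_comp0 none_compS.

Lemma none_split_gen (c : P n) w (ew : trg0 c = w) (m : N w) :
  none_split (gen ew m) = none_phi ew m.
Proof. exact: chain_lift_gen. Qed.

Lemma none_counit z : counit S (D n) None (none_split z) = z.
Proof.
apply: (@chain_ext _ N n _ (counit S (D n) None \o none_split) idfun).
move=> c w ew m; rewrite -[LHS]/(counit S (D n) None (none_split (gen ew m))).
rewrite none_split_gen [LHS]ev_counit -[RHS]/(gen ew m).
subst w; rewrite -[LHS]/(push_proj r N _ n (dgen _ _)) /dgen [LHS]push_proj_gen tvalK.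
exact: gen_congr.
Qed.

Definition slice_split (x : plus C) : {additive D n x -> G n x} :=
  match x with Some a => some_split a | None => none_split end.

Lemma slice_split_nat (x y : plus C) (f : hom x y) m :
  slice_split x (psh_res (D n) f m) = psh_res (G n) f (slice_split y m).
Proof.
move: x y f m => [a|] [b|] f m; [|by case: f| |].
- apply: (@chain_ext _ (slice_system r N b) n _ (some_split a \o push_pre r N f n)
    (psh_res (G n) (f : hom (Some a : plus C) (Some b)) \o some_split b)) => y w ew k.
  rewrite -[LHS]/(some_split a (push_pre r N f n (gen ew k))).
  rewrite -[RHS]/(psh_res (G n) (f : hom (Some a : plus C) (Some b)) (some_split b (gen ew k))).
  rewrite push_pre_gen !some_split_gen.
  rewrite (some_phiE _ _ (erefl : src0 (fpl (fap (slice_pre r f) y)) = src0 (fpl y))).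
  by rewrite (@source_mor_pre a b f y _ erefl) /some_phi /ev -psh_comp.
- apply: (@chain_ext _ (slice_system r N b) n _ (none_split \o push_proj r N b n)
    (psh_res (G n) (f : hom (None : plus C) (Some b)) \o some_split b)) => y w ew k.
  rewrite -[LHS]/(none_split (push_proj r N b n (gen ew k))).
  rewrite -[RHS]/(psh_res (G n) (f : hom (None : plus C) (Some b)) (some_split b (gen ew k))).
  rewrite push_proj_gen none_split_gen some_split_gen.
  by rewrite /some_phi /none_phi /ev -psh_comp.
- by case: f; rewrite [RHS](@psh_id _ (G n) None).
Qed.

End Degree.

(** The counit has an additive section at the level of the total modules, namely the inclusion of
    the summand of the identity; it is not natural, but it suffices to lift the universal
    derivation, and restricting the lift to the slices gives a natural section. *)
Theorem slice_rel_projective n : polygraph P -> rel_projective S (D n).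
Proof.
move=> pol.
pose eps := total_map (fun a => counit S (D n) (Some (fap r a : C)) :
  {additive psh_fam r (G n) a -> psh_fam r (D n) a}).
pose kappa := total_map (fun a => mk_additive (cinj_additive (cid (Some (fap r a : C) : plus C))) :
  {additive psh_fam r (D n) a -> psh_fam r (G n) a}).
have eps_act u t : eps (mact (psh_module r (G n)) u t) = mact (psh_module r (D n)) u (eps t).
  by apply: total_map_act => a b v m; apply: counit_nat.
have kappaK t : eps (kappa t) = t.
  apply: total_eq => a; rewrite !tval_map [LHS]counit_inj.
  exact: (@psh_id _ (D n)).
have [sigma der sd] := derivation_lift (@udelta_derivation _ _ r N n) eps_act kappaK pol.
have sd' c t (a : P 0%N) :
    counit S (D n) (Some (fap r a : C)) (tval a (sigma c t)) = tval a (udelta r c t).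
  by rewrite -sd tval_map.
exists (slice_split der); split; first exact: slice_split_nat.
case=> [x|] m; [exact: some_counit|exact: none_counit].
Qed.

End Splitting.

(** * Homology is detected on slices *)

(** A map of chains over [h] whose coefficients are isomorphisms induces the same map in
    homology as [h], the two systems on the source being isomorphic. *)
Section PushAlongIso.
Variables (Q P : infcat) (h : functor Q P) (L : local_system Q) (K : local_system P).
Variable theta : forall o, {additive L o -> K (fap h o)}.
Variable theta' : forall o, {additive K (fap h o) -> L o}.
Hypothesis thetaK : forall o, cancel (theta o) (theta' o).
Hypothesis theta'K : forall o, cancel (theta' o) (theta o).
Hypothesis theta_nat : forall a b (u : hom1 a b) m,
  theta a (ls_res L u m) = ls_res K (map_hom1 h u) (theta b m).
Let L' := pullback h K.

Let compare_nat (o o' : Q 0%N) (u : hom1 o o') m :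
  theta o (ls_res L u m) = ls_res L' (map_hom1 (fid Q) u) (theta o' m).
Proof.
rewrite theta_nat.
exact: (@ls_res_congr P K (fap h o) (fap h o') (map_hom1 h u) (map_hom1 h (map_hom1 (fid Q) u)) _ erefl).
Qed.

Let compare_nat' (o o' : Q 0%N) (u : hom1 o o') m :
  theta' o (ls_res L' u m) = ls_res L (map_hom1 (fid Q) u) (theta' o' m).
Proof.
rewrite -[m in LHS]theta'K -[ls_res L' u _](theta_nat u) thetaK.
exact: (@ls_res_congr Q L o o' u (map_hom1 (fid Q) u) _ erefl).
Qed.

Let compare n : {additive chain L n -> chain L' n} :=
  @chain_push _ _ L L' (fid Q) theta compare_nat n.
Let compare' n : {additive chain L' n -> chain L n} :=
  @chain_push _ _ L' L (fid Q) theta' compare_nat' n.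

Let compareK n z : compare' n (compare n z) = z.
Proof.
apply: (@chain_ext _ L n _ (compare' n \o compare n) idfun) => y w ew m.
rewrite -[LHS]/(compare' n (compare n (gen ew m))) /compare chain_push_gen.
rewrite /compare' chain_push_gen thetaK; exact: gen_congr.
Qed.

Let push_compare n z : chain_push theta_nat n (compare' n z) = chain_fun h K n z.
Proof.
apply: (@chain_ext _ L' n _ (chain_push theta_nat n \o compare' n) (chain_fun h K n)) => y w ew m.
rewrite -[LHS]/(chain_push theta_nat n (compare' n (gen ew m))) chain_fun_gen.
rewrite /compare' chain_push_gen chain_push_gen theta'K; exact: gen_congr.
Qed.

Lemma chain_push_homology n :
  bijective (homology_map (chain_complex_map h K) (n := n)) ->
  (forall z', z' \in is_cycle (chain_complex K) n ->
    exists z, z \in is_cycle (chain_complex L) n /\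
      exists w, z' = chain_push theta_nat n z + chain_diff K n w) /\
  (forall z, z \in is_cycle (chain_complex L) n ->
    forall w, chain_push theta_nat n z = chain_diff K n w -> exists v, z = chain_diff L n v).
Proof.
move=> /homology_bijE [sur inj]; split.
  move=> z' /sur [z [zc [w ->]]].
  exists (compare' n z); split; last by exists w; rewrite push_compare.
  case: n z zc {z' w sur inj} => [|n] z zc //.
  move: zc; rewrite /in_mem /= => /eqP zc; apply/eqP.
  by rewrite -[LHS](@chain_push_diff _ _ L' L (fid Q) theta' compare_nat' n z) -[RHS](raddf0 (compare' n)); apply: (congr1 (compare' n)).
move=> z zc w zw.
have [||v vz] := inj (compare n z) _ w.
- case: n z zc w zw {sur inj} => [|n] z zc w zw //.
  move: zc; rewrite /in_mem /= => /eqP zc; apply/eqP.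
  by rewrite -[LHS](@chain_push_diff _ _ L L' (fid Q) theta compare_nat n z) -[RHS](raddf0 (compare n)); apply: (congr1 (compare n)).
- by rewrite -zw -push_compare compareK.
by exists (compare' n.+1 v); rewrite -[z]compareK vz; apply: (@chain_push_diff _ _ L' L (fid Q) theta' compare_nat').
Qed.

End PushAlongIso.

Section SlicewiseHomology.
Variables (C : category) (P1 P2 : infcat) (r1 : functor P1 (ofcat C)) (r2 : functor P2 (ofcat C)).
Variables (g : functor P1 P2) (e : fcomp r2 g = r1) (N : local_system P2).
Let N1 := pullback g N.

Lemma slice_map_nat (x : C) (o o' : slice r1 x 0%N) (u : hom1 o o') m :
  ls_res (slice_system r1 N1 x) u m =
  ls_res (slice_system r2 N x) (map_hom1 (slice_map e x) u) m.
Proof.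
exact: (@ls_res_congr P2 N (fap g (fpl o)) (fap g (fpl o'))
  (map_hom1 g (map_hom1 (slice_proj r1 x) u))
  (map_hom1 (slice_proj r2 x) (map_hom1 (slice_map e x) u)) m erefl).
Qed.

Definition slicewise_push (x : C) n :
    {additive chain (slice_system r1 N1 x) n -> chain (slice_system r2 N x) n} :=
  @chain_push _ _ (slice_system r1 N1 x) (slice_system r2 N x) (slice_map e x)
    (fun o => idfun) (@slice_map_nat x) n.

Lemma slicewise_push_gen (x : C) n (y : slice r1 x n) o (ey : trg0 y = o) (m : N (fap g (fpl o))) :
  slicewise_push x n (gen (M := slice_system r1 N1 x) ey m) =
  gen (M := slice_system r2 N x) (fap_trg0 (slice_map e x) ey) m.
Proof. exact: chain_push_gen. Qed.

Definition slicewise n (x : plus C) :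
    {additive slice_complex r1 N1 n x -> slice_complex r2 N n x} :=
  match x with Some a => slicewise_push a n | None => chain_fun g N n end.

Lemma slicewise_nat n (x y : plus C) (f : hom x y) m :
  slicewise n x (psh_res (slice_complex r1 N1 n) f m) =
  psh_res (slice_complex r2 N n) f (slicewise n y m).
Proof.
move: x y f m => [a|] [b|] f m; [|by case: f| |by []].
- apply: (@chain_ext _ (slice_system r1 N1 b) n _ (slicewise_push a n \o push_pre r1 N1 f n)
    (push_pre r2 N f n \o slicewise_push b n)) => y w ew k.
  rewrite -[LHS]/(slicewise_push a n (push_pre r1 N1 f n (gen ew k))).
  rewrite -[RHS]/(push_pre r2 N f n (slicewise_push b n (gen ew k))).
  rewrite push_pre_gen !slicewise_push_gen push_pre_gen.
  apply: slice_gen_eq => // k'.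
  by rewrite (Prop_irrelevance k' erefl).
- apply: (@chain_ext _ (slice_system r1 N1 b) n _ (chain_fun g N n \o push_proj r1 N1 b n)
    (push_proj r2 N b n \o slicewise_push b n)) => y w ew k.
  rewrite -[LHS]/(chain_fun g N n (push_proj r1 N1 b n (gen ew k))).
  rewrite -[RHS]/(push_proj r2 N b n (slicewise_push b n (gen ew k))).
  rewrite push_proj_gen slicewise_push_gen push_proj_gen [LHS]chain_fun_gen.
  exact: gen_congr.
Qed.

Lemma slicewise_d n (x : plus C) m :
  slicewise n x (pd (slice_complex r1 N1) n x m) =
  pd (slice_complex r2 N) n x (slicewise n.+1 x m).
Proof.
case: x m => [a|] m; first exact: chain_push_diff.
exact: chain_fun_diff.
Qed.

Lemma slice_cycleE (P : infcat) (r : functor P (ofcat C)) (L : local_system P) (x : C) n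
    (z : chain (slice_system r L x) n) :
  z \in is_cycle (chain_complex (slice_system r L x)) n <->
  pcycle (z : slice_complex r L n (Some x : plus C)).
Proof.
case: n z => [|n] z; first by split.
by rewrite /in_mem /=; split=> [/eqP|/= h]; [|apply/eqP].
Qed.

Lemma none_cycleE (P : infcat) (r : functor P (ofcat C)) (L : local_system P) n (z : chain L n) :
  z \in is_cycle (chain_complex L) n <-> pcycle (z : slice_complex r L n (None : plus C)).
Proof.
case: n z => [|n] z; first by split.
by rewrite /in_mem /=; split=> [/eqP|/= h]; [|apply/eqP].
Qed.

Lemma slicewise_qiso (x : C) n :
  bijective (homology_map (chain_complex_map (slice_map e x) (slice_system r2 N x)) (n := n)) ->
  qsurj_at slicewise (Some x : plus C) n /\ qinj_at slicewise (Some x : plus C) n.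
Proof.
have K : forall o : slice r1 x 0%N, cancel (@idfun (N (fap g (fpl o)))) idfun by [].
move=> /(@chain_push_homology _ _ (slice_map e x) (slice_system r1 N1 x) (slice_system r2 N x)
  (fun=> idfun) (fun=> idfun) K K (@slice_map_nat x)) [sur inj]; split.
  by move=> z' /slice_cycleE /sur [z [/slice_cycleE zc zw]]; exists z.
by move=> z /slice_cycleE zc w zw; apply: (inj z zc w zw).
Qed.

Hypothesis pol1 : polygraph P1.
Hypothesis pol2 : polygraph P2.

(** At the objects of [C] the map of complexes of presheaves is the one induced by a slice of
    [g], and at the added initial object it is the one induced by [g] itself. *)
Theorem slicewise_homology :
  (forall x n, bijective (homology_map
    (chain_complex_map (slice_map e x) (slice_system r2 N x)) (n := n))) ->
  forall n, bijective (homology_map (chain_complex_map g N) (n := n)).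
Proof.
move=> bij n.
have [sur inj] := @rel_projective_qiso _ _ _ slicewise slicewise_nat slicewise_d C
  (@Some C : C -> plus C) (fun m => slice_rel_projective r1 N1 m pol1)
  (fun m => slice_rel_projective r2 N m pol2)
  (fun x m => (slicewise_qiso (bij x m)).1) (fun x m => (slicewise_qiso (bij x m)).2) None n.
apply/homology_bijE; split.
  move=> z' /(none_cycleE r2) /sur [z [zc [w ->]]].
  by exists z; split; [apply/(none_cycleE r1)|exists w].
by move=> z /(none_cycleE r1) zc w zw; apply: (inj z zc w zw).
Qed.

End SlicewiseHomology.

Lemma Hpol_mapE (P' P X' X : infcat) (p' : functor P' X') (p : functor P X)
  (f : functor X' X) (f' : functor P' P) (e : fcomp p f' = fcomp f p') (n : nat)
  (M : local_system X) :
  bijective (Hpol_map e (n := n) (M := M)) <->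
  bijective (homology_map (chain_complex_map f' (pullback p M)) (n := n)).
Proof.
rewrite /Hpol_map; move: (pullback_square e M); rewrite /Hpol.
by move: (pullback p' (pullback f M)) => L k; case: _ / k.
Qed.

Lemma polygraphic_slicewise (X : category) (X1 X2 : infcat)
    (f : functor X1 X2) (p1 : functor X1 (ofcat X)) (p2 : functor X2 (ofcat X))
    (p2f : fcomp p2 f = p1) :
  (forall x : X, polygraphic_equivalence (slice_map p2f x)) ->
  forall (M : local_system X2) (n : nat)
    (P1 P2 : infcat) (q1 : functor P1 X1) (q2 : functor P2 X2) (g : functor P1 P2)
    (e : fcomp q2 g = fcomp f q1),
    polygraphic_resolution q1 -> polygraphic_resolution q2 ->
    bijective (Hpol_map e (n := n) (M := M)).
Proof.
move=> eq M n P1 P2 q1 q2 g e res1 res2; apply/Hpol_mapE.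
have e' : fcomp (fcomp p2 q2) g = fcomp p1 q1 by rewrite -fcompA e fcompA p2f.
apply: (@slicewise_homology X P1 P2 _ _ g e' (pullback q2 M) res1.1 res2.1) => x m.
have [_ bij] := eq x.
pose s1 := slice_map (erefl (fcomp p1 q1)) x; pose s2 := slice_map (erefl (fcomp p2 q2)) x.
have sq : fcomp s2 (slice_map e' x) = fcomp (slice_map p2f x) s1.
  apply: functor_eq => k c; apply: fpcell_eq => //=.
  exact: (congr1 (fun h => fap h (fpl c)) e).
have := bij (pullback (slice_proj p2 x) M) m _ _ s1 s2 _ sq
  (slice_resolution x (erefl _) res1) (slice_resolution x (erefl _) res2).
move=> /Hpol_mapE; rewrite -pullback_fcomp.
have -> : fcomp (slice_proj p2 x) s2 = fcomp q2 (slice_proj (fcomp p2 q2) x).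
  exact: functor_eq.
by rewrite pullback_fcomp.
Qed.

(** * Groupoids, equivalences and localizations *)

Local Notation "g \oc f" := (ccomp g f) (at level 40, left associativity).

Section Isomorphisms.
Variable C : category.

Lemma iso_monic (a b c : C) (f : hom b c) (g h : hom a b) : is_iso f -> f \oc g = f \oc h -> g = h.
Proof. by case=> k kf _ e; rewrite -(ccomp_idl g) -(ccomp_idl h) -kf -!ccompA e. Qed.

Lemma iso_epic (a b c : C) (f : hom a b) (g h : hom b c) : is_iso f -> g \oc f = h \oc f -> g = h.
Proof. by case=> k _ fk e; rewrite -(ccomp_idr g) -(ccomp_idr h) -fk !ccompA e. Qed.

Definition groupoid := forall (a b : C) (f : hom a b), is_iso f.

End Isomorphisms.

Lemma nat_isomorphic_faithful (C D : category) (F : cfunctor C D) (G : cfunctor D C) :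
  nat_isomorphic (cfcomp G F) (cfid C) ->
  forall (a b : C) (f g : hom a b), cf_hom F f = cf_hom F g -> f = g.
Proof.
move=> [eta [nat iso]] a b f g e; apply: (iso_epic (iso a)).
by rewrite -[LHS]nat -[RHS]nat /= e.
Qed.

Section FullyFaithful.
Variables (C D : category) (F : cfunctor C D).
Hypothesis eqF : equivalence_of_categories F.

Lemma equivalence_faithful (a b : C) (f g : hom a b) : cf_hom F f = cf_hom F g -> f = g.
Proof. by have [G [h _]] := eqF; apply: nat_isomorphic_faithful h _ _ f g. Qed.

Lemma equivalence_full (a b : C) (g : hom (F a) (F b)) : exists f : hom a b, cf_hom F f = g.
Proof.
have [G [h h']] := eqF; have [eta [nat iso]] := h.
have [k ke ek] := iso a.
exists (eta b \oc cf_hom G g \oc k); apply: (nat_isomorphic_faithful h').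
apply: (iso_monic (iso b)); rewrite [LHS]nat /=.
by rewrite -[LHS]ccompA ke ccomp_idr.
Qed.

Lemma equivalence_surj (d : D) : exists a : C, exists _ : hom (F a) d, True.
Proof. by have [G [_ [eps _]]] := eqF; exists (G d), (eps d). Qed.

End FullyFaithful.

(** The identity of [a] with its target rewritten along an equation. *)
Definition eqh (C : category) (a b : C) (e : a = b) : hom a b := eq_rect a (hom a) (cid a) b e.

Lemma eqh_id (C : category) (a : C) (e : a = a) : eqh e = cid a.
Proof. by rewrite (Prop_irrelevance e erefl). Qed.

Lemma eqh_comp (C : category) (a b c : C) (e : a = b) (e' : b = c) (e'' : a = c) :
  eqh e' \oc eqh e = eqh e''.
Proof. by subst; rewrite !eqh_id ccomp_idl. Qed.

Lemma cf_eqh (C D : category) (F : cfunctor C D) (a b : C) (e : a = b) (e' : F a = F b) :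
  cf_hom F (eqh e) = eqh e'.
Proof. by case: b / e e' => e'; rewrite !eqh_id cf_id. Qed.

Section LocalizationTheory.
Variable C : category.
Local Notation L := (localization C).

Definition lhom (a b : C) (f : hom a b) : @hom L a b := qpi _ (w_hom f).
Definition linv (a b : C) (f : hom a b) : @hom L b a := qpi _ (w_inv f).

Lemma lhom_id (a : C) : lhom (cid a) = @cid L a.
Proof. by apply/qpiP; apply: rst_step; apply: wr_hom_id. Qed.

Lemma lhom_comp (a b c : C) (g : hom b c) (f : hom a b) :
  lhom (g \oc f) = @ccomp L _ _ _ (lhom g) (lhom f).
Proof. by rewrite [RHS]loc_comp_pi; apply/qpiP/rst_step/wr_hom_comp. Qed.

Lemma linvl (a b : C) (f : hom a b) : @ccomp L _ _ _ (linv f) (lhom f) = @cid L a.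
Proof. by rewrite [LHS]loc_comp_pi; apply/qpiP/rst_step/wr_invl. Qed.

Lemma linvr (a b : C) (f : hom a b) : @ccomp L _ _ _ (lhom f) (linv f) = @cid L b.
Proof. by rewrite [LHS]loc_comp_pi; apply/qpiP/rst_step/wr_invr. Qed.

(** Arrows of the localization are composites of arrows of [C] and of their inverses. *)
Lemma loc_ind (R : forall a b : C, @hom L a b -> Prop) :
  (forall a, R a a (@cid L a)) -> (forall a b (f : hom a b), R a b (lhom f)) ->
  (forall a b (f : hom a b), R b a (linv f)) ->
  (forall a b c (g : @hom L b c) (f : @hom L a b), R b c g -> R a b f -> R a c (g \oc f)) ->
  forall a b f, R a b f.
Proof.
move=> Rid Rhom Rinv Rcomp a b f; rewrite -[f]qreprK.
move: (qrepr f) => w {f}; elim: w => [c|c d g|c d g|c d e v hv u hu]; [exact: Rid|exact: Rhom|exact: Rinv|].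
by rewrite -loc_comp_pi; apply: Rcomp.
Qed.

Lemma localization_groupoid : groupoid L.
Proof.
apply: loc_ind => [a|a b f|a b f|a b c g f [g' g'g gg'] [f' f'f ff']].
- by exists (@cid L a); rewrite ccomp_idl.
- by exists (linv f); [apply: linvl|apply: linvr].
- by exists (lhom f); [apply: linvr|apply: linvl].
- exists (f' \oc g').
    by rewrite ccompA -(ccompA f') g'g ccomp_idr f'f.
  by rewrite ccompA -(ccompA g) ff' ccomp_idr gg'.
Qed.

(** Naturality with respect to an arrow implies naturality with respect to its inverse. *)
Lemma loc_nat (D : category) (H K : cfunctor L D) (eta : forall a : C, hom (H a) (K a)) :
  (forall (a b : C) (f : hom a b),
    eta b \oc cf_hom H (lhom f) = cf_hom K (lhom f) \oc eta a) ->
  forall (a b : C) (f : @hom L a b), eta b \oc cf_hom H f = cf_hom K f \oc eta a.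
Proof.
move=> nat; apply: loc_ind => [a|a b f|a b f|a b c g f hg hf].
- by rewrite !cf_id ccomp_idl ccomp_idr.
- exact: nat.
- rewrite -[eta a]ccomp_idl -(cf_id K a) -(linvl f) cf_comp -!ccompA; congr (_ \oc _).
  by rewrite ccompA -nat -ccompA -cf_comp linvr cf_id ccomp_idr.
- by rewrite !cf_comp ccompA hg -ccompA hf ccompA.
Qed.

Section Extension.
Variables (D : category) (grp : groupoid D) (H : cfunctor C D).

Definition ginv (a b : D) (f : hom a b) : hom b a := s2val (cid2 (grp f)).

Lemma ginvl (a b : D) (f : hom a b) : ginv f \oc f = cid a.
Proof. by rewrite /ginv; case: cid2. Qed.

Lemma ginvr (a b : D) (f : hom a b) : f \oc ginv f = cid b.
Proof. by rewrite /ginv; case: cid2. Qed.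

Fixpoint ext_word (a b : C) (w : word a b) : hom (H a) (H b) :=
  match w with
  | w_id a => cid (H a)
  | w_hom a b f => cf_hom H f
  | w_inv a b f => ginv (cf_hom H f)
  | w_comp a b c v u => ext_word v \oc ext_word u
  end.

Lemma ext_word_rel (a b : C) (w w' : word a b) : word_rel w w' -> ext_word w = ext_word w'.
Proof.
elim=> /=.
- by move=> *; apply: ccomp_idl.
- by move=> *; apply: ccomp_idr.
- by move=> *; apply: ccompA.
- by move=> *; apply: cf_id.
- by move=> *; apply: cf_comp.
- by move=> *; apply: ginvl.
- by move=> *; apply: ginvr.
- by move=> *; congr (_ \oc _).
- by move=> *; congr (_ \oc _).
Qed.

Lemma ext_word_rst (a b : C) (w w' : word a b) :
  clos_refl_sym_trans _ (@word_rel C a b) w w' -> ext_word w = ext_word w'.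
Proof. by elim=> {w w'} [w w' /ext_word_rel|w|w w' _ ->|w w' w'' _ -> _ ->]. Qed.

Definition loc_ext_hom (a b : C) (q : @hom L a b) : hom (H a) (H b) := ext_word (qrepr q).

Lemma loc_ext_pi (a b : C) (w : word a b) : loc_ext_hom (qpi _ w) = ext_word w.
Proof. exact/ext_word_rst/qrepr_pi. Qed.

Program Definition loc_ext : cfunctor L D := @CFunctor L D H loc_ext_hom _ _.
Next Obligation. exact: loc_ext_pi. Qed.
Next Obligation. by rewrite -[f]qreprK -[g]qreprK loc_comp_pi !loc_ext_pi. Qed.

Lemma loc_ext_lhom (a b : C) (f : hom a b) : cf_hom loc_ext (lhom f) = cf_hom H f.
Proof. exact: loc_ext_pi. Qed.

End Extension.
End LocalizationTheory.

(** * Fundamental groupoids *)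

Local Notation "g # phi" := (cf_hom (Pi1_map g) phi) (at level 30, right associativity).

Section FundamentalGroupoid.
Variable X : infcat.

Definition arr (a b : X 0%N) (u : hom1 a b) : @hom (Pi1 X) a b := lhom (C := c1 X) (qpi _ u).

Lemma arr_id (a : X 0%N) : arr (hom1_id a) = @cid (Pi1 X) a.
Proof. exact: lhom_id. Qed.

Lemma arr_comp (a b c : X 0%N) (v : hom1 b c) (u : hom1 a b) :
  arr (hom1_comp v u) = arr v \oc arr u.
Proof. by rewrite -lhom_comp; congr lhom; rewrite [RHS]c1_comp_pi. Qed.

Lemma arr_two_cell (a b : X 0%N) (u v : hom1 a b) : two_cell u v -> arr u = arr v.
Proof. by move=> uv; congr lhom; apply/qpiP/rst_step. Qed.

Lemma arr_congr (a b a' b' : X 0%N) (u : hom1 a b) (u' : hom1 a' b')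
    (ea : a = a') (eb : b = b') :
  (u : X 1%N) = u' -> eqh (C := Pi1 X) eb \oc arr u = arr u' \oc eqh (C := Pi1 X) ea.
Proof.
by move=> e; subst; rewrite !eqh_id ccomp_idl ccomp_idr (hom1_eq e).
Qed.

Lemma Pi1_nat (D : category) (H K : cfunctor (Pi1 X) D) (eta : forall a : X 0%N, hom (H a) (K a)) :
  (forall (a b : X 0%N) (u : hom1 a b),
    eta b \oc cf_hom H (arr u) = cf_hom K (arr u) \oc eta a) ->
  forall (a b : X 0%N) (f : @hom (Pi1 X) a b), eta b \oc cf_hom H f = cf_hom K f \oc eta a.
Proof.
move=> nat; apply: (loc_nat (C := c1 X)) => a b f.
by rewrite -[f]qreprK; apply: nat.
Qed.

End FundamentalGroupoid.

Section FundamentalGroupoidMap.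

Lemma Pi1_map_arr (X Y : infcat) (g : functor X Y) (a b : X 0%N) (u : hom1 a b) :
  g # arr u = arr (map_hom1 g u).
Proof. by rewrite [LHS]loc_map_pi /= c1_map_pi. Qed.

Lemma Pi1_fid (X : infcat) (a b : X 0%N) (f : @hom (Pi1 X) a b) : fid X # f = f.
Proof.
have := @Pi1_nat X (Pi1 X) (Pi1_map (fid X)) (cfid _) (fun a => @cid (Pi1 X) a) _ a b f.
rewrite ccomp_idl ccomp_idr; apply=> a' b' u.
rewrite ccomp_idl ccomp_idr Pi1_map_arr; congr arr; exact: hom1_eq.
Qed.

(** Functors which agree strictly may still have values that are not convertible, so equal
    composites are compared up to [eqh]. *)
Lemma Pi1_square (X Y Y' Z : infcat) (g : functor X Y) (h : functor Y Z)
    (g' : functor X Y') (h' : functor Y' Z)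
    (E : fcomp h g = fcomp h' g') (a b : X 0%N) (f : @hom (Pi1 X) a b)
    (ea : fap h (fap g a) = fap h' (fap g' a)) (eb : fap h (fap g b) = fap h' (fap g' b)) :
  eqh (C := Pi1 Z) eb \oc h # g # f = h' # g' # f \oc eqh (C := Pi1 Z) ea.
Proof.
have e (c : X 0%N) : fap h (fap g c) = fap h' (fap g' c) := congr1 (fun k => fap k c) E.
have := @Pi1_nat X (Pi1 Z) (cfcomp (Pi1_map h) (Pi1_map g)) (cfcomp (Pi1_map h') (Pi1_map g'))
  (fun a => eqh (C := Pi1 Z) (e a)) _ a b f.
rewrite (Prop_irrelevance ea (e a)) (Prop_irrelevance eb (e b)); apply=> a' b' u.
rewrite -[cf_hom (cfcomp (Pi1_map h) _) _]/(h # g # arr u).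
rewrite -[cf_hom (cfcomp (Pi1_map h') _) _]/(h' # g' # arr u) !Pi1_map_arr; apply: arr_congr.
exact: (congr1 (fun k => fap k (u : X 1%N)) E).
Qed.

End FundamentalGroupoidMap.

(** * Fundamental groupoids are detected on slices *)

Section Anchors.
Variables (C : category) (P : infcat) (r : functor P (ofcat C)).

Definition anchor (y : P 0%N) : slice r (fap r y : C) 0%N :=
  @FPCell _ _ _ r (ofcat_map (under_forget (fap r y : C))) 0 y (unit_ob (fap r y : C)) erefl.

Lemma anchor_src n (c : P n) (y : P 0%N) : src0 c = y ->
  u_ob (unit_ob (fap r y : C)) = src0 (fap r c).
Proof. by move=> <-; rewrite -fap_src. Qed.

Section AnchorLift.
Variables (y y' : P 0%N) (u : hom1 y y') (v : hom (fap r y : C) (fap r y' : C)).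
Hypothesis uv : hom_of (map_hom1 r u) = v.
Let c := scell (anchor_src (h1_src u)).

Lemma anchor_lift_src : src0 c = anchor y.
Proof. by apply: fpcell_eq; [apply: h1_src|apply: src0_olift]. Qed.

Lemma anchor_lift_trg : trg0 c = fap (slice_pre r v) (anchor y').
Proof.
apply: fpcell_eq; first exact: h1_trg.
rewrite -[LHS]/(trg0 (olift (anchor_src (h1_src u)))) trg0_olift.
have eb : u_ob (push (anchor_src (h1_src u))) = fap r y'.
  by rewrite -[RHS](congr1 (fap r) (h1_trg u)) fap_trg.
apply: (@under_ob_eq _ _ _ (under_pre_ob v (unit_ob (fap r y' : C))) eb).
rewrite (@push_hom_of _ _ _ (ltn0Sn 0) _ _ _ _ _ (map_hom1 r u) (erefl : u_ob (unit_ob _) = _) eb).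
  by rewrite /= uv ccomp_idl ccomp_idr.
by rewrite trg_id.
Qed.

(** The lift of [u] leaving the anchor of [y]; its ends are the stated ones up to equality, which
    is all that [hom1] asks for. *)
Definition anchor_lift : hom1 (anchor y) (fap (slice_pre r v) (anchor y')) :=
  Hom1 c anchor_lift_src anchor_lift_trg.

End AnchorLift.

Lemma anchor_lift_two_cell (y y' : P 0%N) (u u' : hom1 y y') v
    (e : hom_of (map_hom1 r u) = v) (e' : hom_of (map_hom1 r u') = v) :
  two_cell u u' -> two_cell (anchor_lift e) (anchor_lift e').
Proof.
case=> al [su tu].
have s0 : src0 al = y by rewrite -(src_src (leq0n 1) (leqnSn 1)) su h1_src.
by exists (scell (anchor_src s0)); split; apply: slice_eq.
Qed.

End Anchors.

Lemma slice_hom1_eq (C : category) (P : infcat) (r : functor P (ofcat C)) (x : C)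
    (o1 o2 o1' o2' : slice r x 0%N) (u : hom1 o1 o2) (u' : hom1 o1' o2') :
  o1 = o1' -> fpl (u : slice r x 1%N) = fpl (u' : slice r x 1%N) -> (u : slice r x 1%N) = u'.
Proof.
move=> e eu; apply: slice_eq => //.
by rewrite -[LHS]/(fpr (src0 (u : slice r x 1%N))) -[RHS]/(fpr (src0 (u' : slice r x 1%N))) !h1_src e.
Qed.

Lemma slice_pre_id (C : category) (P : infcat) (r : functor P (ofcat C)) (x : C) :
  slice_pre r (cid x) = fid (slice r x).
Proof.
apply: functor_eq => n c; apply: slice_eq => //.
by rewrite slice_pre_ob; case: (src0 _) => ? ?; rewrite /under_pre_ob /= ccomp_idr.
Qed.

Lemma slice_pre_comp (C : category) (P : infcat) (r : functor P (ofcat C)) (x y z : C)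
  (g : hom y z) (h : hom x y) :
  fcomp (slice_pre r h) (slice_pre r g) = slice_pre r (g \oc h).
Proof.
apply: functor_eq => n c; apply: slice_eq => //.
by rewrite -[LHS]/(src0 (fpr (fap (slice_pre r h) (fap (slice_pre r g) c))))
  !slice_pre_ob /under_pre_ob /= ccompA.
Qed.

Lemma Pi1_proj_pre (C : category) (P : infcat) (r : functor P (ofcat C)) (x y : C)
    (v : hom x y) (o o' : slice r y 0%N) (phi : @hom (Pi1 (slice r y)) o o') :
  (slice_proj r x # slice_pre r v # phi : @hom (Pi1 P) (fpl o) (fpl o')) = slice_proj r y # phi.
Proof.
have E : fcomp (slice_proj r x) (slice_pre r v) = fcomp (fid _) (slice_proj r y).
  exact: functor_eq.
have := @Pi1_square _ _ _ _ _ _ _ _ E _ _ phi erefl erefl.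
by rewrite !eqh_id ccomp_idl ccomp_idr Pi1_fid.
Qed.

Lemma Pi1_proj_eqh (C : category) (P : infcat) (r : functor P (ofcat C)) (x : C)
    (o o' : slice r x 0%N) (e : o = o') (e' : fpl o = fpl o') :
  slice_proj r x # eqh (C := Pi1 _) e = eqh (C := Pi1 P) e'.
Proof. exact: (@cf_eqh _ _ (Pi1_map (slice_proj r x))). Qed.

Section Gluing.
Variables (C : category) (X1 X2 : infcat) (f : functor X1 X2) (p : functor X2 (ofcat C)).
Local Notation p1 := (fcomp p f).
Local Notation S1 x := (slice p1 x).
Local Notation S2 x := (slice p x).
Local Notation F x := (slice_map (erefl p1) x).
Local Notation pre1 v := (slice_pre p1 v).
Local Notation pre2 v := (slice_pre p v).
Local Notation proj1 x := (slice_proj p1 x).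
Local Notation proj2 x := (slice_proj p x).
Hypothesis eqF : forall x : C, equivalence_of_categories (Pi1_map (F x)).

Let slice_sq (x y : C) (v : hom x y) : fcomp (F x) (pre1 v) = fcomp (pre2 v) (F y).
Proof. by apply: functor_eq => n c; apply: fpcell_eq. Qed.

Let sq_ob (x y : C) (v : hom x y) (w : S1 y 0%N) :
  fap (F x) (fap (pre1 v) w) = fap (pre2 v) (fap (F y) w).
Proof. exact: (congr1 (fun h => fap h w) (slice_sq v)). Qed.

Lemma local_preimage (y : X2 0%N) :
  exists w : S1 (fap p y : C) 0%N,
  exists _ : @hom (Pi1 (S2 (fap p y : C))) (fap (F _) w) (anchor p y), True.
Proof. exact: (equivalence_surj (eqF (fap p y : C)) (anchor p y)). Qed.

Definition fib (y : X2 0%N) : S1 (fap p y : C) 0%N := sval (boolp.cid (local_preimage y)).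
Definition theta (y : X2 0%N) : @hom (Pi1 (S2 (fap p y : C))) (fap (F _) (fib y)) (anchor p y) :=
  sval (boolp.cid (svalP (boolp.cid (local_preimage y)))).

Section Over.
Variables (y y' : X2 0%N) (v : hom (fap p y : C) (fap p y' : C)).
Variable rho : @hom (Pi1 (S2 (fap p y : C))) (anchor p y) (fap (pre2 v) (anchor p y')).

(** The arrow [rho] between anchors and the arrow [phi] between the chosen objects correspond to
    each other under the isomorphisms [theta]. *)
Definition over_fib (phi : @hom (Pi1 (S1 (fap p y : C))) (fib y) (fap (pre1 v) (fib y'))) :=
  pre2 v # theta y' \oc eqh (C := Pi1 _) (sq_ob v (fib y')) \oc F _ # phi = rho \oc theta y.

Definition over (g : @hom (Pi1 X1) (fpl (fib y)) (fpl (fib y'))) :=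
  exists2 phi, over_fib phi & proj1 _ # phi = g.

Lemma over_exists : exists g, over g.
Proof.
have [k _ hk] := localization_groupoid
  (pre2 v # theta y' \oc eqh (C := Pi1 _) (sq_ob v (fib y'))).
have [phi phiE] := equivalence_full (eqF _) (k \oc (rho \oc theta y)).
exists (proj1 _ # phi), phi => //.
by rewrite /over_fib phiE ccompA hk ccomp_idl.
Qed.

Lemma over_uniq g g' : over g -> over g' -> g = g'.
Proof.
case=> [phi h <-] [phi' h' <-]; suff -> : phi = phi' by [].
apply: (equivalence_faithful (eqF _)).
apply: (iso_monic (localization_groupoid
  (pre2 v # theta y' \oc eqh (C := Pi1 _) (sq_ob v (fib y'))))).
by rewrite [LHS]h [RHS]h'.
Qed.

End Over.

Lemma over_id (y : X2 0%N) (e : anchor p y = fap (pre2 (cid _)) (anchor p y)) :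
  over (eqh (C := Pi1 _) e) (@cid (Pi1 X1) (fpl (fib y))).
Proof.
have pid1 (w : S1 (fap p y : C) 0%N) : w = fap (pre1 (cid _)) w by rewrite slice_pre_id.
have pid2 (w : S2 (fap p y : C) 0%N) : w = fap (pre2 (cid _)) w by rewrite slice_pre_id.
exists (eqh (C := Pi1 _) (pid1 _)); last first.
  exact: (Pi1_proj_eqh (pid1 (fib y)) erefl).
have Fid : fap (F _) (fib y) = fap (F _) (fap (pre1 (cid _)) (fib y)) by rewrite -pid1.
have nat : fcomp (fid _) (fid _) = fcomp (pre2 (cid (fap p y : C))) (fid _).
  by rewrite slice_pre_id.
have := @Pi1_square _ _ _ _ (fid _) (fid _) (fid _) _ nat _ _ (theta y) (pid2 _) e.
rewrite !Pi1_fid => sq; rewrite /over_fib [RHS]sq -ccompA; congr (_ \oc _).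
rewrite (cf_eqh (F := Pi1_map (F _)) _ Fid).
exact: (eqh_comp (C := Pi1 _)).
Qed.

(** Correspondence is compatible with composition, the upper arrow being first restricted along
    [v]. *)
Lemma over_comp (y y' y'' : X2 0%N) (v' : hom (fap p y' : C) (fap p y'' : C))
    (v : hom (fap p y : C) (fap p y' : C)) rho' rho g' g
    (e : fap (pre2 v) (fap (pre2 v') (anchor p y'')) = fap (pre2 (v' \oc v)) (anchor p y'')) :
  over (v := v') rho' g' -> over (v := v) rho g ->
  over (eqh (C := Pi1 _) e \oc (pre2 v # rho' \oc rho)) (g' \oc g).
Proof.
case=> [phi' h' <-] [phi h <-].
have cc1 : fcomp (pre1 v) (pre1 v') = fcomp (pre1 (v' \oc v)) (fid _).
  by rewrite slice_pre_comp fcomp_idr.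
have cc2 : fcomp (pre2 v) (pre2 v') = fcomp (pre2 (v' \oc v)) (fid _).
  by rewrite slice_pre_comp fcomp_idr.
have e1 w : fap (pre1 v) (fap (pre1 v') w) = fap (pre1 (v' \oc v)) w :> S1 _ 0%N.
  exact: (congr1 (fun h => fap h w) cc1).
have e2 w : fap (pre2 v) (fap (pre2 v') w) = fap (pre2 (v' \oc v)) w :> S2 _ 0%N.
  exact: (congr1 (fun h => fap h w) cc2).
exists (eqh (C := Pi1 _) (e1 (fib y'')) \oc (pre1 v # phi' \oc phi)); last first.
  rewrite !cf_comp (Pi1_proj_eqh (e1 (fib y'')) erefl).
  rewrite [LHS](@ccomp_idl (Pi1 X1)); congr (@ccomp (Pi1 X1) _ _ _ _ _).
  exact: (@Pi1_proj_pre _ _ p1 _ _ v _ _ phi').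
have E1 := @Pi1_square _ _ _ _ _ _ _ _ cc2 _ _ (theta y'') (e2 _) e.
rewrite Pi1_fid in E1.
have E2 := @Pi1_square _ _ _ _ _ _ _ _ (slice_sq v) _ _ phi' (sq_ob v (fib y'))
  (sq_ob v (fap (pre1 v') (fib y''))).
have F1 : fap (F _) (fap (pre1 v) (fap (pre1 v') (fib y''))) =
    fap (F _) (fap (pre1 (v' \oc v)) (fib y'')) by rewrite e1.
have F2 : fap (pre2 v) (fap (F _) (fap (pre1 v') (fib y''))) =
    fap (pre2 v) (fap (pre2 v') (fap (F _) (fib y''))) by rewrite sq_ob.
rewrite /over_fib -[RHS]ccompA -[X in _ = _ \oc X]ccompA -h.
rewrite -[X in _ = _ \oc (_ \oc X)]ccompA [X in _ = _ \oc X]ccompA -cf_comp -h' !cf_comp.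
rewrite (cf_eqh (F := Pi1_map (pre2 v)) _ F2) (cf_eqh (F := Pi1_map (F _)) _ F1).
rewrite !ccompA E1 -!(ccompA _ (pre2 v # F _ # phi')) -E2 !ccompA.
congr (_ \oc _); congr (_ \oc _).
rewrite -!ccompA; congr (_ \oc _).
rewrite (eqh_comp (C := Pi1 _) _ _ (etrans (sq_ob _ _) F2)).
rewrite (eqh_comp (C := Pi1 _) _ _ (etrans F1 (sq_ob _ _))).
exact/esym/(eqh_comp (C := Pi1 _)).
Qed.

Lemma anchor_lift_comp (y y' y'' : X2 0%N) (u' : hom1 y' y'') (u : hom1 y y') v' v
    (ev' : hom_of (map_hom1 p u') = v') (ev : hom_of (map_hom1 p u) = v)
    (ev'' : hom_of (map_hom1 p (hom1_comp u' u)) = v' \oc v)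
    (e : fap (pre2 v) (fap (pre2 v') (anchor p y'')) = fap (pre2 (v' \oc v)) (anchor p y'')) :
  arr (anchor_lift ev'') =
  eqh (C := Pi1 _) e \oc (pre2 v # arr (anchor_lift ev') \oc arr (anchor_lift ev)).
Proof.
rewrite Pi1_map_arr -arr_comp (arr_congr (u' := anchor_lift ev'') erefl) ?eqh_id ?ccomp_idr //.
apply: slice_hom1_eq => //; exact: comp_congr.
Qed.

(** The arrow between the chosen objects that corresponds to the lift of [u]. *)
Definition glue (y y' : X2 0%N) (u : hom1 y y') : @hom (Pi1 X1) (fpl (fib y)) (fpl (fib y')) :=
  sval (boolp.cid (over_exists (arr (anchor_lift (erefl (hom_of (map_hom1 p u))))))).

Lemma over_glue (y y' : X2 0%N) (u : hom1 y y') v (e : hom_of (map_hom1 p u) = v) :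
  over (arr (anchor_lift e)) (glue u).
Proof. by subst v; apply: svalP. Qed.

Lemma glue_two_cell (y y' : X2 0%N) (u u' : hom1 y y') : two_cell u u' -> glue u = glue u'.
Proof.
move=> uu'; have e := hom_of_two_cell (map_two_cell p uu').
apply: over_uniq (over_glue e) _.
by rewrite (arr_two_cell (anchor_lift_two_cell e erefl uu')); apply: over_glue.
Qed.

Lemma glue_id (y : X2 0%N) : glue (hom1_id y) = @cid (Pi1 X1) (fpl (fib y)).
Proof.
have e : hom_of (map_hom1 p (hom1_id y)) = cid (fap p y : C).
  by rewrite map_hom1_id hom_of_id.
have ea : anchor p y = fap (pre2 (cid (fap p y : C))) (anchor p y) by rewrite slice_pre_id.
apply: over_uniq (over_glue e) _.
suff -> : arr (anchor_lift e) = eqh (C := Pi1 _) ea by apply: over_id.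
have := @arr_congr _ _ _ _ _ (hom1_id (anchor p y)) (anchor_lift e) erefl ea.
rewrite arr_id eqh_id !ccomp_idr => -> //; apply: slice_hom1_eq => //.
Qed.

Lemma glue_comp (y y' y'' : X2 0%N) (u' : hom1 y' y'') (u : hom1 y y') :
  glue (hom1_comp u' u) = glue u' \oc glue u.
Proof.
set v' := hom_of (map_hom1 p u'); set v := hom_of (map_hom1 p u).
have ev : hom_of (map_hom1 p (hom1_comp u' u)) = v' \oc v by rewrite map_hom1_comp hom_of_comp.
have e : fap (pre2 v) (fap (pre2 v') (anchor p y'')) = fap (pre2 (v' \oc v)) (anchor p y'').
  by rewrite -slice_pre_comp.
apply: over_uniq (over_glue ev) _.
rewrite (anchor_lift_comp (erefl v') (erefl v) ev e).
by apply: over_comp; apply: over_glue.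
Qed.

Definition glue_c1_hom (y y' : X2 0%N) (q : c1_hom y y') := glue (qrepr q).

Lemma glue_c1_pi (y y' : X2 0%N) (u : hom1 y y') : glue_c1_hom (qpi _ u) = glue u.
Proof.
have rst w w' : clos_refl_sym_trans _ (@two_cell X2 y y') w w' -> glue w = glue w'.
  by elim=> {w w'} [w w' /glue_two_cell|w|w w' _ ->|w w' w'' _ -> _ ->].
exact/rst/qrepr_pi.
Qed.

Program Definition glue_c1 : cfunctor (c1 X2) (Pi1 X1) :=
  @CFunctor (c1 X2) (Pi1 X1) (fun y => fpl (fib y)) glue_c1_hom _ _.
Next Obligation. by rewrite [LHS]glue_c1_pi glue_id. Qed.
Next Obligation.
by rewrite -[f0]qreprK -[g]qreprK [X in glue_c1_hom X]c1_comp_pi !glue_c1_pi glue_comp.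
Qed.

Definition glued : cfunctor (Pi1 X2) (Pi1 X1) :=
  loc_ext (@localization_groupoid (c1 X1)) glue_c1.

Lemma glued_arr (y y' : X2 0%N) (u : hom1 y y') : cf_hom glued (arr u) = glue u.
Proof. by rewrite [LHS]loc_ext_lhom; apply: glue_c1_pi. Qed.

(** The isomorphism is the projection of [theta] to [X2]. *)
Lemma glued_right : nat_isomorphic (cfcomp (Pi1_map f) glued) (cfid (Pi1 X2)).
Proof.
exists (fun y => proj2 _ # theta y); split=> [|y]; last exact: localization_groupoid.
apply: (Pi1_nat (K := cfid _) (H := cfcomp (Pi1_map f) glued)) => y y' u.
rewrite -[cf_hom (cfcomp _ _) _]/(f # cf_hom glued (arr u)) glued_arr.
rewrite -[cf_hom (cfid _) _]/(arr u).
set v := hom_of (map_hom1 p u).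
have [phi h <-] := over_glue (erefl v).
have := congr1 (@cf_hom _ _ (Pi1_map (proj2 _)) _ _) h; rewrite !cf_comp.
rewrite (Pi1_proj_eqh (sq_ob v (fib y')) erefl) Pi1_map_arr.
have -> : proj2 _ # F _ # phi = f # proj1 _ # phi.
  have E : fcomp (proj2 (fap p y)) (F _) = fcomp f (proj1 (fap p y)) by apply: functor_eq.
  by have := @Pi1_square _ _ _ _ _ _ _ _ E _ _ phi erefl erefl;
    rewrite !eqh_id ccomp_idl ccomp_idr.
have -> : arr u = arr (map_hom1 (proj2 _) (anchor_lift (erefl v))).
  by congr arr; apply: hom1_eq.
move=> <-; rewrite eqh_id ccomp_idr; congr (@ccomp (Pi1 X2) _ _ _ _ _).
by rewrite -(@Pi1_proj_pre _ _ p _ _ v).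
Qed.

Let base (w : X1 0%N) : S1 (fap p (fap f w) : C) 0%N := anchor p1 w.

Let base_ob (w : X1 0%N) : anchor p (fap f w) = fap (F _) (base w).
Proof. exact: fpcell_eq. Qed.

(** The slice of [f] being full, the isomorphism between the chosen object and the anchor of
    [f w] comes from an arrow to the anchor of [w] in the slice of [X1]. *)
Lemma glued_left : nat_isomorphic (cfcomp glued (Pi1_map f)) (cfid (Pi1 X1)).
Proof.
have ex (w : X1 0%N) : exists k : @hom (Pi1 (S1 (fap p (fap f w) : C))) (fib (fap f w)) (base w),
    F _ # k = eqh (C := Pi1 _) (base_ob w) \oc theta (fap f w).
  exact: (equivalence_full (eqF _)).
pose kappa w := sval (boolp.cid (ex w)).
have kappaE w : F _ # kappa w = eqh (C := Pi1 _) (base_ob w) \oc theta (fap f w).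
  exact: (svalP (boolp.cid (ex w))).
exists (fun w => proj1 _ # kappa w); split=> [|w]; last exact: localization_groupoid.
apply: (Pi1_nat (H := cfcomp glued (Pi1_map f)) (K := cfid _)) => w w' u.
rewrite -[cf_hom (cfcomp _ _) _]/(cf_hom glued (f # arr u)) Pi1_map_arr glued_arr.
rewrite -[cf_hom (cfid _) _]/(arr u).
set v := hom_of (map_hom1 p (map_hom1 f u)).
have [phi h <-] := over_glue (erefl v).
have ev : hom_of (map_hom1 p1 u) = v by apply: hom_of_congr.
have -> : arr u = arr (map_hom1 (proj1 _) (anchor_lift ev)).
  by congr arr; apply: hom1_eq.
rewrite -Pi1_map_arr -[proj1 _ # kappa w'](@Pi1_proj_pre _ _ p1 _ _ v).
suff e : pre1 v # kappa w' \oc phi = arr (anchor_lift ev) \oc kappa w.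
  by have := congr1 (@cf_hom _ _ (Pi1_map (proj1 _)) _ _) e; rewrite !cf_comp.
apply: (equivalence_faithful (eqF _)); rewrite !cf_comp kappaE.
have b1 : fap (pre2 v) (anchor p (fap f w')) = fap (pre2 v) (fap (F _) (base w')).
  by rewrite base_ob.
have b2 : fap (pre2 v) (anchor p (fap f w')) = fap (F _) (fap (pre1 v) (base w')).
  by rewrite sq_ob.
apply: (iso_monic (localization_groupoid (eqh (C := Pi1 _) (sq_ob v (base w'))))).
rewrite 2!ccompA (Pi1_square (slice_sq v) _ (sq_ob v (fib (fap f w')))) kappaE cf_comp.
rewrite (cf_eqh (F := Pi1_map (pre2 v)) _ b1) -!ccompA [_ \oc (_ \oc F _ # phi)]ccompA h.
rewrite Pi1_map_arr [X in _ = _ \oc X]ccompA.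
rewrite -(@arr_congr _ _ _ _ _ (anchor_lift (erefl v)) _ (base_ob w) b2); last first.
  by apply: slice_hom1_eq => //; exact: base_ob.
by rewrite !ccompA (eqh_comp (C := Pi1 _) _ _ b1).
Qed.

Theorem slicewise_Pi1 : equivalence_of_categories (Pi1_map f).
Proof. by exists glued; split; [apply: glued_left|apply: glued_right]. Qed.

End Gluing.

Theorem proposition6p9 (X : category) (X1 X2 : infcat)
    (f : functor X1 X2) (p1 : functor X1 (ofcat X)) (p2 : functor X2 (ofcat X))
    (p2f : fcomp p2 f = p1) :
  (forall x : X, polygraphic_equivalence (slice_map p2f x)) ->
  polygraphic_equivalence f.
Proof.
move=> eqv; split; last exact: polygraphic_slicewise eqv.
by case: p1 / p2f eqv => eqv; apply: slicewise_Pi1 => x; exact: (eqv x).1.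
Qed.
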